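(* Let $G=\mathrm{GL}(2,D)$, let $B$ be the subgroup of upper triangular matrices, and let $\rho$ be a smooth irreducible admissible representation of $B$ over $\overline{\mathbb{F}}_p$. (i) If $\rho=\rho_0\circ\det_G|_B$ for some character $\rho_0:F^\times\to\overline{\mathbb{F}}_p^\times$, then $\mathrm{Ind}_B^G\,\rho$ is a non-split extension of two irreducible non-isomorphic representations of $G$: $$0\to \rho_0\circ\det\nolimits_G\to \mathrm{Ind}_B^G\,\rho\to \mathrm{St}\,\rho_0\to 0,$$ where $\mathrm{St}\,\rho_0$ is defined as the quotient of $\mathrm{Ind}_B^G\,\rho$ by $\rho_0\circ\det_G$. (ii) If there is no character $\rho_0$ of $F^\times$ with $\rho=\rho_0\circ\det_G$ on $B$, then $\mathrm{Ind}_B^G\,\rho$ is irreducible.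
   Context: $F$ is a non-archimedean locally compact local field of residue characteristic $p$; $D$ is a central division algebra over $F$ of dimension $d^2$, $d\ge 1$. All representations (and characters) are smooth with coefficients in $\overline{\mathbb{F}}_p$. $\det_G:\mathrm{GL}(2,D)\to F^\times$ is the reduced norm of the central simple algebra $M_2(D)$; on an upper triangular matrix with diagonal $(a,b)$ it equals $\mathrm{Nrm}(a)\mathrm{Nrm}(b)$, where $\mathrm{Nrm}:D^\times\to F^\times$ is the reduced norm. $\mathrm{Ind}_B^G\,\rho$ is smooth (unnormalized) parabolic induction: smooth functions $f:G\to\rho$ with $f(bg)=\rho(b)f(g)$, with $G$ acting by right translation. The embedding of $\rho_0\circ\det_G$ in $\mathrm{Ind}_B^G\,\rho$ is as the line spanned by the function $\rho_0\circ\det_G$. *)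

(* Defs.v *)
From HB Require Import structures.
From mathcomp Require Import all_boot all_order all_algebra all_field.
From mathcomp Require Import all_classical all_reals topology tvs.

Set Implicit Arguments.
Unset Strict Implicit.
Unset Printing Implicit Defensive.

Import Order.TTheory GRing.Theory Num.Theory.

Local Open Scope classical_set_scope.
Local Open Scope ring_scope.

HB.mixin Record hasContinuousMul R & Topological R & GRing.NzRing R := {
  mulr_continuous : continuous (fun x : R * R => x.1 * x.2)
}.

#[short(type="topologicalNzRingType")]
HB.structure Definition TopologicalNzRing :=
  {R of TopologicalZmodule R & GRing.NzRing R & hasContinuousMul R}.

#[short(type="topologicalFieldType")]
HB.structure Definition TopologicalField :=
  {F of TopologicalNzRing F & GRing.Field F}.

HB.mixin Record isTopologicalGroup G & Topological G & Group G := {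
  mulg_continuous : continuous (fun x : G * G => (x.1 * x.2)%g);
  invg_continuous : continuous (fun x : G => (x^-1)%g)
}.

#[short(type="topologicalGroupType")]
HB.structure Definition TopologicalGroup :=
  {G of Topological G & Group G & isTopologicalGroup G}.

(* The unit group of a ring that need not have a computable inverse (here     *)
(* 'M[D]_2 with D noncommutative): a unit is stored with its inverse.         *)
Section Units.
Variable R : nzRingType.

Definition units : Type :=
  {x : R * R | (x.1 * x.2 == 1) && (x.2 * x.1 == 1)}.

HB.instance Definition _ := Choice.copy units
  {x : R * R | (x.1 * x.2 == 1) && (x.2 * x.1 == 1)}.

Definition uval (u : units) : R := (sval u).1.
Definition uinv (u : units) : R := (sval u).2.

Lemma uvalK u : uval u * uinv u = 1.
Proof. by case: u => -[x y] /= xyP; case/andP: (xyP) => /eqP. Qed.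

Lemma uinvK u : uinv u * uval u = 1.
Proof. by case: u => -[x y] /= xyP; case/andP: (xyP) => _ /eqP. Qed.

Lemma units_inj (u v : units) : uval u = uval v -> u = v.
Proof.
move=> uv; suff uv' : uinv u = uinv v.
  apply/val_inj; rewrite /= [LHS]surjective_pairing [RHS]surjective_pairing.
  by congr (_, _).
by rewrite -[uinv u]mulr1 -(uvalK v) -uv mulrA uinvK mul1r.
Qed.

Definition mk_unit (x y : R) (xy : x * y = 1) (yx : y * x = 1) : units :=
  exist _ (x, y) (introT andP (conj (introT eqP xy) (introT eqP yx))).

Definition unit_one : units := mk_unit (mul1r 1) (mul1r 1).
Definition unit_inv (u : units) : units := mk_unit (uinvK u) (uvalK u).

Fact unit_mul_subproof u v : uval u * uval v * (uinv v * uinv u) = 1.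
Proof. by rewrite mulrA -(mulrA (uval u)) uvalK mulr1 uvalK. Qed.
Fact unit_mul_subproof' u v : uinv v * uinv u * (uval u * uval v) = 1.
Proof. by rewrite mulrA -(mulrA (uinv v)) uinvK mulr1 uinvK. Qed.
Definition unit_mul u v : units :=
  mk_unit (unit_mul_subproof u v) (unit_mul_subproof' u v).

Fact unit_mulA : associative unit_mul.
Proof. by move=> u v w; apply/units_inj/mulrA. Qed.
Fact unit_mul1 : left_id unit_one unit_mul.
Proof. by move=> u; apply/units_inj/mul1r. Qed.
Fact unit_1mul : right_id unit_one unit_mul.
Proof. by move=> u; apply/units_inj/mulr1. Qed.
Fact unit_mulV : left_inverse unit_one unit_inv unit_mul.
Proof. by move=> u; apply/units_inj/uinvK. Qed.
Fact unit_Vmul : right_inverse unit_one unit_inv unit_mul.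
Proof. by move=> u; apply/units_inj/uvalK. Qed.

HB.instance Definition _ := isGroup.Build units
  unit_mulA unit_mul1 unit_1mul unit_mulV unit_Vmul.

End Units.


(* Units carry the topology induced by u |-> (u, u^-1), the usual topology    *)
(* making them a topological group. Over a local field inversion is           *)
(* continuous, so for F^* and GL(2, D) this is the subspace topology.         *)
Section UnitsTopology.
Variable R : topologicalNzRingType.

HB.instance Definition _ := Topological.copy (units R)
  (initial_topology (fun u : units R => (uval u, uinv u))).

Lemma uval_continuous : continuous (@uval R).
Proof.
move=> u; apply: (@continuous_comp _ _ _
  (fun u : units R => (uval u, uinv u)) fst); last exact: cvg_fst.
exact: (@initial_continuous _ _ (fun u : units R => (uval u, uinv u))).
Qed.

Lemma uinv_continuous : continuous (@uinv R).
Proof.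
move=> u; apply: (@continuous_comp _ _ _
  (fun u : units R => (uval u, uinv u)) snd); last exact: cvg_snd.
exact: (@initial_continuous _ _ (fun u : units R => (uval u, uinv u))).
Qed.

Lemma continuous_units (X : topologicalType) (f : X -> units R) :
  continuous (@uval R \o f) -> continuous (@uinv R \o f) -> continuous f.
Proof.
move=> cf cf'; apply: (@continuous_comp_initial _ _ _
  (fun u : units R => (uval u, uinv u)) f) => x.
by apply: (@cvg_pair _ _ _ _ (nbhs _) (nbhs _)); [exact: cf|exact: cf'].
Qed.

Lemma continuousM2 (X : topologicalType) (f g : X -> R) :
  continuous f -> continuous g -> continuous (fun x => f x * g x).
Proof.
move=> cf cg x; apply: (@continuous_comp _ _ _ (fun x => (f x, g x))
  (fun x : R * R => x.1 * x.2)); last exact: mulr_continuous.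
by apply: (@cvg_pair _ _ _ _ (nbhs (f x)) (nbhs (g x))); [exact: cf|exact: cg].
Qed.

Fact units_mulg_continuous :
  continuous (fun x : units R * units R => (x.1 * x.2)%g).
Proof.
have c1 (h : units R -> R) : continuous h ->
    continuous (h \o @fst (units R) (units R)).
  by move=> ch x; apply: continuous_comp; [exact: cvg_fst|exact: ch].
have c2 (h : units R -> R) : continuous h ->
    continuous (h \o @snd (units R) (units R)).
  by move=> ch x; apply: continuous_comp; [exact: cvg_snd|exact: ch].
apply: continuous_units.
  exact: (continuousM2 (c1 _ uval_continuous) (c2 _ uval_continuous)).
exact: (continuousM2 (c2 _ uinv_continuous) (c1 _ uinv_continuous)).
Qed.

Fact units_invg_continuous : continuous (fun x : units R => (x^-1)%g).
Proof.
by apply: continuous_units; [exact: uinv_continuous|exact: uval_continuous].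
Qed.

HB.instance Definition _ := isTopologicalGroup.Build (units R)
  units_mulg_continuous units_invg_continuous.

End UnitsTopology.

Lemma continuous_mx (X T : topologicalType) m n (f : X -> 'M[T]_(m, n)) :
  (forall i j, continuous (fun x => f x i j)) -> continuous f.
Proof.
move=> cf x A /= [P xP PA]; rewrite nbhs_simpl /=.
have : \forall y \near x, forall i j, P i j (f y i j).
  apply: filter_forall => i; apply: filter_forall => j.
  exact: (cf i j x _ (xP i j)).
by apply: filterS => y Py; apply: PA.
Qed.

Lemma continuous_mxcoord (T : topologicalType) m n i j :
  continuous (fun M : 'M[T]_(m, n) => M i j).
Proof.
move=> M A MA; exists (fun i' j' => if (i' == i) && (j' == j) then A else setT).
  move=> i' j'; case: ifP => [/andP[/eqP-> /eqP->] //|_]; exact: filterT.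
by move=> N /= /(_ i j); rewrite !eqxx.
Qed.

Lemma continuousD2 (X : topologicalType) (M : topologicalZmodType)
    (f g : X -> M) :
  continuous f -> continuous g -> continuous (fun x => f x + g x).
Proof.
move=> cf cg x; apply: (@continuous_comp _ _ _ (fun x => (f x, g x))
  (fun x : M * M => x.1 + x.2)); last exact: add_continuous.
by apply: (@cvg_pair _ _ _ _ (nbhs (f x)) (nbhs (g x))); [exact: cf|exact: cg].
Qed.

Lemma continuous_fst (X Y Z : topologicalType) (h : X -> Z) :
  continuous h -> continuous (fun x : X * Y => h x.1).
Proof. by move=> ch x; apply: continuous_comp; [exact: cvg_fst|exact: ch]. Qed.

Lemma continuous_snd (X Y Z : topologicalType) (h : Y -> Z) :
  continuous h -> continuous (fun x : X * Y => h x.2).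
Proof. by move=> ch x; apply: continuous_comp; [exact: cvg_snd|exact: ch]. Qed.

(* A finite-dimensional F-algebra with its canonical topology, the product    *)
(* topology of F^n transported by the coordinates in a basis; as operations   *)
(* of F are continuous, the choice of the basis is irrelevant.                *)
Definition algtop (F : topologicalFieldType) (D : falgType F) : Type := D.

Section AlgTop.
Variables (F : topologicalFieldType) (D : falgType F).
Local Notation T := (algtop D).

HB.instance Definition _ := Falgebra.copy T D.
HB.instance Definition _ := Topological.copy T (initial_topology
  (fun x : T => \row_(i < \dim {:D}) coord (vbasis {:D}) i (x : D))).

Lemma coord_continuous i : continuous (fun x : T => coord (vbasis {:D}) i (x : D)).
Proof.
pose r (x : T) : 'rV[F]_(\dim {:D}) := \row_i coord (vbasis {:D}) i (x : D).
rewrite [X in continuous X](_ : _ = fun x : T => r x 0 i); last first.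
  by apply/funext => x; rewrite mxE.
move=> x; apply: (@continuous_comp _ _ _ r (fun r : 'rV_ _ => r 0 i)).
  exact: (@initial_continuous _ _ r).
exact: continuous_mxcoord.
Qed.

Lemma continuous_algtop (X : topologicalType) (f : X -> T) :
  (forall i, continuous (fun x => coord (vbasis {:D}) i (f x : D))) ->
  continuous f.
Proof.
pose r (x : T) : 'rV[F]_(\dim {:D}) := \row_i coord (vbasis {:D}) i (x : D).
move=> cf; apply: (@continuous_comp_initial _ _ _ r f).
apply: continuous_mx => i j.
rewrite [X in continuous X](_ : _ = fun x => coord (vbasis {:D}) j (f x : D)).
  exact: cf.
by apply/funext => x; rewrite mxE.
Qed.

Fact algtop_opp_continuous : continuous (-%R : T -> T).
Proof.
apply: continuous_algtop => i.
rewrite [X in continuous X](_ : _ = fun x : T =>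
    - coord (vbasis {:D}) i (x : D)); last by apply/funext => x; rewrite linearN.
move=> x; apply: (@continuous_comp _ _ _
  (fun x : T => coord (vbasis {:D}) i (x : D)) -%R); first exact: coord_continuous.
exact: opp_continuous.
Qed.

Fact algtop_add_continuous : continuous (fun x : T * T => x.1 + x.2).
Proof.
apply: continuous_algtop => i.
rewrite [X in continuous X](_ : _ = fun x : T * T =>
    coord (vbasis {:D}) i (x.1 : D) + coord (vbasis {:D}) i (x.2 : D)); last first.
  by apply/funext => x; rewrite linearD.
apply: continuousD2; first exact: (continuous_fst (@coord_continuous i)).
exact: (continuous_snd (@coord_continuous i)).
Qed.

Fact algtop_mul_continuous : continuous (fun x : T * T => x.1 * x.2).
Proof.
pose c (x : D) i := coord (vbasis {:D}) i x.
pose e i : D := (vbasis {:D})`_i.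
have eE (x : D) : x = \sum_i c x i *: e i by exact: (coord_vbasis (memvf x)).
apply: continuous_algtop => k.
rewrite [X in continuous X](_ : _ = fun x : T * T =>
    \sum_i \sum_j c x.1 i * c x.2 j * c (e i * e j) k); last first.
  apply/funext => x; rewrite [x.1 in LHS]eE [x.2 in LHS]eE.
  rewrite big_distrl linear_sum; apply: eq_bigr => i _.
  rewrite big_distrr linear_sum; apply: eq_bigr => j _ /=.
  by rewrite -scalerAl -scalerAr scalerA linearZ.
apply: continuous_big => [|i _]; first exact: add_continuous.
apply: continuous_big => [|j _]; first exact: add_continuous.
apply: continuousM2; last by move=> x; exact: cvg_cst.
apply: continuousM2; first exact: (continuous_fst (@coord_continuous i)).
exact: (continuous_snd (@coord_continuous j)).
Qed.

HB.instance Definition _ := PreTopologicalNmodule_isTopologicalNmodule.Build T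
  algtop_add_continuous.
HB.instance Definition _ := TopologicalNmodule_isTopologicalZmodule.Build T
  algtop_opp_continuous.
HB.instance Definition _ := hasContinuousMul.Build T algtop_mul_continuous.

End AlgTop.

(* An alias of 'M[R]_2, so that its topological ring structure does not       *)
(* compete with the normed module structure that matrix_normedtype gives to   *)
(* matrices over a numFieldType.                                              *)
Definition mat2 (R : Type) : Type := 'M[R]_2.

HB.instance Definition _ (R : nzRingType) := GRing.NzRing.copy (mat2 R) 'M[R]_2.

Section Mat2Top.
Variable R : topologicalNzRingType.
Local Notation M := (mat2 R).

HB.instance Definition _ := Topological.copy M 'M[R]_2.

Let cE i j : continuous (fun m : M => m i j).
Proof. exact: (@continuous_mxcoord R 2 2 i j). Qed.

Fact mat2_opp_continuous : continuous (-%R : M -> M).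
Proof.
apply: (@continuous_mx _ R 2 2) => i j.
rewrite [X in continuous X](_ : _ = fun m : M => - (m i j)); last first.
  by apply/funext => x; rewrite mxE.
move=> x; apply: (@continuous_comp _ _ _ (fun m : M => m i j) -%R).
  exact: cE.
exact: opp_continuous.
Qed.

Fact mat2_add_continuous : continuous (fun x : M * M => x.1 + x.2).
Proof.
apply: (@continuous_mx _ R 2 2) => i j.
rewrite [X in continuous X](_ : _ = fun x : M * M => x.1 i j + x.2 i j); last first.
  by apply/funext => x; rewrite mxE.
by apply: continuousD2; [exact: (continuous_fst (@cE i j))
                        |exact: (continuous_snd (@cE i j))].
Qed.

Fact mat2_mul_continuous : continuous (fun x : M * M => x.1 * x.2).
Proof.
apply: (@continuous_mx _ R 2 2) => i j.
rewrite [X in continuous X](_ : _ = fun x : M * M =>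
    \sum_k x.1 i k * x.2 k j); last first.
  by apply/funext => x; rewrite mxE.
apply: continuous_big => [|k _]; first exact: add_continuous.
by apply: continuousM2; [exact: (continuous_fst (@cE i k))
                        |exact: (continuous_snd (@cE k j))].
Qed.

HB.instance Definition _ := PreTopologicalNmodule_isTopologicalNmodule.Build M
  mat2_add_continuous.
HB.instance Definition _ := TopologicalNmodule_isTopologicalZmodule.Build M
  mat2_opp_continuous.
HB.instance Definition _ := hasContinuousMul.Build M mat2_mul_continuous.

End Mat2Top.

(* The quotient of V by the image of a linear map f : W -> V.                 *)
Section LmodCokernel.
Variables (K : pzRingType) (W V : lmodType K) (f : {linear W -> V}).

Definition limage : {pred V} := fun v => `[< exists w, f w = v >].

Lemma limageP v : reflect (exists w, f w = v) (v \in limage).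
Proof. exact: asboolP. Qed.

Fact limage_submod : submod_closed limage.
Proof.
split; first by apply/limageP; exists 0; rewrite linear0.
move=> a _ _ /limageP[v <-] /limageP[w <-].
by apply/limageP; exists (a *: v + w); rewrite linearP.
Qed.

HB.instance Definition _ := GRing.isSubmodClosed.Build K V limage limage_submod.

Local Notation Q := (Quotient.quot limage).

Definition lcoker : Type := Q.

HB.instance Definition _ := GRing.Zmodule.copy lcoker Q.

Definition lmodpi (v : V) : lcoker := (\pi_Q v)%qT.
Definition lmodrepr (x : lcoker) : V := repr (x : Q).

Lemma lmodreprK : cancel lmodrepr lmodpi.
Proof. exact: (@reprK _ Q). Qed.

Lemma lmodpi_eq v w : lmodpi v = lmodpi w <-> v - w \in limage.
Proof.
rewrite Quotient.idealrBE /lmodpi.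
by split=> [->|/eqP].
Qed.

Lemma lmodpiD v w : lmodpi (v + w) = lmodpi v + lmodpi w.
Proof. exact: (raddfD (\pi_Q)%qT). Qed.

Definition lcoker_scale (a : K) (x : lcoker) := lmodpi (a *: lmodrepr x).

Lemma lmodpiZ a v : lmodpi (a *: v) = lcoker_scale a (lmodpi v).
Proof.
apply/lmodpi_eq; rewrite -scalerBr rpredZ //.
by apply/lmodpi_eq; rewrite lmodreprK.
Qed.

Fact lcoker_scaleA a b x :
  lcoker_scale a (lcoker_scale b x) = lcoker_scale (a * b) x.
Proof. by rewrite -[x]lmodreprK -!lmodpiZ scalerA. Qed.
Fact lcoker_scale1 : left_id 1 lcoker_scale.
Proof. by move=> x; rewrite -[x]lmodreprK -!lmodpiZ scale1r. Qed.
Fact lcoker_scaleDr : right_distributive lcoker_scale +%R.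
Proof.
move=> a x y; rewrite -[x]lmodreprK -[y]lmodreprK -lmodpiD -!lmodpiZ.
by rewrite scalerDr lmodpiD.
Qed.
Fact lcoker_scaleDl x : {morph lcoker_scale^~ x : a b / a + b}.
Proof. by move=> a b; rewrite -[x]lmodreprK -!lmodpiZ scalerDl lmodpiD. Qed.

HB.instance Definition _ := GRing.Zmodule_isLmodule.Build K lcoker
  lcoker_scaleA lcoker_scale1 lcoker_scaleDr lcoker_scaleDl.

Fact lmodpi_is_linear : linear lmodpi.
Proof. by move=> a v w; rewrite lmodpiD lmodpiZ. Qed.
HB.instance Definition _ := GRing.isLinear.Build K V lcoker _ lmodpi
  lmodpi_is_linear.

End LmodCokernel.

Section Representations.
Variables (K : fieldType) (G : topologicalGroupType).
Implicit Types H U : set G.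

(* A representation of a subgroup H of G. As for {morphism H >-> _}, the      *)
(* action is a function on all of G whose values outside H are irrelevant.    *)
Record rep H := Rep {
  rep_space :> lmodType K;
  rep_act : G -> {linear rep_space -> rep_space};
  rep_act1 : rep_act 1%g =1 id;
  rep_actM : forall g h, H g -> H h ->
    rep_act (g * h)%g =1 rep_act g \o rep_act h
}.

Record rep_hom H (V W : rep H) := RepHom {
  hom_fun :> {linear V -> W};
  hom_act : forall g v, H g -> hom_fun (rep_act V g v) = rep_act W g (hom_fun v)
}.

Definition rep_iso H (V W : rep H) : Prop :=
  exists f : rep_hom V W, bijective f.

Definition irreducible H (V : rep H) : Prop :=
  (exists v : V, v != 0) /\
  forall S : {pred V}, submod_closed S ->
    (forall g v, H g -> v \in S -> rep_act V g v \in S) ->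
    (forall v, v \in S -> v = 0) \/ (forall v, v \in S).

(* Openness for the subspace topology of H. *)
Definition open_in H : set (set G) :=
  [set A | exists2 O : set G, open O & A = O `&` H].

Definition open_subgroup H U : Prop := group_closed (mem U) /\ open_in H U.

Definition stabilizer H (V : rep H) (v : V) : set G :=
  [set g | H g /\ rep_act V g v = v].

Definition smooth H (V : rep H) : Prop :=
  forall v : V, open_in H (stabilizer v).

Definition invariants H (V : rep H) U : set V :=
  [set v | forall g, U g -> rep_act V g v = v].
Arguments invariants {H} V U.

Definition finite_dimensional (V : lmodType K) (A : set V) : Prop :=
  exists (n : nat) (e : 'I_n -> V),
    forall v, A v -> exists c : 'I_n -> K, v = \sum_i c i *: e i.

Definition admissible H (V : rep H) : Prop :=
  smooth V /\
  forall U, open_subgroup H U -> finite_dimensional (invariants V U).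

Section Character.
Variable (H : set G) (chi : {multiplicative G -> units K}).

Definition char_act (g : G) (c : K^o) : K^o := uval (chi g) *: c.

Fact char_act_is_linear g : linear (char_act g).
Proof. by move=> a x y; rewrite /char_act scalerDr !scalerA mulrC. Qed.
HB.instance Definition _ g :=
  GRing.isLinear.Build K K^o K^o _ (char_act g) (char_act_is_linear g).

Fact char_act1 : char_act 1%g =1 id.
Proof.
have chi1 : chi 1%g = 1%g.
  by apply: (@mulgI _ (chi 1%g)); rewrite -gmulfM !mulg1.
by move=> c; rewrite /char_act chi1 scale1r.
Qed.

Fact char_actM g h : H g -> H h ->
  char_act (g * h)%g =1 char_act g \o char_act h.
Proof. by move=> _ _ c; rewrite /char_act gmulfM /= scalerA. Qed.

(* The restriction to H of the character chi of G, as a representation. *)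
Definition char_rep : rep H :=
  @Rep H K^o (fun g => char_act g) char_act1 char_actM.

End Character.

Section Induction.
Variables (H : set G) (V : rep H).

(* Smooth functions f : G -> V with f (b g) = b . f g for b in H; f is smooth *)
(* when right translation by some open subgroup of G fixes it.                *)
Definition ind_pred : {pred G -> V} := fun f =>
  `[< (forall b g, H b -> f (b * g)%g = rep_act V b (f g)) /\
      exists2 U, open_subgroup setT U & forall g k, U k -> f (g * k)%g = f g >].

Fact open_subgroupT : open_subgroup setT setT.
Proof.
split; first by split=> [|x y _ _]; exact: in_setT.
by exists setT; [exact: openT|rewrite setIT].
Qed.

Fact open_subgroupI U U' : open_subgroup setT U -> open_subgroup setT U' ->
  open_subgroup setT (U `&` U').
Proof.
move=> [[U1 UV] [O oO UO]] [[U'1 U'V] [O' oO' UO']]; split; last first.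
  by exists (O `&` O'); [exact: openI|rewrite UO UO' !setIT].
split=> [|x y]; first by rewrite in_setI U1.
rewrite !in_setI => /andP[xU xU'] /andP[yU yU'].
by rewrite UV // U'V.
Qed.

Fact open_subgroupJ U x : open_subgroup setT U ->
  open_subgroup setT [set g | U (x^-1 * g * x)%g].
Proof.
move=> [[U1 UV] [O oO UO]]; split; last first.
  exists [set g | U (x^-1 * g * x)%g]; last by rewrite setIT.
  have cm (f g : G -> G) : continuous f -> continuous g ->
      continuous (fun y => f y * g y)%g.
    move=> cf cg y; apply: (@continuous_comp _ _ _ (fun y => (f y, g y))
      (fun z : G * G => (z.1 * z.2)%g)); last exact: mulg_continuous.
    apply: (@cvg_pair _ _ _ _ (nbhs (f y)) (nbhs (g y))).
      exact: cf.
    exact: cg.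
  have cJ : continuous (fun g : G => (x^-1 * g * x)%g).
    apply: (cm); last by move=> y; exact: cvg_cst.
    by apply: (cm); [move=> y; exact: cvg_cst|move=> y; exact: cvg_id].
  move/continuousP: cJ; apply.
  by rewrite UO setIT.
split; first by apply/mem_set; rewrite /= mulg1 mulVg; exact: set_mem.
move=> g h /set_mem Ug /set_mem Uh; apply/mem_set => /=.
have /set_mem := UV _ _ (mem_set Ug) (mem_set Uh).
by rewrite !invgM invgK !mulgA mulgK.
Qed.

Fact ind_pred_submod : submod_closed ind_pred.
Proof.
split.
  apply/asboolP; split=> [b g _|]; first by rewrite linear0.
  by exists setT => //; exact: open_subgroupT.
move=> a f f' /asboolP[fH [U oU fU]] /asboolP[f'H [U' oU' f'U']].
apply/asboolP; split=> [b g Hb|].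
  rewrite -[LHS]/(a *: f (b * g)%g + f' (b * g)%g) fH // f'H //.
  by rewrite -linearP.
exists (U `&` U'); first exact: open_subgroupI.
move=> g k [Uk U'k].
by rewrite -[LHS]/(a *: f (g * k)%g + f' (g * k)%g) fU // f'U'.
Qed.

HB.instance Definition _ := GRing.isSubmodClosed.Build K (G -> V) ind_pred
  ind_pred_submod.

Record ind_space := IndSpace {
  ind_fun :> G -> V;
  ind_funP : ind_fun \in ind_pred
}.
HB.instance Definition _ := [isSub for ind_fun].
HB.instance Definition _ := [Choice of ind_space by <:].
HB.instance Definition _ := [SubChoice_isSubLmodule of ind_space by <:].

Fact ind_act_subproof (x : G) (f : ind_space) :
  (fun g => f (g * x)%g) \in ind_pred.
Proof.
have /asboolP[fH [U oU fU]] := ind_funP f.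
apply/asboolP; split=> [b g Hb|].
  by rewrite -[LHS]/(f (b * g * x)%g) -mulgA; exact: fH.
exists [set g | U (x^-1 * g * x)%g]; first exact: open_subgroupJ.
move=> g k /= Uk; rewrite -(fU (g * x)%g _ Uk); congr (ind_fun f _).
by rewrite !mulgA mulgK.
Qed.

Definition ind_act x (f : ind_space) : ind_space :=
  IndSpace (ind_act_subproof x f).

Fact ind_act_is_linear x : linear (ind_act x).
Proof. by move=> a f f'; apply/val_inj. Qed.
HB.instance Definition _ x := GRing.isLinear.Build K ind_space ind_space _
  (ind_act x) (ind_act_is_linear x).

Fact ind_act1 : ind_act 1%g =1 id.
Proof. by move=> f; apply/val_inj/funext => g /=; rewrite mulg1. Qed.

Fact ind_actM x y : [set: G] x -> [set: G] y ->
  ind_act (x * y)%g =1 ind_act x \o ind_act y.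
Proof. by move=> _ _ f; apply/val_inj/funext => g /=; rewrite mulgA. Qed.

Definition Ind : rep setT :=
  @Rep setT ind_space (fun x => ind_act x) ind_act1 ind_actM.

End Induction.

Section Cokernel.
Variables (V W : rep setT) (f : rep_hom V W).

Definition coker_act (g : G) (x : lcoker f) : lcoker f :=
  lmodpi f (rep_act W g (lmodrepr x)).

Fact coker_act_pi g w : coker_act g (lmodpi f w) = lmodpi f (rep_act W g w).
Proof.
apply/lmodpi_eq; have /lmodpi_eq/limageP[v vE] := lmodreprK (lmodpi f w).
by rewrite -linearB -vE; apply/limageP; exists (rep_act V g v); rewrite hom_act.
Qed.

Fact coker_act_is_linear g : linear (coker_act g).
Proof.
move=> a x y.
by rewrite -[x]lmodreprK -[y]lmodreprK -linearP !coker_act_pi -!linearP.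
Qed.
HB.instance Definition _ g := GRing.isLinear.Build K (lcoker f) (lcoker f) _
  (coker_act g) (coker_act_is_linear g).

Fact coker_act1 : coker_act 1%g =1 id.
Proof. by move=> x; rewrite -[x]lmodreprK coker_act_pi rep_act1. Qed.

Fact coker_actM g h : [set: G] g -> [set: G] h ->
  coker_act (g * h)%g =1 coker_act g \o coker_act h.
Proof.
by move=> _ _ x; rewrite -[x]lmodreprK /= !coker_act_pi rep_actM.
Qed.

Definition coker : rep setT :=
  @Rep setT (lcoker f) (fun g => coker_act g) coker_act1 coker_actM.

Fact coker_proj_act g w : [set: G] g ->
  lmodpi f (rep_act W g w) = rep_act coker g (lmodpi f w).
Proof. by move=> _; rewrite /= coker_act_pi. Qed.

Definition coker_proj : rep_hom W coker := @RepHom _ W coker (lmodpi f) coker_proj_act.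

End Cokernel.

Definition short_exact H (V W Q : rep H) (i : rep_hom V W) (q : rep_hom W Q) :=
  [/\ injective i, (forall w, q w = 0 <-> exists v, i v = w)
    & (forall x, exists w, q w = x)].

Definition split_epi H (W Q : rep H) (q : rep_hom W Q) : Prop :=
  exists s : rep_hom Q W, cancel s q.

End Representations.
Arguments coker_proj {K G V W} f.

(* A nontrivial ultrametric absolute value that induces the (locally compact) *)
(* topology of F. As the maximal ideal of its valuation ring is               *)
(* {x | absF x < 1}, the last field says that the residue field has           *)
(* characteristic p.                                                          *)
Record nonarch_local_field (R : realType) (p : nat) (F : topologicalFieldType)
    (absF : F -> R) : Prop := {
  absF_ge0 : forall x, 0 <= absF x;
  absF_eq0 : forall x, absF x = 0 <-> x = 0;
  absFM : forall x y, absF (x * y) = absF x * absF y;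
  absF_ultra : forall x y, absF (x + y) <= Num.max (absF x) (absF y);
  absF_nontrivial : exists2 x, x != 0 & absF x != 1;
  absF_nbhs : forall (x : F) (A : set F),
    nbhs x A <-> exists2 e : R, 0 < e & [set y | absF (y - x) < e] `<=` A;
  locally_compactF : locally_compact [set: F];
  residue_pchar : prime p /\ absF p%:R < 1
}.

Definition central_division_algebra (F : fieldType) (D : falgType F) : Prop :=
  (forall x : D, x != 0 -> x \is a GRing.unit) /\ 'Z({:D})%VS = 1%VS.

Section GL2.
Variables (F : topologicalFieldType) (D : falgType F).

Definition GL2 : topologicalGroupType := units (mat2 (algtop D)).

Definition borel : set GL2 := [set g | (uval g : 'M_2) ord_max ord0 = 0].

(* detG is the reduced norm of the central simple algebra 'M[D]_2 of degree   *)
(* 2d, i.e. the determinant in a splitting. A unital ring morphism            *)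
(* phi : 'M[D]_2 -> 'M[E]_(2d) over j : F -> E is a splitting: it extends to  *)
(* E (x)_F 'M[D]_2 -> 'M[E]_(2d), which is bijective since its source is      *)
(* simple of dimension (2d)^2 = 4 dim D. By Skolem-Noether detG does not     *)
(* depend on the splitting. The cast (a%:A)%:M is the embedding of F in       *)
(* 'M[D]_2, which is not an F-algebra in the library.                         *)
Definition is_reduced_norm (d : nat) (detG : GL2 -> units F) : Prop :=
  exists (E : fieldType) (j : {rmorphism F -> E})
         (phi : {rmorphism mat2 (algtop D) -> 'M[E]_(2 * d)}),
    (forall a : F, phi ((a%:A : algtop D)%:M : 'M_2) = (j a)%:M) /\
    (forall g, \det (phi (uval g)) = j (uval (detG g))).

End GL2.
Arguments borel {F} D _.

(* Main.v *)
Require Import Defs.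
From HB Require Import structures.
From mathcomp Require Import all_boot all_order all_fingroup all_algebra all_solvable all_field.
From mathcomp Require Import all_classical all_reals topology tvs.
From mathcomp Require Import zify lra.

(** The norm N x = |N_(D/F) x| is an ultrametric absolute value on D inducing its topology.

    Structure of rho. For a uniformizer w, the element diag(w, 1)^-1 stabilizes the vectors
    of rho fixed by a small open subgroup of B. This space is finite-dimensional, so it
    is mapped onto itself, and by contracting unipotents the unipotent radical acts trivially.
    Hence rho is a finite-dimensional irreducible representation of the diagonal torus,
    trivial near 1, and Schur's lemma holds.

    The induced representation. A function f is determined by f 1 and by
    x |-> f (w n(x)), which is locally constant, and compactly supported if f 1 = 0.
    Every nonzero B-stable subspace of {f | f 1 = 0} is the whole space: since p-groups acting
    in characteristic p have fixed vectors, it contains the function that is constant on a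
    ball and 0 elsewhere; central elements rescale the ball, the torus moves the value
    and translates span. So a G-stable S <> 0 containing some f <> 0 with f 1 = 0 is everything.
    Otherwise the elements of S are invariant under unipotents, and comparing f near 1 with
    f at w through the Bruhat decomposition of n^-(y) shows that diag(y, y^-1) acts trivially
    on rho. Then rho(b) = lam(ad) for a smooth character lam of D^*.

    Such a lam factors through the reduced norm. It is trivial on principal units.
    If the unit z lifts a generator zeta of the residue field, Wedderburn's factorization
    of the minimal polynomial of z into linear factors at conjugates of z bounds the residue
    degree by d, hence the residue degree and the ramification index equal d; moreover
    the Galois conjugate zeta^q is the residue of a conjugate of z, so lam(z)^(q-1) = 1,
    and Nrd z reduces to the norm of zeta. *)

Set Implicit Arguments.
Unset Strict Implicit.
Unset Printing Implicit Defensive.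
Import Order.TTheory GRing.Theory Num.Theory.
Local Open Scope ring_scope.

(** * Linear algebra over a field *)

(** The reduced norm is given only as the determinant of some splitting over an unknown field [E],
    so nothing is visible over [F]. The bridge is the formula Nrd x = (-1)^d m(0)^r, with m the
    minimal polynomial of x and r deg m = d: it gives N x = |Nrd x|^d, and it lets Wedderburn's
    factorization compute the residue of Nrd z. As K has no nontrivial p-power roots of unity, the
    characters that occur see Nrd only up to principal units. So rho_0(a) can be defined as the
    value of lam at any y with |Nrd y - a| < |a|; the work is to show that such y exist and that the
    choice is harmless. On the side of G all rests on one dichotomy for a G-stable subspace S:
    either S is everything, or f |-> f(1) is injective on S, and then f(w n(x)) does not depend on
    x. Applied to S itself, to the preimage of a subspace of St and to the image of a would-be
    section, it yields irreducibility of the induced representation, irreducibility of St and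
    non-splitting. *)

Lemma lin_dependent (K : fieldType) (V : lmodType K) n (e : 'I_n -> V)
    m (v : 'I_m -> V) : (n < m)%N ->
  (forall i, exists c : 'I_n -> K, v i = \sum_j c j *: e j) ->
  exists2 c : 'I_m -> K, (exists i, c i != 0) & \sum_i c i *: v i = 0.
Proof.
move=> nm /choice[C vE]; pose A := \matrix_(i, j) C i j : 'M_(m, n).
have : kermx A != 0.
  rewrite kermx_eq0 /row_free; apply: contraTneq nm => rk.
  by rewrite -leqNgt -rk rank_leq_col.
case/rowV0Pn => u /sub_kermxP uA u0.
have [i ui] : exists i, u 0 i != 0.
  apply/not_existsP => uz; case/negP: u0; apply/eqP/rowP => i.
  by rewrite mxE; apply/eqP; rewrite -[_ == _]negbK; apply/negP/uz.
exists (fun i => u 0 i); first by exists i.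
under eq_bigr => k _ do rewrite vE scaler_sumr.
rewrite exchange_big big1 // => j _.
under eq_bigr => k _ do rewrite scalerA.
rewrite -scaler_suml; move/rowP/(_ j): uA; rewrite !mxE => uA.
under eq_bigr => k _ do rewrite -[C k j](mxE matrix_key (fun i j => C i j)).
by rewrite uA scale0r.
Qed.

(** Sylvester's identity, read off from two block triangular factorizations of one matrix. It brings
    a determinant of size 2d down to size d in [det_compress]. *)
Lemma det_1D_mulC (E : comNzRingType) m n (A : 'M[E]_(m, n)) (B : 'M_(n, m)) :
  \det (1%:M + A *m B) = \det (1%:M + B *m A).
Proof.
have e1 : block_mx 1%:M (- A) B 1%:M
   = block_mx 1%:M 0 B 1%:M *m block_mx 1%:M (- A) 0 (1%:M + B *m A).
  rewrite mulmx_block !(mul1mx, mulmx1, mul0mx, mulmx0, addr0, mulmxN).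
  by rewrite [- _ + _]addrC addrK.
have e2 : block_mx 1%:M (- A) B 1%:M
   = block_mx 1%:M (- A) 0 1%:M *m block_mx (1%:M + A *m B) 0 B 1%:M.
  rewrite mulmx_block !(mul1mx, mulmx1, mul0mx, mulmx0, add0r, mulNmx).
  by rewrite addrK.
have := congr1 determinant (etrans (esym e1) e2).
by rewrite !det_mulmx !det_lblock !det_ublock !det1 !mul1r !mulr1.
Qed.

(** p(z) = det(z + A) is a polynomial in z, so p(-c) - p(0) is a multiple of c. *)
Lemma det_addZ_mod (E : comNzRingType) n (A : 'M[E]_n) (c : E) :
  exists y, \det (A - c%:M) = \det A + c * y.
Proof.
pose p := char_poly (- A).
have pE z : p.[z] = \det (z%:M + A).
  rewrite -[p.[z]]/(horner_eval z p) /p /char_poly -det_map_mx; congr (\det _).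
  by apply/matrixP => i j; rewrite !mxE /= /horner_eval hornerD hornerMn hornerX
    hornerN hornerC opprK.
have : root (p - (p.[0])%:P) 0 by rewrite /root !hornerE subrr.
case/factor_theorem => q pq.
exists (- q.[- c]); have := congr1 (horner^~ (- c)) pq.
rewrite hornerM !hornerD !hornerN !hornerX !hornerC !pE subr0 raddf0 add0r.
by move/eqP; rewrite subr_eq raddfN addrC => /eqP ->; rewrite mulrN mulrN mulrC addrC.
Qed.

(** Over E[X], g(A) - g(X) is a multiple of X - A, so its determinant is a multiple of [char_poly A]
    and hence of g; modulo g it is also det g(A). *)
Lemma char_poly_dvd_det (E : fieldType) n (A : 'M[E]_n) (g : {poly E}) :
  g %| char_poly A ->
  g %| (\det (\sum_(i < size g) g`_i *: A ^+ i))%:P.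
Proof.
move=> gA; set B := \sum_(i < _) _.
pose A' := map_mx polyC A.
have [C BC] : exists C : 'M[{poly E}]_n,
    map_mx polyC B - g%:M = char_poly_mx A *m C.
  have term i : exists C, map_mx polyC (A ^+ i) - ('X ^+ i)%:M = char_poly_mx A *m C.
    have cX : GRing.comm ('X%:M : 'M[{poly E}]_n) A'.
      by apply: comm_scalar_mx.
    have := subrXX_comm i cX.
    set S := \sum_(_ < _) _ => H; exists (- S).
    have -> : map_mx polyC (A ^+ i) = A' ^+ i by exact: rmorphXn.
    have -> : ('X ^+ i)%:M = 'X%:M ^+ i :> 'M[{poly E}]_n by exact: rmorphXn.
    by rewrite mulmxN -[_ *m S]/((_ : 'M_n) * S) -H opprB.
  have /choice[C CE] := term.
  exists (\sum_(i < size g) (g`_i)%:P *: C i).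
  rewrite [in g%:M](coefE, esym (coefK g)) poly_def.
  rewrite [map_mx _ _]raddf_sum raddf_sum -sumrB mulmx_sumr.
  apply: eq_bigr => i _; rewrite -scalemxAr -CE scalerBr; congr (_ - _).
    by apply/matrixP => k l; rewrite /= !mxE polyCM.
  by rewrite /= -mul_polyC scalar_mxM mul_scalar_mx.
have [y yE] := det_addZ_mod (map_mx polyC B) g.
rewrite -(det_map_mx polyC) -[\det _](addrK (g * y)) -yE BC det_mulmx.
by rewrite dvdp_sub ?dvdp_mulr ?dvdpp.
Qed.

(** Induction on the degree: the difference quotient (Q - Q(a0)) / (X - a0) again takes values in
    the image of [j], away from a0 and [s]. It serves to descend characteristic polynomials whose
    values at scalars are reduced norms. *)
Lemma interpolate_over (F E : fieldType) (j : {rmorphism F -> E}) n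
    (Q : {poly E}) (s : seq F) : (size Q <= n)%N ->
  (forall t : seq F, exists a, a \notin t) ->
  (forall a, a \notin s -> exists b, Q.[j a] = j b) ->
  exists P, Q = map_poly j P.
Proof.
move=> sQ infF; elim: n Q s sQ => [|n IHn] Q s.
  by rewrite leqn0 size_poly_eq0 => /eqP -> _; exists 0; rewrite rmorph0.
move=> sQ Qs; have [a0 a0s] := infF s; have [b0 Qb0] := Qs _ a0s.
have /factor_theorem[Q' QE] : root (Q - (j b0)%:P) (j a0).
  by rewrite /root !hornerE Qb0 subrr.
have [||P' QP'] := IHn Q' (a0 :: s).
- have [->|Q'0] := eqVneq Q' 0; first by rewrite size_poly0.
  rewrite -ltnS; have := size_Mmonic Q'0 (monicXsubC (j a0)).
  rewrite -QE size_XsubC addn2 /= => <-.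
  rewrite (leq_trans (size_polyD _ _)) // geq_max sQ size_polyN.
  exact: leq_trans (size_polyC_leq1 _) _.
- move=> a; rewrite inE negb_or => /andP[aa0 as_]; have [b Qb] := Qs _ as_.
  exists ((b - b0) / (a - a0)).
  have := congr1 (horner^~ (j a)) QE; rewrite !hornerE Qb => QE'.
  have ja : j a - j a0 != 0 by rewrite -rmorphB fmorph_eq0 subr_eq0.
  by rewrite fmorph_div !rmorphB QE' mulfK.
exists (P' * ('X - a0%:P) + b0%:P).
rewrite rmorphD rmorphM /= -QP' map_polyXsubC map_polyC /= -QE.
by rewrite subrK.
Qed.

Section DivisionAlgebra.
Variables (F : fieldType) (D : falgType F).
Hypothesis divD : forall x : D, x != 0 -> x \is a GRing.unit.

Lemma divD_mul0 (x y : D) : x * y = 0 -> x = 0 \/ y = 0.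
Proof.
have [->|x0] := eqVneq x 0; first by left.
by move=> /(congr1 (fun z => x^-1 * z)); rewrite mulKr ?divD // mulr0; right.
Qed.

(** An annihilator of least degree: one exists because the powers of x are dependent, and it is
    irreducible because D has no zero divisors. *)
Lemma minpoly_exists (x : D) : exists m : {poly F},
  [/\ m \is monic, irreducible_poly m,
      horner_alg x m = 0 & forall h, horner_alg x h = 0 -> m %| h].
Proof.
pose Z (h : {poly F}) := h != 0 /\ horner_alg x h = 0.
have [h0 Zh0] : exists h, Z h.
  have [i|c [i ci] cE] := @lin_dependent F D _ (fun i => (vbasis {:D})`_i)
     (\dim {:D}).+1 (fun i : 'I_ _ => x ^+ i) (ltnSn _).
  - exists (fun j => coord (vbasis {:D}) j (x ^+ i)).
    exact: (coord_vbasis (memvf (x ^+ i))).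
  exists (\poly_(i < (\dim {:D}).+1) c (inord i)); split.
    apply: contraNneq ci => /(congr1 (fun p : {poly F} => p`_i)).
    by rewrite coef_poly ltn_ord inord_val coef0 => ->.
  rewrite poly_def linear_sum /= -[RHS]cE; apply: eq_bigr => k _.
  rewrite inord_val -mul_polyC rmorphM /= horner_algC rmorphXn /= horner_algX.
  by rewrite mulr_algl.
pose P k := `[< exists2 h, Z h & size h = k >].
have exP : exists k, P k by exists (size h0); apply/asboolP; exists h0.
case: (ex_minnP exP) => k /asboolP[h [hn0 hx] hk] kmin.
pose m := (lead_coef h)^-1 *: h.
have lc : lead_coef h != 0 by rewrite lead_coef_eq0.
have mx0 : horner_alg x m = 0 by rewrite /m -mul_polyC rmorphM /= hx mulr0.
have sm : size m = k by rewrite size_scale ?invr_eq0.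
have mmon : m \is monic by rewrite monicE lead_coefZ mulVf.
have minm g : horner_alg x g = 0 -> (size g < k)%N -> g = 0.
  move=> gx gk; apply/eqP; apply: contraTT gk => gn0; rewrite -leqNgt.
  by apply: kmin; apply/asboolP; exists g.
exists m; split=> //.
  split; last first.
    move=> q q1 /dvdpP[r mE].
    have mn0 : m != 0 by rewrite monic_neq0.
    have [rn0 qn0] : r != 0 /\ q != 0.
      by move: mn0; rewrite mE mulf_eq0 negb_or => /andP[].
    have : horner_alg x r * horner_alg x q = 0 by rewrite -rmorphM -mE.
    have sq1 : (1 < size q)%N.
      by rewrite ltn_neqAle eq_sym q1 lt0n size_poly_eq0.
    have smE : (size m = (size r + size q).-1)%N by rewrite mE size_mul.
    case/divD_mul0 => [rx|qx].
      case/eqP: rn0; apply: minm rx _; rewrite -sm smE.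
      by case: (size q) sq1 => [|[|s]] // _; rewrite !addnS /= ltnS leq_addr.
    rewrite -dvdp_size_eqp ?mE ?dvdp_mull ?dvdpp // -mE eqn_leq.
    rewrite dvdp_leq ?mE ?mulf_neq0 ?dvdp_mull ?dvdpp //= -mE sm.
    by rewrite leqNgt; apply: contra_neqN qn0; apply: minm.
  rewrite sm ltnNge; apply/negP => k1.
  have /size1_polyC hc : (size m <= 1)%N by rewrite sm.
  move: mmon mx0; rewrite hc monicE lead_coefC => /eqP ->.
  by rewrite horner_algC scale1r => /eqP; rewrite oner_eq0.
move=> g gx; rewrite /dvdp; apply/eqP; apply: minm; last first.
  by rewrite -sm ltn_modp monic_neq0.
have := congr1 (horner_alg x) (divp_eq g m).
by rewrite gx rmorphD rmorphM /= mx0 mulr0 add0r.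
Qed.

(** Write P = m^r g with g prime to m. By Bezout g(x) is invertible in D, so det psi(g(x)) is a
    nonzero constant; yet g, a factor of the characteristic polynomial, divides it. So g is
    constant, and equal to 1 as P is monic. *)
Lemma char_poly_power (E : fieldType) (j : {rmorphism F -> E}) n
    (psi : {rmorphism D -> 'M[E]_n}) (x : D) (m P : {poly F}) :
  (forall a : F, psi a%:A = (j a)%:M) ->
  m \is monic -> irreducible_poly m -> horner_alg x m = 0 ->
  char_poly (psi x) = map_poly j P ->
  exists2 r, P = m ^+ r & (r * (size m).-1 = n)%N.
Proof.
move=> psiA mmon mirr mx0 chP.
have Pmon : P \is monic by rewrite -(map_monic j) -chP char_poly_monic.
have psih h : psi (horner_alg x h) =
    \sum_(i < size (map_poly j h)) (map_poly j h)`_i *: psi x ^+ i.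
  rewrite -[in LHS](coefK h) poly_def linear_sum [LHS]rmorph_sum size_map_poly.
  apply: eq_bigr => i _; rewrite linearZ /= rmorphXn /= horner_algX.
  by rewrite rmorphM /= psiA rmorphXn coef_map -mul_scalar_mx.
have [r [g [PE mg]]] : exists r g, P = m ^+ r * g /\ ~~ (m %| g).
  have : exists2 k, (size P <= k)%N & True by exists (size P).
  case=> k + _; have := monic_neq0 Pmon; move: (P).
  elim: k => [|k IHk] Q Q0; first by rewrite leqn0 size_poly_eq0 (negPf Q0).
  move=> sQ; have [/dvdpP[Q' QE]|mQ] := boolP (m %| Q); last first.
    by exists 0, Q; rewrite expr0 mul1r.
  have Q'0 : Q' != 0 by apply: contraNneq Q0 => Q'0; rewrite QE Q'0 mul0r.
  have [|r [g [Q'E mg]]] := IHk Q' Q'0.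
    rewrite -ltnS (leq_trans _ sQ) // QE size_Mmonic //.
    case: mirr => + _; case: (size m) => [|[|s]] // _.
    by rewrite !addnS /= ltnS leq_addr.
  by exists r.+1, g; rewrite QE Q'E exprSr [RHS]mulrAC.
have {mg}: coprimep m g by rewrite irreducible_poly_coprime.
case/Bezout_eq1_coprimepP => -[u v] /= uv.
have vg : horner_alg x v * horner_alg x g = 1.
  have := congr1 (horner_alg x) uv.
  by rewrite rmorphD !rmorphM /= mx0 mulr0 add0r rmorph1.
have detn0 : \det (psi (horner_alg x g)) != 0.
  have := congr1 (determinant \o psi) vg; rewrite /= rmorphM rmorph1.
  rewrite [\det (_ * _)]det_mulmx det1 => H; apply/eqP => d0.
  by move: H; rewrite d0 mulr0 => /esym/eqP; rewrite oner_eq0.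
have : map_poly j g %| (\det (psi (horner_alg x g)))%:P.
  rewrite psih; apply: char_poly_dvd_det.
  by rewrite chP PE rmorphM /= dvdp_mulIr.
move/dvdp_leq; rewrite size_map_poly polyC_eq0 => /(_ detn0).
rewrite size_polyC detn0 => sg.
have gn0 : g != 0 by apply: contraNneq (monic_neq0 Pmon) => g0; rewrite PE g0 mulr0.
have g1 : g = 1.
  have gC : g = (lead_coef g)%:P.
    by rewrite {2}(size1_polyC sg) lead_coefC; exact: size1_polyC.
  have := Pmon; rewrite PE monicMl ?monic_exp // monicE => /eqP g1.
  by rewrite gC g1.
exists r; first by rewrite PE g1 mulr1.
have := size_char_poly (psi x); rewrite chP size_map_poly PE g1 mulr1.
by move=> sE; rewrite mulnC -size_exp sE.
Qed.

End DivisionAlgebra.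

(** * Matrices over D and the reduced norm *)

Definition mx22 (T : Type) (a b c e : T) : 'M[T]_2 :=
  \matrix_(i, j) if i == ord0 then if j == ord0 then a else b
                 else if j == ord0 then c else e.

Lemma forall_I2 (P : 'I_2 -> Prop) : P ord0 -> P ord_max -> forall i, P i.
Proof.
move=> P0 P1 [[|[|//]] iP].
  by rewrite (_ : Ordinal _ = ord0) //; apply/val_inj.
by rewrite (_ : Ordinal _ = ord_max) //; apply/val_inj.
Qed.

Lemma mx22_eta (T : Type) (A : 'M[T]_2) :
  A = mx22 (A ord0 ord0) (A ord0 ord_max) (A ord_max ord0) (A ord_max ord_max).
Proof.
by apply/matrixP => i j; rewrite mxE; move: i j;
  apply: forall_I2; apply: forall_I2.
Qed.

Section Mx22.
Variable R : nzRingType.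
Implicit Types a b c e : R.

Lemma mx22M a b c e a' b' c' e' : mx22 a b c e *m mx22 a' b' c' e' =
  mx22 (a * a' + b * c') (a * b' + b * e') (c * a' + e * c') (c * b' + e * e').
Proof.
apply/matrixP => i j; rewrite !mxE big_ord_recl big_ord1 !mxE /=.
by move: i j; apply: forall_I2; apply: forall_I2.
Qed.

Lemma mx22Mr a b c e a' b' c' e' : mx22 a b c e * mx22 a' b' c' e' =
  mx22 (a * a' + b * c') (a * b' + b * e') (c * a' + e * c') (c * b' + e * e').
Proof. exact: mx22M. Qed.

Lemma mx22D a b c e a' b' c' e' : mx22 a b c e + mx22 a' b' c' e' =
  mx22 (a + a') (b + b') (c + c') (e + e').
Proof.
apply/matrixP => i j; rewrite !mxE.
by move: i j; apply: forall_I2; apply: forall_I2.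
Qed.

Lemma scalar_mx22 a : a%:M = mx22 a 0 0 a.
Proof.
apply/matrixP => i j; rewrite !mxE.
by move: i j; apply: forall_I2; apply: forall_I2; rewrite ?mulr1n ?mulr0n.
Qed.

Lemma mx22_1 : 1 = mx22 1 0 0 1 :> 'M[R]_2.
Proof. exact: scalar_mx22. Qed.

Lemma mx22_0 : 0 = mx22 0 0 0 0 :> 'M[R]_2.
Proof. by apply/matrixP => i j; rewrite !mxE !if_same. Qed.

Lemma mx22N a b c e : - mx22 a b c e = mx22 (- a) (- b) (- c) (- e).
Proof.
apply/matrixP => i j; rewrite !mxE.
by move: i j; apply: forall_I2; apply: forall_I2.
Qed.

Definition mx22E := (mx22Mr, mx22M, mx22D, mx22N).

End Mx22.

Definition simpr01 := (mulr1, mul1r, mulr0, mul0r, addr0, add0r, oppr0).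

(** In a rank factorization A = C R, the relation C (R C) R = C R can be cancelled on both sides.
    This is what identifies the corner cut out by A with matrices of size r. *)
Lemma idempotent_factor (E : fieldType) n r (A : 'M[E]_n) :
  A *m A = A -> \rank A = r ->
  exists (C : 'M_(n, r)) (R : 'M_(r, n)), C *m R = A /\ R *m C = 1%:M.
Proof.
move=> AA rA; rewrite -rA; exists (col_base A), (row_base A).
split; first exact: mulmx_base.
have cf := col_base_full A; have rf := row_base_free A.
have := mulmx_base A.
move: (col_base A) (row_base A) cf rf => C R cf rf CR.
have : C *m (R *m C) *m R = C *m R by rewrite !mulmxA -(mulmxA _ C R) CR AA.
move/(row_free_inj rf); rewrite -[RHS]mulmx1.
move/(congr1 trmx); rewrite !trmx_mul trmx1 => H.
apply: trmx_inj; rewrite trmx_mul trmx1; apply: row_free_inj H.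
by rewrite /row_free mxrank_tr; exact: cf.
Qed.

(** * The norm of D over F through the regular representation *)

Section RegularRepresentation.
Variables (F : fieldType) (D : falgType F).
Local Notation n := (\dim {:D}).

(** Right multiplication acting on rows of coordinates: this pairing of sides keeps the order of
    products. *)
Definition regmx (x : D) : 'M[F]_n :=
  \matrix_(i, j) coord (vbasis {:D}) j ((vbasis {:D})`_i * x).

Definition coordrow (x : D) : 'rV[F]_n := \row_j coord (vbasis {:D}) j x.

Lemma coordrowK (x : D) : \sum_j coordrow x 0 j *: (vbasis {:D})`_j = x.
Proof.
rewrite [RHS](coord_vbasis (memvf x)).
by apply: eq_bigr => j _; rewrite mxE.
Qed.

Lemma coordrowM y x : coordrow (y * x) = coordrow y *m regmx x.
Proof.
apply/rowP => j; rewrite !mxE -[in LHS](coordrowK y) big_distrl linear_sum /=.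
apply: eq_bigr => i _; rewrite -scalerAl linearZ /=.
by rewrite !mxE.
Qed.

Lemma coordrow_basis (i : 'I_n) : coordrow (vbasis {:D})`_i = delta_mx 0 i.
Proof.
apply/rowP => j; rewrite !mxE /= coord_free ?(basis_free (vbasisP _)) //.
by rewrite eq_sym.
Qed.

Lemma regmx_eq A x : (forall y, coordrow (y * x) = coordrow y *m A) -> regmx x = A.
Proof.
move=> xA; apply/row_matrixP => i; rewrite !rowE -coordrow_basis -xA.
by rewrite coordrowM.
Qed.

Lemma regmx_is_additive : zmod_morphism regmx.
Proof.
move=> x y; apply: regmx_eq => z.
rewrite mulmxBr -!coordrowM; apply/rowP => j; rewrite !mxE.
by rewrite mulrBr linearB.
Qed.
HB.instance Definition _ :=
  GRing.isZmodMorphism.Build D 'M[F]_n regmx regmx_is_additive.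

Lemma regmx_is_multiplicative : monoid_morphism regmx.
Proof.
split; first by apply: regmx_eq => z; rewrite mulr1 mulmx1.
by move=> x y; apply: regmx_eq => z; rewrite mulrA !coordrowM mulmxA.
Qed.
HB.instance Definition _ :=
  GRing.isMonoidMorphism.Build D 'M[F]_n regmx regmx_is_multiplicative.

Lemma regmx_in_alg a : regmx a%:A = a%:M.
Proof.
apply: regmx_eq => z; rewrite mulr_algr mul_mx_scalar.
by apply/rowP => j; rewrite !mxE linearZ.
Qed.

Definition algnorm (x : D) : F := \det (regmx x).

Lemma algnormM x y : algnorm (x * y) = algnorm x * algnorm y.
Proof. by rewrite /algnorm rmorphM [\det _]det_mulmx. Qed.

Lemma algnorm_alg a : algnorm a%:A = a ^+ n.
Proof. by rewrite /algnorm regmx_in_alg det_scalar. Qed.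

(** Exhibits the norm as a form in the coordinates, the shape to which the compactness argument of
    [det_lower_bound] applies. *)
Lemma algnormE x : algnorm x = \det (\sum_i coordrow x 0 i *: regmx (vbasis {:D})`_i).
Proof.
congr (\det _); rewrite -[in LHS](coordrowK x) rmorph_sum; apply: eq_bigr => i _ /=.
by rewrite -mulr_algl rmorphM /= regmx_in_alg -mul_scalar_mx.
Qed.

Hypothesis divD : forall x : D, x != 0 -> x \is a GRing.unit.

Lemma algnorm_eq0 x : algnorm x = 0 <-> x = 0.
Proof.
split=> [|->]; last first.
  rewrite /algnorm raddf0.
  have : (0 < n)%N by rewrite adim_gt0.
  by case: n => // k _; rewrite det0.
have [//|x0] := eqVneq x 0 => nx.
have := algnormM x x^-1; rewrite divrr ?divD // nx mul0r.
by rewrite /algnorm rmorph1 det1 => /eqP; rewrite oner_eq0.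
Qed.

End RegularRepresentation.

(** * Reduced norms and minimal polynomials *)

Section ReducedNorm.
Variables (F : fieldType) (D : falgType F) (E : fieldType) (j : {rmorphism F -> E}).
Variables (d : nat) (phi : {rmorphism 'M[D]_2 -> 'M[E]_(2 * d)}) (nrd : D -> F).
Hypothesis divD : forall x : D, x != 0 -> x \is a GRing.unit.
Hypothesis infF : forall t : seq F, exists a, a \notin t.
Hypothesis phiA : forall a : F, phi (a%:A)%:M = (j a)%:M.
Hypothesis phi_nrd : forall x, x != 0 -> \det (phi (mx22 x 0 0 1)) = j (nrd x).

Let E1 := phi (mx22 1 0 0 0).

Let E1E1 : E1 *m E1 = E1.
Proof.
by rewrite -[LHS]/(E1 * E1) -rmorphM mx22E !simpr01.
Qed.

(** The images of diag(1, 0) and diag(0, 1) are conjugate by the swap, annihilate each other and add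
    up to 1, so each takes half of the rank 2d. *)
Let rank_E1 : \rank E1 = d.
Proof.
pose E2 := phi (mx22 0 0 0 1).
pose w := phi (mx22 0 1 1 0).
have E12 : E1 *m E2 = 0.
  by rewrite -[LHS]/(E1 * E2) -rmorphM -(rmorph0 phi) mx22E mx22_0 !simpr01.
have wE : w *m E1 *m w = E2.
  by rewrite -[LHS]/(w * E1 * w) -!rmorphM !mx22E !simpr01.
have ww : w *m w = 1%:M.
  by rewrite -[LHS]/(w * w) -rmorphM -[RHS](rmorph1 phi) mx22E mx22_1 !simpr01.
have r12 : \rank E2 = \rank E1.
  have wu : w \in unitmx by case: (mulmx1_unit ww).
  by rewrite -wE mxrankMfree ?row_free_unit // eqmxMfull ?row_full_unit.
have le1 : (\rank E1 + \rank E2 <= 2 * d)%N by exact: mulmx0_rank_max.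
have le2 : (2 * d <= \rank E1 + \rank E2)%N.
  have {1}-> : (2 * d = \rank (phi 1%R))%N by rewrite rmorph1 mxrank1.
  apply: leq_trans (mxrank_add _ _); rewrite -rmorphD mx22D.
  by rewrite mx22_1 !simpr01.
apply/eqP; rewrite -(eqn_pmul2l (isT : 0 < 2)%N) eqn_leq.
by move: le1 le2; rewrite r12 addnn -mul2n => -> ->.
Qed.

Section Compression.
Variables (C : 'M[E]_(2 * d, d)) (R : 'M[E]_(d, 2 * d)).
Hypotheses (CR : C *m R = E1) (RC : R *m C = 1%:M).

(** A splitting of D itself, of size d, cut out of the splitting of the 2 x 2 matrices by the
    idempotent [E1]. *)
Definition compress (x : D) : 'M[E]_d := R *m phi (mx22 x 0 0 0) *m C.

Let phi11 x : phi (mx22 x 0 0 0) = E1 *m phi (mx22 x 0 0 0) *m E1.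
Proof.
by rewrite -[RHS]/(E1 * phi _ * E1) -!rmorphM !mx22E !simpr01.
Qed.

Lemma compress_is_additive : zmod_morphism compress.
Proof.
move=> x y; rewrite /compress -mulmxBl -mulmxBr -rmorphB.
by rewrite !mx22E !simpr01.
Qed.

Lemma compress_is_multiplicative : monoid_morphism compress.
Proof.
split; first by rewrite /compress -/E1 -CR !mulmxA RC mul1mx RC.
move=> x y; rewrite /compress -[RHS]/(_ *m _) !mulmxA; congr (_ *m _).
rewrite -(mulmxA _ C R) CR -!mulmxA; congr (_ *m _).
rewrite -[RHS]/(phi _ * (E1 * phi _)) -!rmorphM.
by rewrite !mx22E !simpr01.
Qed.

Lemma compress_alg a : compress a%:A = (j a)%:M.
Proof.
have aE : mx22 a%:A 0 0 0 = (a%:A)%:M * mx22 1 0 0 0 :> 'M[D]_2.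
  by rewrite scalar_mx22 mx22Mr !simpr01.
rewrite /compress aE [phi _]rmorphM /= phiA [_ * _]mul_scalar_mx -/E1.
by rewrite -scalemxAr -scalemxAl -CR !mulmxA RC mul1mx RC scalemx1.
Qed.

(** diag(x, 1) = 1 + diag(x - 1, 0), and the image of the last term is C times [compress] of x - 1
    times R; Sylvester's identity moves C to the right, where it meets R. *)
Lemma det_compress x : x != 0 -> \det (compress x) = j (nrd x).
Proof.
move=> x0; rewrite -phi_nrd //.
have -> : mx22 x 0 0 1 = 1 + mx22 (x - 1) 0 0 0.
  by rewrite mx22_1 mx22D !simpr01 addrC subrK.
rewrite rmorphD rmorph1 phi11 -CR -!mulmxA [\det (1 + _)]det_1D_mulC.
rewrite !mulmxA -(mulmxA _ R C) RC mulmx1 -/(compress (x - 1)).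
by rewrite compress_is_additive compress_is_multiplicative.1 addrC subrK.
Qed.

End Compression.

(** At a scalar a the characteristic polynomial of psi(x) takes the value Nrd(a - x). By
    interpolation it descends to F, so it is a power of m, and its value at 0 gives Nrd x. *)
Lemma reduced_normE x m : x != 0 ->
  m \is monic -> irreducible_poly m -> horner_alg x m = 0 ->
  exists2 r, (r * (size m).-1 = d)%N & nrd x = (-1) ^+ d * (m ^+ r).[0].
Proof.
move=> x0 mmon mirr mx0.
have [C [R [CR RC]]] := idempotent_factor E1E1 rank_E1.
have [psi psiE] : exists psi : {rmorphism D -> 'M[E]_d}, forall y, psi y = compress C R y.
  pose psiA := GRing.isZmodMorphism.Build _ _ _ (compress_is_additive C R).
  pose psiM := GRing.isMonoidMorphism.Build _ _ _ (compress_is_multiplicative CR RC).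
  pose psi : {rmorphism D -> 'M[E]_d} := HB.pack (compress C R) psiA psiM.
  by exists psi.
have psi_alg a : psi a%:A = (j a)%:M by rewrite psiE compress_alg.
have charE a : (char_poly (psi x)).[j a] = \det (psi (a%:A - x)).
  rewrite -[_.[_]]/(horner_eval (j a) (char_poly _)) /char_poly -det_map_mx.
  congr (\det _); rewrite (rmorphB psi) /= psi_alg.
  by apply/matrixP => k l; rewrite !mxE /= /horner_eval hornerD hornerN hornerC
    hornerMn hornerX.
have [P chP] : exists P, char_poly (psi x) = map_poly j P.
  (* [phi_nrd] is silent at 0, so the one scalar to exclude is the a with a - x = 0, if there is
     any. *)
  pose s := if `[< exists a : F, a%:A = x >] is true
            then [:: xget 0 [set a : F | a%:A = x]%classic] else [::].
  apply: (@interpolate_over _ _ j _ _ s) (leqnn _) infF _ => a as_.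
  rewrite charE; exists (nrd (a%:A - x)); rewrite psiE (det_compress CR RC) //.
  rewrite subr_eq0; apply: contraNneq as_ => ax.
  rewrite /s; case: asboolP => [_|]; last by case; exists a.
  case: xgetP => [b _ bx|/(_ a)//]; rewrite inE.
  rewrite -subr_eq0; have : (a - b) *: (1 : D) == 0 by rewrite scalerBl ax bx subrr.
  by rewrite scaler_eq0 oner_eq0 orbF.
have [r PE rd] := char_poly_power psi_alg mmon mirr mx0 chP.
exists r => //; apply: (fmorph_inj j); rewrite -(det_compress CR RC) // -psiE.
have := charE 0; rewrite scale0r sub0r rmorphN /= rmorph0 chP -(rmorph0 j).
rewrite horner_map PE -scaleN1r detZ => /(congr1 (fun z => (-1) ^+ d * z)).
rewrite mulrA -expr2 sqrr_sign mul1r => <-.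
by rewrite rmorphM rmorph_sign.
Qed.

End ReducedNorm.

Lemma algnorm_minpoly (F : fieldType) (D : falgType F) (x : D) m :
  (forall x : D, x != 0 -> x \is a GRing.unit) ->
  m \is monic -> irreducible_poly m -> horner_alg x m = 0 ->
  exists2 r, (r * (size m).-1 = \dim {:D})%N &
    algnorm x = (-1) ^+ (\dim {:D}) * (m ^+ r).[0].
Proof.
move=> divD mmon mirr mx0.
have chP : char_poly (regmx x) = map_poly idfun (char_poly (regmx x)).
  by rewrite map_poly_id.
have [r PE rd] := char_poly_power (@regmx_in_alg F D : forall a, regmx _ = (idfun a)%:M) mmon mirr mx0 chP.
exists r => //; rewrite -PE horner_coef0 char_poly_det mulrA -expr2 sqrr_sign.
by rewrite mul1r.
Qed.

(** * Wedderburn factorization of minimal polynomials *)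

Section WedderburnFactorization.
Variables (F : fieldType) (D : falgType F).
Hypothesis divD : forall x : D, x != 0 -> x \is a GRing.unit.
Hypothesis centD : 'Z({:D})%VS = 1%VS.

(** Evaluation is not multiplicative over D: in p q the left factor is evaluated at the conjugate of
    x by q(x). *)
Lemma horner_mul_conj (p q : {poly D}) (x y : D) :
  y * q.[x] = q.[x] * x -> (p * q).[x] = p.[y] * q.[x].
Proof.
move=> yq; elim/poly_ind: p => [|p c IHp]; first by rewrite mul0r !horner0 mul0r.
rewrite mulrDl -mulrA -[in 'X * q]commr_polyX mulrA !hornerD hornerMX IHp.
by rewrite hornerMX !hornerC hornerCM [in RHS]mulrDl -!mulrA yq.
Qed.

Definition conjby (u x : D) : D := u * x * u^-1.

Lemma conjby_is_additive u : zmod_morphism (conjby u).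
Proof. by move=> x y; rewrite /conjby mulrBr mulrBl. Qed.

HB.instance Definition _ u :=
  GRing.isZmodMorphism.Build D D (conjby u) (conjby_is_additive u).

Lemma conjbyM u : u != 0 -> {morph conjby u : x y / x * y}.
Proof. by move=> u0 x y; rewrite /conjby -!mulrA mulKr ?divD // mulrA. Qed.

Lemma conjby_comp u v x : u != 0 -> v != 0 -> conjby u (conjby v x) = conjby (u * v) x.
Proof. by move=> u0 v0; rewrite /conjby invrM ?divD // !mulrA. Qed.

Lemma horner_algE (z : D) (h : {poly F}) : horner_alg z h = (map_poly (in_alg D) h).[z].
Proof. by []. Qed.

Lemma horner_conj (h : {poly D}) u x : u != 0 ->
  (map_poly (conjby u) h).[conjby u x] = conjby u h.[x].
Proof.
move=> u0; have cX i : conjby u (x ^+ i) = conjby u x ^+ i.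
  elim: i => [|i IHi]; first by rewrite /conjby !expr0 mulr1 divrr ?divD.
  by rewrite !exprS conjbyM // IHi.
rewrite (@horner_coef_wide _ (size h)); last exact: size_poly.
rewrite horner_coef raddf_sum; apply: eq_bigr => i _.
by rewrite coef_map -cX /= conjbyM.
Qed.

Variables (z : D) (m : {poly F}).
Hypotheses (mmon : m \is monic) (mz : horner_alg z m = 0).
Hypothesis minm : forall h, horner_alg z h = 0 -> m %| h.

Let mD := map_poly (in_alg D) m.
Let kills (h : {poly D}) := forall u, u != 0 -> h.[conjby u z] = 0.

Let conj_alg u a : u != 0 -> conjby u (a%:A) = a%:A.
Proof. by move=> u0; rewrite /conjby mulr_algr -scalerAl divrr ?divD. Qed.

Let mD_kills : kills mD.
Proof.
move=> u u0; have -> : mD = map_poly (conjby u) mD.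
  apply/polyP => i; rewrite [RHS]coef_map /= [mD`_i]coef_map /= conj_alg //.
by rewrite horner_conj // -horner_algE mz /conjby mulr0 mul0r.
Qed.

Let commutes_central c : (forall u, u != 0 -> conjby u c = c) -> exists a, c = a%:A.
Proof.
move=> cC; have : c \in 'Z({:D})%VS.
  rewrite memv_cap memvf /=; apply/centvP => y _.
  have [->|y0] := eqVneq y 0; first by rewrite mulr0 mul0r.
  by rewrite -{1}(cC y y0) /conjby mulrVK ?divD.
by rewrite centD => /vlineP[a ->]; exists a.
Qed.

(** Take a monic polynomial of least degree that vanishes on all conjugates of z. Conjugating its
    coefficients gives another one, and the difference has smaller degree, so the coefficients are
    central, that is in F; then m divides it. *)
Let kills_size h : h != 0 -> kills h -> (size m <= size h)%N.
Proof.
move=> h0 hk; pose P k := `[< exists2 g : {poly D}, g != 0 /\ kills g & size g = k >].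
have exP : exists k, P k by exists (size h); apply/asboolP; exists h.
case: (ex_minnP exP) => k /asboolP[g [g0 gk] sg] kmin.
apply: (@leq_trans k); last by apply: kmin; apply/asboolP; exists h.
have lg0 : lead_coef g != 0 by rewrite lead_coef_eq0.
pose g1 := (lead_coef g)^-1%:P * g.
have g1k : g1`_k.-1 = 1 by rewrite coefCM -sg -lead_coefE mulVr ?divD.
have sg1 : (size g1 <= k)%N.
  by apply/leq_sizeP => i ki; rewrite coefCM nth_default ?mulr0 // sg.
have kg1 : kills g1 by move=> u u0; rewrite hornerCM gk ?mulr0.
have k0 : (0 < k)%N by rewrite -sg size_poly_gt0.
have g1C u : u != 0 -> map_poly (conjby u) g1 = g1.
  move=> u0; apply/eqP; rewrite eq_sym -subr_eq0; apply/eqP/eqP.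
  set g2 := g1 - _; apply: contraT => g20.
  have : (k <= size g2)%N.
    apply: kmin; apply/asboolP; exists g2 => //; split=> // v v0.
    have u'0 : u^-1 != 0.
      by apply: contraNneq u0 => u'0; rewrite -(invrK u) u'0 invr0.
    have uv : u^-1 * v != 0.
      by apply/eqP => /(divD_mul0 divD)[] /eqP; apply/negP.
    have -> : conjby v z = conjby u (conjby (u^-1 * v) z).
      by rewrite conjby_comp // mulVKr ?divD.
    rewrite /g2 hornerD hornerN horner_conj // kg1 // raddf0 subr0.
    by rewrite conjby_comp // mulVKr ?divD // kg1.
  rewrite leqNgt; case/negP.
  have : (size g2 <= k.-1)%N.
    apply/leq_sizeP => i; rewrite leq_eqVlt => /predU1P[<-|ki].
      by rewrite coefB coef_map /= g1k /conjby mulr1 divrr ?divD ?subrr.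
    have ki' : (k <= i)%N by case: (k) ki k0.
    rewrite coefB coef_map /= (leq_sizeP _ _ sg1 i ki').
    by rewrite raddf0 subrr.
  by move/leq_ltn_trans; apply; rewrite prednK.
have /choice[a aE] : forall i, exists a, g1`_i = a%:A.
  move=> i; apply: commutes_central => u u0.
  by rewrite -[in RHS](g1C u u0) coef_map.
pose h0' := \poly_(i < k) a i.
have g1E : g1 = map_poly (in_alg D) h0'.
  apply/polyP => i; rewrite coef_map coef_poly /=; case: ltnP => ki.
    by rewrite aE.
  by rewrite scale0r (leq_sizeP _ _ sg1).
have h0'0 : h0' != 0.
  by apply: contraTneq isT => h00; move: g1k;
    rewrite g1E h00 rmorph0 coef0 => /esym/eqP; rewrite oner_eq0.
have : horner_alg z h0' = 0.
  rewrite horner_algE -g1E; have := kg1 1; rewrite /conjby mul1r divr1; apply.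
  exact: oner_neq0.
by move/minm/dvdp_leq => /(_ h0'0) /leq_trans; apply; exact: size_poly.
Qed.

(** Linear factors are collected in h with m = g h. If h does not vanish at some conjugate c of z,
    put b = h(c): by [horner_mul_conj] g vanishes at b c b^-1, again a conjugate of z, and one more
    factor splits off g. If h vanishes on the whole class, [kills_size] forces g = 1. *)
Lemma wedderburn_factorization : exists s : seq D,
  [/\ z \in s, forall c, c \in s -> exists2 u, u != 0 & c = conjby u z
    & map_poly (in_alg D) m = \prod_(c <- s) ('X - c%:P)].
Proof.
have [g mg] : exists g, mD = g * ('X - z%:P).
  by apply/factor_theorem; rewrite /root -horner_algE mz.
have : mD = g * \prod_(c <- [:: z]) ('X - c%:P) by rewrite big_seq1.
have : forall c, c \in [:: z] -> exists2 u, u != 0 & c = conjby u z.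
  by move=> c; rewrite inE => /eqP ->; exists 1;
    rewrite ?oner_eq0 // /conjby mul1r divr1.
have : z \in [:: z] by rewrite inE.
have mDmon : mD \is monic by rewrite monic_map.
have prod_monic (s : seq D) : \prod_(c <- s) ('X - c%:P) \is monic.
  by apply: monic_prod => c _; exact: monicXsubC.
have prod_size s : size (\prod_(c <- s) ('X - c%:P) : {poly D}) = (size s).+1.
  by rewrite -(size_prod_XsubC s id).
move: [:: z] g {mg}; have [n] := ubnP (size m).
have : (size m <= n)%N -> True by [].
move=> _ nm s g.
have : (size m - size s < n)%N by apply: leq_ltn_trans nm; exact: leq_subr.
elim: n s g {nm} => // n IHn s g sn zs cs mE.
set h := \prod_(c <- s) _ in mE.
have [hk|] := pselect (kills h).
  exists s; split=> //; rewrite -/mD mE -/h.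
  have hn0 : h != 0 by exact: monic_neq0 (prod_monic s).
  have := kills_size hn0 hk.
  have gmon : g \is monic by rewrite -(monicMr g (prod_monic s)) -/h -mE.
  have : size m = size mD by rewrite size_map_poly.
  rewrite mE size_Mmonic ?(monic_neq0 gmon) ?prod_monic // => szm sz; suff -> : g = 1 by rewrite mul1r.
  have sg1 : (size g <= 1)%N.
    have h0 : (0 < size h)%N by rewrite size_poly_gt0 hn0.
    have : (0 < size g)%N by rewrite size_poly_gt0 monic_neq0.
    move: sz h0; rewrite szm; case: (size g) => [|[|k]] //; case: (size h) => // l.
    by rewrite addnS addSn /=; lia.
  by move: gmon; rewrite (size1_polyC sg1) monicE lead_coefC => /eqP ->.
move/existsNP => [u]; move/not_implyP => [u0 /eqP hu].
pose b := h.[conjby u z]; pose y := conjby b (conjby u z).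
have yb : y * b = b * conjby u z by rewrite /y /conjby mulrVK ?divD.
have /factor_theorem[g' gE] : root g y.
  have := mD_kills u0; rewrite mE (horner_mul_conj g yb).
  by move/(divD_mul0 divD) => [/eqP //|/eqP]; rewrite (negPf hu).
apply: (IHn (y :: s) g').
- have ss : (size s < size m)%N.
    have mE' : mD = g' * \prod_(c <- y :: s) ('X - c%:P).
      by rewrite mE gE big_cons mulrA.
    have gmon : g' \is monic by rewrite -(monicMr g' (prod_monic (y :: s))) -mE'.
    have : size m = size mD by rewrite size_map_poly.
    rewrite mE' size_Mmonic ?(monic_neq0 gmon) ?prod_monic // prod_size /= => ->.
    have : (0 < size g')%N by rewrite size_poly_gt0 monic_neq0.
    lia.
  move: sn ss => /=; lia.
- by rewrite inE zs orbT.
- move=> c; rewrite inE => /orP[/eqP ->|/cs//]; exists (b * u).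
    apply/eqP => /(divD_mul0 divD) [b0|u00].
      by rewrite -/b b0 eqxx in hu.
    by rewrite u00 eqxx in u0.
  by rewrite /y conjby_comp.
- by rewrite mE gE big_cons mulrA.
Qed.

End WedderburnFactorization.

(** * Valued division rings and residue fields *)

(** Bernoulli's inequality for the powers of x^-1 = 1 + a, then the archimedean property. *)
Lemma expr_small (R : archiRealFieldType) (x e : R) : 0 < x < 1 -> 0 < e ->
  exists k, x ^+ k < e.
Proof.
move=> /andP[x0 x1] e0; pose a := x^-1 - 1.
have a0 : 0 < a by rewrite subr_gt0 invf_gt1.
have bern n : 1 + n%:R * a <= x^-1 ^+ n.
  elim: n => [|n IH]; first by rewrite mul0r addr0 expr0.
  rewrite exprSr; apply: le_trans (ler_wpM2r _ IH); last by rewrite invr_ge0 ltW.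
  have xE : x^-1 = a + 1 by rewrite subrK.
  have : 0 <= n%:R * a * a by rewrite !mulr_ge0 // ltW.
  rewrite xE -natr1; move: (n%:R) (a) => b c; lra.
pose n := Num.bound (e^-1 / a); exists n.
have : e^-1 / a < n%:R by apply: archi_boundP; rewrite divr_ge0 ?invr_ge0 // ltW.
rewrite ltr_pdivrMr // => en; have := lt_le_trans en (le_trans _ (bern n)).
rewrite -[x ^+ n]invrK -exprVn => H.
rewrite -[e]invrK ltf_pV2 ?posrE ?invr_gt0 ?exprn_gt0 ?invr_gt0 //.
by apply: H; rewrite lerDr.
Qed.

(** Common to F and D, so T may be noncommutative. [nm_cover], the total boundedness of balls, is
    the form in which local compactness enters: discreteness of values and finiteness of the residue
    ring come from it. *)
Record valued (R : realType) (T : unitRingType) (nm : T -> R) : Prop := {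
  nm_ge0 : forall x, 0 <= nm x;
  nm_eq0 : forall x, nm x = 0 <-> x = 0;
  nmM : forall x y, nm (x * y) = nm x * nm y;
  nm_ultra : forall x y, nm (x + y) <= Num.max (nm x) (nm y);
  nm_unit : forall x : T, x != 0 -> x \is a GRing.unit;
  nm_cover : forall e M : R, 0 < e -> exists s : seq T,
    forall x, nm x <= M -> exists2 y, y \in s & nm (x - y) < e
}.

Section Valued.
Variables (R : realType) (T : unitRingType) (nm : T -> R).
Hypothesis v : valued nm.
Implicit Types x y : T.

Lemma nm0 : nm 0 = 0. Proof. exact/(nm_eq0 v). Qed.

Lemma nm_gt0 x : x != 0 -> 0 < nm x.
Proof.
by move=> x0; rewrite lt_def (nm_ge0 v) andbT; apply: contraNneq x0 => /(nm_eq0 v) ->.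
Qed.

Lemma nm1 : nm 1 = 1.
Proof.
have n0 : nm 1 != 0 by rewrite gt_eqF // nm_gt0 ?oner_neq0.
by apply: (mulfI n0); rewrite -(nmM v) !mulr1.
Qed.

Lemma nmX x n : nm (x ^+ n) = nm x ^+ n.
Proof. by elim: n => [|n IH]; rewrite ?nm1 // !exprS (nmM v) IH. Qed.

Lemma nmN x : nm (- x) = nm x.
Proof.
suff n1 : nm (- 1) = 1 by rewrite -mulN1r (nmM v) n1 mul1r.
apply/eqP; rewrite -(@eqrXn2 _ 2%N) ?(nm_ge0 v) // expr1n -nmX sqrrN expr1n.
by rewrite nm1.
Qed.

Lemma nmB_sym x y : nm (x - y) = nm (y - x).
Proof. by rewrite -nmN opprB. Qed.

Lemma nmD_le x y (e : R) : nm x <= e -> nm y <= e -> nm (x + y) <= e.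
Proof. by move=> xe ye; rewrite (le_trans (nm_ultra v _ _)) // ge_max xe. Qed.

Lemma nmD_lt x y (e : R) : nm x < e -> nm y < e -> nm (x + y) < e.
Proof. by move=> xe ye; rewrite (le_lt_trans (nm_ultra v _ _)) // gt_max xe. Qed.

Lemma nmB_le x y (e : R) : nm x <= e -> nm y <= e -> nm (x - y) <= e.
Proof. by move=> xe ye; apply: nmD_le => //; rewrite nmN. Qed.

Lemma nmB_lt x y (e : R) : nm x < e -> nm y < e -> nm (x - y) < e.
Proof. by move=> xe ye; apply: nmD_lt => //; rewrite nmN. Qed.

Lemma nm_trans x y z (e : R) : nm (x - y) < e -> nm (y - z) < e -> nm (x - z) < e.
Proof. by move=> xy yz; rewrite -[x](subrK y) -addrA; exact: nmD_lt. Qed.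

Lemma nm_lt_eq x y : nm (x - y) < nm x -> nm y = nm x.
Proof.
move=> xy; apply/eqP; rewrite eq_le; apply/andP; split.
  by rewrite -[y in leLHS](subKr x); apply: nmB_le => //; exact: ltW.
rewrite leNgt; apply/negP => yx.
by have := nmD_lt xy yx; rewrite subrK ltxx.
Qed.

Lemma nmV x : nm x^-1 = (nm x)^-1.
Proof.
have [->|x0] := eqVneq x 0; first by rewrite invr0 nm0 invr0.
have nx0 : nm x != 0 by rewrite gt_eqF // nm_gt0.
by apply: (mulfI nx0); rewrite -(nmM v) divrr ?(nm_unit v) // nm1 divff.
Qed.

Lemma nm_neq0 x : nm x != 0 -> x != 0.
Proof. by apply: contraNneq => ->; rewrite nm0. Qed.

Lemma nm_nat n : nm n%:R <= 1.
Proof. by elim: n => [|n IH]; rewrite ?nm0 // -natr1 nmD_le // nm1. Qed.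

Lemma nm_sum (I : Type) (r : seq I) (P : pred I) (f : I -> T) (e : R) : 0 <= e ->
  (forall i, P i -> nm (f i) <= e) -> nm (\sum_(i <- r | P i) f i) <= e.
Proof.
by move=> e0 H; elim/big_ind: _ => // [|x y]; [rewrite nm0|exact: nmD_le].
Qed.

(** One representative for each ball of radius e that meets the ball of radius M. With e = M = 1
    these are representatives of the residue ring. *)
Definition net (e M : R) (s : seq T) : Prop :=
  [/\ uniq s, {in s &, forall x y, nm (x - y) < e -> x = y},
      forall y, y \in s -> nm y <= M
    & forall x, nm x <= M -> exists2 y, y \in s & nm (x - y) < e].

Lemma net_exists e M : 0 < e -> exists s, net e M s.
Proof.
move=> e0; have [t tM] := nm_cover v M e0.
suff: exists s, [/\ uniq s, {in s &, forall x y, nm (x - y) < e -> x = y},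
      forall y, y \in s -> nm y <= M
    & forall x, nm x <= M -> (exists2 y, y \in t & nm (x - y) < e) ->
       exists2 y, y \in s & nm (x - y) < e].
  by case=> s [us ds sM cs]; exists s; split=> // x xM; apply: cs => //; exact: tM.
elim: t {tM} => [|a t [s [us ds sM cs]]].
  by exists [::]; split=> // x _ [y]; rewrite in_nil.
have [[x0 x0M x0a]|nx0] := pselect (exists2 x, nm x <= M & nm (x - a) < e); last first.
  exists s; split=> // x xM [y]; rewrite inE => /orP[/eqP -> xa|yt xy].
    by case: nx0; exists x.
  by apply: cs => //; exists y.
have [[y ys x0y]|ny] := pselect (exists2 y, y \in s & nm (x0 - y) < e).
  exists s; split=> // x xM [z]; rewrite inE => /orP[/eqP -> xa|zt xz].
    by exists y => //; apply: nm_trans x0y; apply: nm_trans xa _; rewrite nmB_sym.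
  by apply: cs => //; exists z.
exists (x0 :: s); split.
- rewrite /= us andbT; apply: contra_notN ny => x0s.
  by exists x0 => //; rewrite subrr nm0.
- move=> x y; rewrite !inE => /orP[/eqP ->|xs] /orP[/eqP ->|ys] // xy.
  + by case: ny; exists y.
  + by case: ny; exists x => //; rewrite nmB_sym.
  + exact: ds.
- by move=> y; rewrite inE => /orP[/eqP ->|/sM].
move=> x xM [z]; rewrite inE => /orP[/eqP -> xa|zt xz].
  exists x0; first by rewrite inE eqxx.
  by apply: nm_trans xa _; rewrite nmB_sym.
have [y ys xy] := cs x xM (ex_intro2 _ _ z zt xz).
by exists y => //; rewrite inE ys orbT.
Qed.

Lemma net_filter e M s x : 0 < e -> net e M s -> nm x <= M ->
  exists y, [/\ y \in s, nm (x - y) < e & forall z, z \in s -> (nm (x - z) < e) = (z == y)].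
Proof.
move=> e0 [us ds sM cs] xM; have [y ys xy] := cs x xM; exists y; split=> // z zs.
apply/idP/eqP => [xz|->//]; apply: ds => //; apply: nm_trans xy.
by rewrite nmB_sym.
Qed.

(** Every z with nm z > nm x lies within nm x of a point of a finite net, and has the value of that
    point. So only finitely many values lie between nm x and 1. *)
Lemma value_discrete : (exists2 x, x != 0 & nm x < 1) ->
  exists2 w : T, 0 < nm w < 1 & forall x, nm x < 1 -> nm x <= nm w.
Proof.
case=> x x0 x1; have nx := nm_gt0 x0.
have [s [_ _ _ cs]] := net_exists 1 nx.
have [y0 y0P ymax] : exists2 y, y \in x :: [seq y <- s | nm y < 1] &
    forall z, z \in x :: [seq y <- s | nm y < 1] -> nm z <= nm y.
  elim: [seq y <- s | _] (x) => [|a t IH] b.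
    by exists b => [|z]; rewrite inE ?eqxx // in_nil orbF => /eqP ->.
  have [y yt yM] := IH a; have [le|lt] := leP (nm b) (nm y).
    by exists y => [|z]; rewrite inE ?yt ?orbT // => /predU1P[->|/yM].
  exists b => [|z]; rewrite inE ?eqxx // => /predU1P[->//|/yM].
  by move/le_trans; apply; exact: ltW.
have y1 : nm y0 < 1.
  by move: y0P; rewrite inE mem_filter => /orP[/eqP ->|/andP[]].
have xy0 : nm x <= nm y0 by apply: ymax; rewrite inE eqxx.
exists y0 => [|z z1]; first by rewrite y1 andbT (lt_le_trans nx).
have [zx|xz] := leP (nm z) (nm x); first exact: le_trans xy0.
have [y ys zy] := cs z (ltW z1).
have yz : nm y = nm z by apply: nm_lt_eq; apply: lt_trans xz.
by rewrite -yz; apply: ymax; rewrite inE mem_filter yz z1 ys orbT.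
Qed.

Lemma value_group w : 0 < nm w < 1 -> (forall x, nm x < 1 -> nm x <= nm w) ->
  forall x, x != 0 -> exists k, nm x = nm w ^+ k \/ nm x * nm w ^+ k = 1.
Proof.
move=> /andP[w0 w1] wmax.
have small x : x != 0 -> nm x <= 1 -> exists k, nm x = nm w ^+ k.
  move=> x0 x1; have nx := nm_gt0 x0.
  have [k kP] : exists k, nm w ^+ k < nm x.
    by apply: expr_small => //; rewrite w0.
  elim: k x x0 x1 nx kP => [|k IH] x x0 x1 nx kx.
    by have := le_lt_trans x1 kx; rewrite ltxx.
  have [xe|xl] := eqVneq (nm x) 1; first by exists 0.
  have xw : nm x <= nm w by apply: wmax; rewrite lt_neqAle xl.
  have wn0 : w != 0 by apply: nm_neq0; rewrite gt_eqF.
  have := IH (x * w^-1); rewrite (nmM v) nmV ler_pdivrMr // mul1r.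
  rewrite [_ ^+ k < _]ltr_pdivlMr // -exprSr => -[||||i iE] //.
  - by apply: nm_neq0; rewrite (nmM v) nmV mulf_neq0 ?invr_eq0 ?gt_eqF.
  - by rewrite divr_gt0.
  by exists i.+1; rewrite exprSr -iE divfK ?gt_eqF.
move=> x x0; have [x1|x1] := leP (nm x) 1.
  by have [k kE] := small x x0 x1; exists k; left.
have [||k kE] := small x^-1.
- by apply: nm_neq0; rewrite nmV invr_eq0 gt_eqF ?nm_gt0.
- by rewrite nmV invf_le1 ?nm_gt0 // ltW.
by exists k; right; rewrite -kE nmV divff // gt_eqF ?nm_gt0.
Qed.

End Valued.

(** * The residue ring of a valued division ring *)

Section Residue.
Variables (R : realType) (T : unitRingType) (nm : T -> R) (s : seq T).
Hypotheses (v : valued nm) (ns : net nm 1 1 s).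

Let nsu : uniq s. Proof. by case: ns. Qed.
Let nsd : {in s &, forall x y, nm (x - y) < 1 -> x = y}. Proof. by case: ns. Qed.
Let nsM y : y \in s -> nm y <= 1. Proof. by case: ns => _ _ + _; apply. Qed.
Let nsc x : nm x <= 1 -> exists2 y, y \in s & nm (x - y) < 1.
Proof. by case: ns => _ _ _; apply. Qed.

Lemma residue_size : (0 < size s)%N.
Proof. by have [|y] := @nsc 0; [rewrite (nm0 v)|case: (s)]. Qed.

(** Carried by the indices of a net, so that finiteness is built in; the two proofs are parameters
    because the ring structure depends on them. *)
Definition residue (_ : valued nm) (_ : net nm 1 1 s) : Type := 'I_(size s).
Local Notation L := (residue v ns).
HB.instance Definition _ := Finite.copy L 'I_(size s).

Definition rrep (i : L) : T := nth 0 s (i : 'I_(size s)).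
(** The default index concerns only x with nm x > 1, where the value has no meaning. *)
Definition red (x : T) : L := odflt (Ordinal residue_size : 'I_(size s))
   [pick i : 'I_(size s) | nm (x - nth 0 s i) < 1].

Lemma rrep_int i : nm (rrep i) <= 1.
Proof. by apply: nsM; apply: mem_nth. Qed.
Local Hint Resolve rrep_int : core.

Lemma rrepE x : nm x <= 1 -> nm (x - rrep (red x)) < 1.
Proof.
move=> x1; rewrite /rrep /red; case: pickP => [//|H].
have [y ys xy] := nsc x1.
have iy : (index y s < size s)%N by rewrite index_mem.
by have /= := H (Ordinal iy); rewrite nth_index // xy.
Qed.

Lemma rrep_eq i j : nm (rrep i - rrep j) < 1 -> i = j.
Proof.
move=> ij; apply/val_inj/eqP => /=; rewrite -(nth_uniq 0 _ _ nsu) //.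
by apply/eqP/nsd; rewrite ?mem_nth.
Qed.

Lemma redK i : red (rrep i) = i.
Proof. by apply: rrep_eq; rewrite (nmB_sym v); exact: rrepE. Qed.

Lemma red_eq x y : nm x <= 1 -> nm y <= 1 -> red x = red y <-> nm (x - y) < 1.
Proof.
move=> x1 y1; split=> [xy|xy].
  apply: (nm_trans v (rrepE x1)); rewrite xy (nmB_sym v); exact: rrepE.
apply: rrep_eq; apply: (nm_trans v (y := x)).
  by rewrite (nmB_sym v); exact: rrepE.
by apply: (nm_trans v xy); exact: rrepE.
Qed.

Lemma red_ind (P : L -> Prop) : (forall x, nm x <= 1 -> P (red x)) -> forall i, P i.
Proof. by move=> H i; rewrite -[i]redK; exact: H. Qed.

Let add (i j : L) := red (rrep i + rrep j).
Let opp (i : L) := red (- rrep i).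
Let mul (i j : L) := red (rrep i * rrep j).

Let int_add x y : nm x <= 1 -> nm y <= 1 -> nm (x + y) <= 1.
Proof. exact: nmD_le. Qed.
Let int_opp x : nm x <= 1 -> nm (- x) <= 1.
Proof. by rewrite (nmN v). Qed.
Let int_mul x y : nm x <= 1 -> nm y <= 1 -> nm (x * y) <= 1.
Proof. by move=> *; rewrite (nmM v) mulr_ile1 ?(nm_ge0 v). Qed.

Lemma red_add x y : nm x <= 1 -> nm y <= 1 -> add (red x) (red y) = red (x + y).
Proof.
move=> x1 y1; apply/red_eq; rewrite ?int_add // -(nmN v) opprB opprD addrACA.
by apply: nmD_lt => //; exact: rrepE.
Qed.

Lemma red_opp x : nm x <= 1 -> opp (red x) = red (- x).
Proof.
move=> x1; apply/red_eq; rewrite ?int_opp // opprK addrC; exact: rrepE.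
Qed.

Lemma red_mul x y : nm x <= 1 -> nm y <= 1 -> mul (red x) (red y) = red (x * y).
Proof.
move=> x1 y1; apply/red_eq; rewrite ?int_mul // (nmB_sym v).
have -> : x * y - rrep (red x) * rrep (red y) =
    (x - rrep (red x)) * y + rrep (red x) * (y - rrep (red y)).
  by rewrite mulrBl mulrBr addrA subrK.
have aux a b : nm a < 1 -> nm b <= 1 -> nm a * nm b < 1.
  by move=> a1 b1; apply: le_lt_trans a1; rewrite ler_piMr ?(nm_ge0 v).
apply: nmD_lt => //; rewrite (nmM v); last rewrite mulrC.
  by apply: aux => //; exact: rrepE.
by apply: aux => //; exact: rrepE.
Qed.

Let i0 : nm 0 <= 1. Proof. by rewrite (nm0 v). Qed.
Let i1 : nm 1 <= 1. Proof. by rewrite (nm1 v). Qed.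

Fact residue_addA : associative add.
Proof.
by do 3!elim/red_ind=> ? ?; rewrite !red_add ?int_add // addrA.
Qed.
Fact residue_addC : commutative add.
Proof. by do 2!elim/red_ind=> ? ?; rewrite !red_add // addrC. Qed.
Fact residue_add0 : left_id (red 0) add.
Proof. by elim/red_ind=> ? ?; rewrite !red_add // add0r. Qed.
Fact residue_addN : left_inverse (red 0) opp add.
Proof. by elim/red_ind=> ? ?; rewrite red_opp // red_add ?int_opp // addNr. Qed.
HB.instance Definition _ := GRing.isZmodule.Build L
  residue_addA residue_addC residue_add0 residue_addN.

Fact residue_mulA : associative mul.
Proof. by do 3!elim/red_ind=> ? ?; rewrite !red_mul ?int_mul // mulrA. Qed.
Fact residue_mul1 : left_id (red 1) mul.
Proof. by elim/red_ind=> ? ?; rewrite !red_mul // mul1r. Qed.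
Fact residue_1mul : right_id (red 1) mul.
Proof. by elim/red_ind=> ? ?; rewrite !red_mul // mulr1. Qed.
Fact residue_mulDl : left_distributive mul add.
Proof.
by do 3!elim/red_ind=> ? ?; rewrite ?(red_mul, red_add) ?int_mul ?int_add
  // mulrDl.
Qed.
Fact residue_mulDr : right_distributive mul add.
Proof.
by do 3!elim/red_ind=> ? ?; rewrite ?(red_mul, red_add) ?int_mul ?int_add
  // mulrDr.
Qed.
Fact residue_1neq0 : red 1 != red 0.
Proof. by apply/eqP => /(red_eq i1 i0); rewrite subr0 (nm1 v) ltxx. Qed.
HB.instance Definition _ := GRing.Zmodule_isNzRing.Build L
  residue_mulA residue_mul1 residue_1mul residue_mulDl residue_mulDr residue_1neq0.

Let runit : pred L := fun i => i != 0.
Let rinv (i : L) := if i == 0 then i else red (rrep i)^-1.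

Lemma red_eq0 x : nm x <= 1 -> red x = 0 <-> nm x < 1.
Proof. by move=> x1; rewrite -[in nm x](subr0 x); exact: red_eq. Qed.

Let rrep_unit i : i != 0 -> nm (rrep i) = 1.
Proof.
move=> i0'; apply/eqP; rewrite eq_le rrep_int leNgt /=; apply: contra_notN _ => H.
  exact: H.
by move/eqP: i0' => []; rewrite -[i]redK; apply/red_eq0.
Qed.

Fact residue_mulV : {in runit, left_inverse 1 rinv *%R}.
Proof.
move=> i i0'; rewrite /rinv (negPf i0') -{2}[i]redK.
have n1 := rrep_unit i0'.
rewrite [_ * _]red_mul ?(nmV v) ?n1 ?invr1 //.
by rewrite mulVr // (nm_unit v) // (nm_neq0 v) // n1 oner_eq0.
Qed.
Fact residue_Vmul : {in runit, right_inverse 1 rinv *%R}.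
Proof.
move=> i i0'; rewrite /rinv (negPf i0') -{1}[i]redK.
have n1 := rrep_unit i0'.
rewrite [_ * _]red_mul ?(nmV v) ?n1 ?invr1 //.
by rewrite divrr // (nm_unit v) // (nm_neq0 v) // n1 oner_eq0.
Qed.
Fact residue_unitP x y : y * x = 1 /\ x * y = 1 -> runit x.
Proof.
by case=> + _; apply: contra_eqN => /eqP ->; rewrite mulr0 eq_sym oner_neq0.
Qed.
Fact residue_inv0 : {in [predC runit], rinv =1 id}.
Proof. by move=> i; rewrite inE /= negbK /rinv => ->. Qed.
HB.instance Definition _ := GRing.NzRing_hasMulInverse.Build L
  residue_mulV residue_Vmul residue_unitP residue_inv0.

(** A finite domain is commutative by Wedderburn's little theorem ([finDomain_mulrC]), so even the
    residue ring of D is a field. *)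
Lemma residue_domain : GRing.integral_domain_axiom L.
Proof.
move=> x y xy; rewrite -implyNb; apply/implyP => x0.
have ux : x \is a GRing.unit by [].
by rewrite -[y](mulKr ux) xy mulr0.
Qed.

HB.instance Definition _ :=
  GRing.PzRing_hasCommutativeMul.Build L (finDomain_mulrC residue_domain).
HB.instance Definition _ := GRing.ComUnitRing_isIntegral.Build L residue_domain.
HB.instance Definition _ :=
  GRing.UnitRing_isField.Build L (finDomain_field residue_domain).

End Residue.

Lemma residue_field_exists (R : realType) (T : unitRingType) (nm : T -> R) :
  valued nm -> exists (L : finFieldType) (red : T -> L),
  [/\ forall x y, nm x <= 1 -> nm y <= 1 -> red (x + y) = red x + red y,
      forall x y, nm x <= 1 -> nm y <= 1 -> red (x * y) = red x * red y,
      red 1 = 1, forall x, nm x <= 1 -> red x = 0 <-> nm x < 1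
    & forall l, exists2 x, nm x <= 1 & red x = l].
Proof.
move=> v; have [s ns] := net_exists v 1 ltr01.
exists (residue v ns : finFieldType), (red v ns); split.
- by move=> x y x1 y1; rewrite -red_add.
- by move=> x y x1 y1; rewrite -red_mul.
- by [].
- exact: red_eq0.
- by move=> l; exists (rrep l); [exact: rrep_int|exact: redK].
Qed.

(** * Frobenius orbits in finite fields *)

Lemma finField_generator (L : finFieldType) : exists2 z : L, z != 0 &
  (forall x, x != 0 -> exists i, x = z ^+ i) /\ (forall i, z ^+ i = 1 -> (#|L|.-1 %| i)%N).
Proof.
have /cyclicP[u uE] := field_unit_group_cyclic [set: {unit L}]%G.
have val_expu i : val (u ^+ i)%g = val u ^+ i.
  by elim: i => [|i IH] //; rewrite expgS exprS -IH.
exists (val u); first by rewrite -unitfE; exact: valP.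
split=> [x x0|i ui].
  have ux : x \is a GRing.unit by rewrite unitfE.
  have : FinRing.unit L ux \in <[u]>%g by rewrite -uE inE.
  by case/cycleP => i /(congr1 val) /= ->; exists i; rewrite val_expu.
rewrite -card_finField_unit uE -[#|_|]/(#[u]%g) order_dvdn; apply/eqP/val_inj.
by rewrite val_expu.
Qed.

Section FrobeniusOrbit.
Variables (L : finFieldType) (q : nat) (z : L).
Hypothesis z0 : z != 0.
Hypotheses (q1 : (1 < q)%N) (frobD : forall x y : L, (x + y) ^+ q = x ^+ q + y ^+ q).
Hypothesis zgen : forall x, x != 0 -> exists i, x = z ^+ i.
Hypothesis zord : forall i, z ^+ i = 1 -> (#|L|.-1 %| i)%N.
Variables (k : finType) (emb : k -> L).
Hypotheses (cardk : #|k| = q) (embI : injective emb).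
Hypothesis emb_fix : forall c, emb c ^+ q = emb c.

Definition frob (x : L) := x ^+ q.

Fact frob_additive : zmod_morphism frob.
Proof.
move=> x y; apply: (addIr (frob y)); rewrite subrK -frobD subrK.
by [].
Qed.
HB.instance Definition _ := GRing.isZmodMorphism.Build L L frob frob_additive.
Fact frob_multiplicative : monoid_morphism frob.
Proof. by split=> [|x y]; rewrite /frob ?expr1n // exprMn. Qed.
HB.instance Definition _ := GRing.isMonoidMorphism.Build L L frob frob_multiplicative.

Lemma iter_frob i x : iter i frob x = x ^+ (q ^ i).
Proof. by elim: i => [|i IH]; rewrite ?expr1 // iterS IH /frob -exprM expnSr. Qed.

(** The q values of [emb] are roots of X^q - X; a further root would exceed the degree. Thus [emb],
    a mere injection, has the fixed field as its image. *)
Lemma frob_fixedP x : frob x = x <-> exists c, x = emb c.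
Proof.
split=> [fx|[c ->]]; last exact: emb_fix.
pose P : {poly L} := 'X^q - 'X.
have sP : size P = q.+1.
  by rewrite size_polyDl size_polyXn // size_polyN size_polyX.
apply: contrapT => nx; pose s := x :: [seq emb c | c : k].
have us : uniq s.
  rewrite /= map_inj_uniq ?enum_uniq ?andbT //; apply: contra_notN nx.
  by case/mapP => c _ ->; exists c.
have rs : all (root P) s.
  apply/allP => y; rewrite /root hornerD hornerN hornerX hornerXn subr_eq0 inE.
  by case/predU1P => [->|/mapP[c _ ->]]; [exact/eqP|exact/eqP/emb_fix].
have P0 : P != 0 by rewrite -size_poly_eq0 sP.
have := max_poly_roots P0 rs us.
by rewrite sP /= size_map -cardE cardk ltnn.
Qed.

Lemma frob_orbit_exists : exists f, [/\ (0 < f)%N, z ^+ (q ^ f) = z &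
   forall i j, (i < f)%N -> (j < f)%N -> z ^+ (q ^ i) = z ^+ (q ^ j) -> i = j].
Proof.
have fi i : injective (iter i frob).
  by elim: i => [|i IH] x y //=; rewrite -!iterS => /fmorph_inj /IH.
have key i j : (i < j)%N -> z ^+ (q ^ i) = z ^+ (q ^ j) -> z ^+ (q ^ (j - i)) = z.
  move=> ij; rewrite -!iter_frob -{1}(subnKC (ltnW ij)) iterD => /fi <-.
  by [].
have exf : exists f, (0 < f)%N && (z ^+ (q ^ f) == z).
  have : ~~ injectiveb (fun i : 'I_#|L|.+1 => z ^+ (q ^ i)).
    apply/negP => /injectiveP/leq_card; rewrite card_ord ltnn //.
  case/injectivePn => i [j ij]; wlog lt : i j ij / (i < j)%N.
    move=> H; have [lt|lt|/val_inj eq] := ltngtP i j; first exact: H lt.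
      by rewrite eq_sym in ij; move=> /esym; exact: H lt.
    by rewrite eq eqxx in ij.
  by move/(key _ _ lt) => zz; exists (j - i)%N; rewrite subn_gt0 lt zz eqxx.
case: (ex_minnP exf) => f /andP[f0 /eqP zf] fmin; exists f; split=> //.
have aux i j : (i < j)%N -> (j < f)%N -> z ^+ (q ^ i) = z ^+ (q ^ j) -> False.
  move=> ij jf /(key _ _ ij) zz.
  have : (f <= j - i)%N by apply: fmin; rewrite subn_gt0 ij zz eqxx.
  by rewrite leqNgt (leq_ltn_trans (leq_subr _ _) jf).
move=> i j fi' jf zz; have [lt|lt|//] := ltngtP i j.
  by case: (aux i j).
by case: (aux j i).
Qed.

Variable f : nat.
Hypotheses (f0 : (0 < f)%N) (zf : z ^+ (q ^ f) = z).
Hypothesis zdist : forall i j, (i < f)%N -> (j < f)%N -> z ^+ (q ^ i) = z ^+ (q ^ j) -> i = j.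

Definition orbit_seq := [seq z ^+ (q ^ i) | i <- iota 0 f].
Definition orbit_poly : {poly L} := \prod_(c <- orbit_seq) ('X - c%:P).

Lemma orbit_uniq : uniq orbit_seq.
Proof.
rewrite map_inj_in_uniq ?iota_uniq // => i j; rewrite !mem_iota !add0n /=.
exact: zdist.
Qed.

Lemma orbit_poly_fixed : map_poly frob orbit_poly = orbit_poly.
Proof.
rewrite /orbit_poly /orbit_seq big_map rmorph_prod /=.
have -> : iota 0 f = index_iota 0 f by rewrite /index_iota subn0.
rewrite -(prednK f0).
under eq_bigr => i _ do rewrite map_polyXsubC /= /frob -exprM -expnSr.
rewrite big_nat_recr //= [RHS]big_nat_recl //= mulrC prednK // zf.
by rewrite expn0 expr1.
Qed.

Lemma frob_fixed_root (Q : {poly L}) i : map_poly frob Q = Q -> root Q z -> root Q (z ^+ (q ^ i)).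
Proof.
move=> QF Qz; elim: i => [|i IH]; first by rewrite expr1.
by rewrite expnSr exprM -/(frob _) -QF fmorph_root.
Qed.

Lemma root_orbit (Q : {poly L}) : map_poly frob Q = Q -> root Q z -> all (root Q) orbit_seq.
Proof. by move=> QF Qz; apply/allP => _ /mapP[i _ ->]; exact: frob_fixed_root. Qed.

Lemma size_orbit_le (Q : {poly L}) : Q != 0 -> map_poly frob Q = Q -> root Q z -> (f < size Q)%N.
Proof.
move=> Q0 QF Qz; have := max_poly_roots Q0 (root_orbit QF Qz) orbit_uniq.
by rewrite size_map size_iota.
Qed.

Lemma orbit_polyE (Q : {poly L}) : Q \is monic -> size Q = f.+1 ->
  map_poly frob Q = Q -> root Q z -> Q = orbit_poly.
Proof.
move=> Qm sQ QF Qz; have := @all_roots_prod_XsubC _ Q orbit_seq.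
rewrite size_map size_iota sQ => /(_ erefl (root_orbit QF Qz)).
rewrite uniq_rootsE orbit_uniq => /(_ isT).
by rewrite (eqP Qm) scale1r.
Qed.

(** A nonzero x is some z^i, and the remainder of X^i modulo the orbit polynomial has
    Frobenius-fixed coefficients and degree below f. *)
Lemma orbit_span x : exists2 c : nat -> k, True & x = \sum_(i < f) emb (c i) * z ^+ i.
Proof.
have fixc (P : {poly L}) : map_poly frob P = P -> (size P <= f)%N ->
    exists2 c : nat -> k, True & P.[z] = \sum_(i < f) emb (c i) * z ^+ i.
  move=> PF sP; have /choice[c cE] : forall i, exists c, P`_i = emb c.
    by move=> i; apply/frob_fixedP; rewrite -{2}PF coef_map.
  exists c => //; rewrite (horner_coef_wide _ sP).
  by apply: eq_bigr => i _; rewrite cE.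
have [->|x0] := eqVneq x 0.
  have [||c _ cE] := fixc 0; [by rewrite rmorph0|by rewrite size_poly0|].
  by exists c => //; rewrite -cE horner0.
have [i ->] := zgen x0.
have gz : root orbit_poly z.
  by rewrite root_prod_XsubC; apply/mapP; exists 0%N; rewrite ?mem_iota ?expr1.
have [||c _ cE] := fixc ('X^i %% orbit_poly).
- by rewrite map_modp orbit_poly_fixed rmorphXn /= map_polyX.
- have := ltn_modp 'X^i orbit_poly.
  rewrite size_prod_XsubC size_map size_iota ltnS => ->.
  by rewrite monic_neq0 // monic_prod // => c _; exact: monicXsubC.
exists c => //; rewrite -cE.
have := congr1 (horner^~ z) (divp_eq 'X^i orbit_poly).
by rewrite hornerD hornerM (eqP gz) mulr0 add0r hornerXn.
Qed.

(** A relation between 1, z, ..., z^(f-1) with fixed coefficients would be a polynomial of degree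
    less than f vanishing at the f points of the orbit. *)
Lemma card_orbit : (q ^ f <= #|L|)%N.
Proof.
rewrite -cardk -{1}(card_ord f) -card_ffun.
apply: (@leq_card _ _ (fun g : {ffun 'I_f -> k} => \sum_i emb (g i) * z ^+ i)).
move=> g h gh.
pose ext (g : {ffun 'I_f -> k}) i := if insub i is Some i' then emb (g i') else 0.
have extE g' (i : 'I_f) : ext g' i = emb (g' i) by rewrite /ext valK.
have ext_fix g' i : frob (ext g' i) = ext g' i.
  by rewrite /ext; case: insub => [i'|]; [exact: emb_fix|rewrite raddf0].
pose P := \poly_(i < f) (ext g i - ext h i).
have Pz : root P z.
  rewrite /root horner_poly; apply/eqP; rewrite -[RHS](subrr (\sum_i emb (g i) * z ^+ i)).
  rewrite [X in _ - X]gh -sumrB; apply: eq_bigr => i _.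
  by rewrite !extE mulrBl.
have PF : map_poly frob P = P.
  apply/polyP => i; rewrite coef_map coef_poly /=; case: ifP => _; last by rewrite raddf0.
  by rewrite raddfB /= !ext_fix.
have P0 : P = 0.
  apply/eqP; apply: contraT => P0; have := size_orbit_le P0 PF Pz.
  by rewrite ltnNge size_poly.
apply/ffunP => i; apply: embI; rewrite -!extE; apply/eqP.
by rewrite -subr_eq0; have := congr1 (fun p : {poly L} => p`_i) P0;
  rewrite coef_poly ltn_ord coef0 => ->.
Qed.

(** The norm of z to the fixed field, z^M with M = 1 + q + ... + q^(f-1). As |L| - 1 = (q - 1) M, it
    generates the nonzero fixed elements. *)
Definition orbit_norm := \prod_(c <- orbit_seq) c.

Let M := (\sum_(i < f) q ^ i)%N.

Lemma orbit_normE : orbit_norm = z ^+ M.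
Proof.
rewrite /orbit_norm big_map expr_sum -(big_mkord xpredT (fun i => z ^+ (q ^ i))).
by rewrite /index_iota subn0.
Qed.

(** z has order |L| - 1 and z^(q^f - 1) = 1, so |L| - 1 divides q^f - 1; [card_orbit] is the
    opposite inequality. *)
Lemma orbit_order : (#|L|.-1 = q.-1 * M)%N.
Proof.
rewrite -predn_exp; have qf : (1 < q ^ f)%N by rewrite -(exp1n f) ltn_exp2r.
apply/anti_leq/andP; split; last by rewrite -!subn1 leq_sub2r ?card_orbit.
apply: dvdn_leq; first by rewrite -subn1 subn_gt0.
apply: zord; apply: (mulfI z0).
by rewrite -exprS prednK ?mulr1 // ltnW.
Qed.

Lemma orbit_norm_order i : orbit_norm ^+ i = 1 -> (q.-1 %| i)%N.
Proof.
rewrite orbit_normE -exprM => /zord; rewrite orbit_order [(q.-1 * M)%N]mulnC.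
rewrite dvdn_pmul2l //.
rewrite /M -(prednK f0) big_ord_recl expn0 //.
Qed.

Lemma orbit_norm_generator l : l != 0 -> frob l = l -> exists i, l = orbit_norm ^+ i.
Proof.
move=> l0 lF; have [j lE] := zgen l0.
have lq : l ^+ q.-1 = 1.
  by apply: (mulfI l0); rewrite -exprS prednK ?mulr1 // ltnW.
move: lq; rewrite lE -exprM => /zord; rewrite orbit_order [(q.-1 * M)%N]mulnC dvdn_pmul2r.
  by case/dvdnP => i ->; exists i; rewrite orbit_normE -exprM mulnC.
by rewrite -subn1 subn_gt0.
Qed.

End FrobeniusOrbit.

(** * Smooth characters of D^* factor through the reduced norm *)

Section PrincipalUnits.
Variables (R : realType) (T : unitRingType) (nm : T -> R) (p : nat).
Hypotheses (v : valued nm) (p_pr : prime p) (p_small : nm p%:R < 1).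

(** Expand (1 + y)^p: the inner binomial coefficients are divisible by p, and the last term is
    y^p. *)
Lemma nm_expp_sub1 x : nm (x - 1) < 1 ->
  nm (x ^+ p - 1) <= nm (x - 1) * Num.max (nm p%:R) (nm (x - 1)).
Proof.
move=> y1; set y := x - 1; have -> : x = y + 1 by rewrite subrK.
have y0 := nm_ge0 v y.
have p0 := prime_gt0 p_pr.
have -> : (y + 1) ^+ p - 1 = \sum_(i < p.-1) y ^+ i.+1 *+ 'C(p, i.+1) + y ^+ p.
  have -> : (y + 1) ^+ p = \sum_(i < p.-1.+2) y ^+ i *+ 'C(p, i).
    by rewrite exprD1n prednK.
  rewrite big_ord_recl big_ord_recr /= expr0 bin0 mulr1n [1 + _]addrC addrK.
  by rewrite /bump !add1n prednK // binn mulr1n.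
apply: (nmD_le v).
  apply: (nm_sum v) => [|i _].
    by rewrite mulr_ge0 // le_max (nm_ge0 v).
  have ip : (0 < i.+1 < p)%N by rewrite /= -ltn_predRL; exact: ltn_ord.
  have /dvdnP[c ->] := prime_dvd_bin p_pr ip.
  rewrite -mulr_natr natrM !(nmM v) exprS (nmM v) -mulrA ler_wpM2l //.
  apply: le_trans (_ : nm p%:R <= _); last by rewrite le_max lexx.
  rewrite mulrCA mulrA ler_piMl ?(nm_ge0 v) //.
  by rewrite mulr_ile1 ?(nm_ge0 v) ?(nm_nat v) // (nmX v) exprn_ile1 // ltW.
rewrite (nmX v); case: p (prime_gt1 p_pr) => [|[|k]] // _.
rewrite exprS ler_wpM2l // le_max; apply/orP; right.
by rewrite exprS ler_piMr // exprn_ile1 // ltW.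
Qed.

Lemma nm_exppk_small x (r : R) : nm (x - 1) < 1 -> 0 < r ->
  exists e, nm (x ^+ (p ^ e) - 1) < r.
Proof.
move=> x1 r0; pose b := Num.max (nm p%:R) (nm (x - 1)).
have b1 : b < 1 by rewrite gt_max p_small.
have b0 : 0 <= b by rewrite le_max (nm_ge0 v).
have step e : nm (x ^+ (p ^ e) - 1) <= b ^+ e * nm (x - 1).
  elim: e => [|e IH]; first by rewrite expn0 !expr1 expr0 mul1r.
  have le : nm (x ^+ (p ^ e) - 1) <= nm (x - 1).
    by apply: le_trans IH _; rewrite ler_piMl ?(nm_ge0 v) // exprn_ile1 // ltW.
  rewrite expnSr exprM; apply: le_trans (nm_expp_sub1 (le_lt_trans le x1)) _.
  rewrite exprSr mulrAC; apply: ler_pM => //; first exact: nm_ge0 v _.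
    by rewrite le_max (nm_ge0 v).
  by rewrite /b ge_max !le_max lexx le orbT.
(* b = 0 is apart because [expr_small] asks for a positive base; it happens for x = 1 when p = 0 in
   T. *)
have [b00|bn0] := eqVneq b 0.
  exists 1%N; apply: le_lt_trans (step 1%N) _.
  by rewrite b00 expr1 mul0r.
have [|k kr] := @expr_small _ b r _ r0; first by rewrite b1 andbT lt_def bn0.
exists k; apply: le_lt_trans (step k) _; apply: le_lt_trans kr.
by rewrite ler_piMr ?exprn_ge0 // ltW.
Qed.

(* x ^ (p ^ e) tends to 1, and c ^ (p ^ e) = 1 forces c = 1 in characteristic p. *)
Lemma character_principal_unit (K : fieldType) (chi : T -> K) (r : R) :
  p \in [pchar K] -> 0 < r ->
  (forall x y, x != 0 -> y != 0 -> chi (x * y) = chi x * chi y) ->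
  (forall x, nm (x - 1) < r -> chi x = 1) ->
  forall x, nm (x - 1) < 1 -> chi x = 1.
Proof.
move=> pK r0 chiM chi1 x x1.
have x0 : x != 0.
  by apply: contraTneq x1 => ->; rewrite sub0r (nmN v) (nm1 v) ltxx.
have xn0 i : x ^+ i != 0.
  by apply: (nm_neq0 v); rewrite (nmX v) expf_neq0 // gt_eqF // (nm_gt0 v).
have chiX i : chi (x ^+ i) = chi x ^+ i.
  elim: i => [|i IH]; first by rewrite chi1 // subrr (nm0 v).
  by rewrite !exprS chiM // IH.
have [e ex] := nm_exppk_small x1 r0.
have := chi1 _ ex; rewrite chiX => /eqP; rewrite -subr_eq0.
have -> : chi x ^+ (p ^ e) - 1 = (chi x - 1) ^+ (p ^ e).
  have pn : [pchar K].-nat (p ^ e)%N.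
    by rewrite pnatX (eq_pnat _ (pcharf_eq pK)) pnat_id.
  by rewrite exprDn_pchar // exprNn_pchar // expr1n.
by rewrite expf_eq0 => /andP[_]; rewrite subr_eq0 => /eqP.
Qed.

End PrincipalUnits.

(** * Characters of the unit group of D modulo principal units *)

Section Characters.
Variables (R : realType) (p d : nat) (F : fieldType) (absF : F -> R) (D : falgType F).
Variables (nm : D -> R) (nrd : D -> F).
Hypotheses (vF : valued absF) (v : valued nm).
Hypothesis nmE : forall x, nm x = absF (algnorm x).
Hypothesis coord_bound : exists B : R, forall x i, nm x <= 1 -> absF (coordrow x 0 i) <= B.
Hypotheses (p_pr : prime p) (p_small : absF p%:R < 1).
Hypothesis F_nontriv : exists2 a, a != 0 & absF a < 1.
Hypotheses (d_gt0 : (0 < d)%N) (dimD : \dim {:D} = (d ^ 2)%N).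
Hypothesis centD : 'Z({:D})%VS = 1%VS.
Hypothesis nrdM : forall x y, x != 0 -> y != 0 -> nrd (x * y) = nrd x * nrd y.
Hypothesis nrdE : forall x m, x != 0 ->
  m \is monic -> irreducible_poly m -> horner_alg x m = 0 ->
  exists2 r, (r * (size m).-1 = d)%N & nrd x = (-1) ^+ d * (m ^+ r).[0].

Let divD : forall x : D, x != 0 -> x \is a GRing.unit := nm_unit v.
Let dimD_gt0 : (0 < \dim {:D})%N. Proof. exact: adim_gt0. Qed.

Let mulD_neq0 (x y : D) : x != 0 -> y != 0 -> x * y != 0.
Proof. by move=> x0 y0; apply: (nm_neq0 v); rewrite (nmM v) mulf_neq0 ?gt_eqF ?(nm_gt0 v). Qed.
Let expD_neq0 (x : D) i : x != 0 -> x ^+ i != 0.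
Proof. by move=> x0; apply: (nm_neq0 v); rewrite (nmX v) expf_neq0 // gt_eqF ?(nm_gt0 v). Qed.
Let invD_neq0 (x : D) : x != 0 -> x^-1 != 0.
Proof. by move=> x0; apply: (nm_neq0 v); rewrite (nmV v) invr_eq0 gt_eqF ?(nm_gt0 v). Qed.

Let nm_alg a : nm a%:A = absF a ^+ (d ^ 2).
Proof. by rewrite nmE algnorm_alg dimD (nmX vF). Qed.

Let d2_gt0 : (0 < d ^ 2)%N. Proof. by rewrite expn_gt0 d_gt0. Qed.

Let nm_alg_le1 a : (nm a%:A <= 1) = (absF a <= 1).
Proof.
by rewrite nm_alg -[1 in LHS](expr1n _ (d ^ 2)) ler_pXn2r ?nnegrE ?(nm_ge0 vF).
Qed.
Let nm_alg_lt1 a : (nm a%:A < 1) = (absF a < 1).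
Proof.
by rewrite nm_alg -[1 in LHS](expr1n _ (d ^ 2)) ltr_pXn2r ?nnegrE ?(nm_ge0 vF).
Qed.

Let minpoly_nrd x : x != 0 -> exists m r, [/\ m \is monic, irreducible_poly m,
  horner_alg x m = 0, forall h, horner_alg x h = 0 -> m %| h &
  (r * (size m).-1 = d)%N /\ nrd x = (-1) ^+ d * (m ^+ r).[0]].
Proof.
move=> x0; have [m [mmon mirr mx mmin]] := minpoly_exists divD x.
have [r rd nx] := nrdE x0 mmon mirr mx.
by exists m, r.
Qed.

(** Up to sign both norms are powers of m(0), with exponents r and r' such that r deg m = d and r'
    deg m = d^2; hence r' = r d. *)
Lemma nm_nrd x : x != 0 -> nm x = absF (nrd x) ^+ d.
Proof.
move=> x0; have [m [r [mmon mirr mx _ [rd ->]]]] := minpoly_nrd x0; rewrite nmE.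
have [r' rd' ->] := algnorm_minpoly divD mmon mirr mx.
rewrite !(nmM vF) !(nmX vF) !(nmN vF) !(nm1 vF) !expr1n !mul1r !horner_exp.
rewrite !(nmX vF) -exprM; congr (_ ^+ _).
move: rd'; rewrite dimD -rd; have m0 : (0 < (size m).-1)%N.
  by case: mirr => + _; case: (size m) => [|[]].
move=> /eqP; rewrite expnS expn1 mulnA eqn_pmul2r // => /eqP ->.
by rewrite mulnC mulnA.
Qed.

Lemma nrd_neq0 x : x != 0 -> nrd x != 0.
Proof.
move=> x0; apply: contraTneq (nm_gt0 v x0) => nx.
by rewrite (nm_nrd x0) nx (nm0 vF) expr0n gtn_eqF // ltxx.
Qed.

Lemma nrdX x i : x != 0 -> nrd (x ^+ i) = nrd x ^+ i.
Proof.
move=> x0; elim: i => [|i IH]; last by rewrite exprS nrdM ?expD_neq0 // IH exprS.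
have n10 : nrd 1 != 0 by rewrite nrd_neq0 // oner_neq0.
by apply: (mulfI n10); rewrite !expr0 mulr1 -nrdM ?mulr1 ?oner_neq0.
Qed.

Lemma nrdV x : x != 0 -> nrd x^-1 = (nrd x)^-1.
Proof.
move=> x0; have n0 := nrd_neq0 x0; apply: (mulfI n0).
by rewrite -nrdM ?invD_neq0 // divrr ?divD // divff // -(expr0 x) nrdX.
Qed.

Variables (L : finFieldType) (red : D -> L).
Hypothesis redD : forall x y, nm x <= 1 -> nm y <= 1 -> red (x + y) = red x + red y.
Hypothesis redM : forall x y, nm x <= 1 -> nm y <= 1 -> red (x * y) = red x * red y.
Hypothesis red1 : red 1 = 1.
Hypothesis red_eq0 : forall x, nm x <= 1 -> red x = 0 <-> nm x < 1.
Hypothesis red_surj : forall l, exists2 x, nm x <= 1 & red x = l.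
Variables (k : finFieldType) (redF : F -> k).
Hypothesis redFD : forall x y, absF x <= 1 -> absF y <= 1 -> redF (x + y) = redF x + redF y.
Hypothesis redFM : forall x y, absF x <= 1 -> absF y <= 1 -> redF (x * y) = redF x * redF y.
Hypothesis redF1 : redF 1 = 1.
Hypothesis redF_eq0 : forall x, absF x <= 1 -> redF x = 0 <-> absF x < 1.
Hypothesis redF_surj : forall l, exists2 x, absF x <= 1 & redF x = l.

Let nmN1 (x : D) : nm x <= 1 -> nm (- x) <= 1. Proof. by rewrite (nmN v). Qed.
Let nmM1 (x y : D) : nm x <= 1 -> nm y <= 1 -> nm (x * y) <= 1.
Proof. by move=> *; rewrite (nmM v) mulr_ile1 ?(nm_ge0 v). Qed.
Let nmX1 (x : D) i : nm x <= 1 -> nm (x ^+ i) <= 1.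
Proof. by move=> *; rewrite (nmX v) exprn_ile1 ?(nm_ge0 v). Qed.
Let int0 : nm 0 <= 1. Proof. by rewrite (nm0 v). Qed.
Let int1 : nm 1 <= 1. Proof. by rewrite (nm1 v). Qed.

Let red0 : red 0 = 0. Proof. by apply/red_eq0; rewrite (nm0 v). Qed.
Let redN x : nm x <= 1 -> red (- x) = - red x.
Proof.
move=> x1; apply: (addIr (red x)); rewrite -redD ?nmN1 //.
by rewrite !addNr.
Qed.
Let redB x y : nm x <= 1 -> nm y <= 1 -> red (x - y) = red x - red y.
Proof. by move=> x1 y1; rewrite redD ?nmN1 // redN. Qed.
Let redX x i : nm x <= 1 -> red (x ^+ i) = red x ^+ i.
Proof.
by move=> x1; elim: i => [|i IH]; rewrite ?red1 // !exprS redM ?nmX1 // IH.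
Qed.
Let red_eqP x y : nm x <= 1 -> nm y <= 1 -> red x = red y <-> nm (x - y) < 1.
Proof.
move=> x1 y1; rewrite -red_eq0 ?nmB_le // redB //.
by split=> [->|/eqP]; rewrite ?subrr // subr_eq0 => /eqP.
Qed.
Let redF_eqP x y : absF x <= 1 -> absF y <= 1 -> redF x = redF y <-> absF (x - y) < 1.
Proof.
move=> x1 y1; rewrite -redF_eq0 ?(nmB_le vF) //.
have -> : redF (x - y) = redF x - redF y.
  apply: (addIr (redF y)); rewrite -redFD ?(nmB_le vF) // !subrK //.
by split=> [->|/eqP]; rewrite ?subrr // subr_eq0 => /eqP.
Qed.

Let q := #|k|.
Let lift (c : k) : F := sval (cid2 (redF_surj c)).
Let lift_int c : absF (lift c) <= 1. Proof. by rewrite /lift; case: cid2. Qed.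
Let liftK c : redF (lift c) = c. Proof. by rewrite /lift; case: cid2. Qed.
Let emb (c : k) : L := red (lift c)%:A.

Let liftA_int c : nm (lift c)%:A <= 1. Proof. by rewrite nm_alg_le1. Qed.

Let embE a : absF a <= 1 -> red a%:A = emb (redF a).
Proof.
move=> a1; apply/red_eqP => //; rewrite ?nm_alg_le1 //.
by rewrite -scalerBl nm_alg_lt1; apply/redF_eqP => //; rewrite liftK.
Qed.

Let q_gt1 : (1 < q)%N. Proof. exact: finNzRing_gt1. Qed.

Let emb_inj : injective emb.
Proof.
move=> c c' /red_eqP; rewrite -scalerBl nm_alg_lt1 => /(_ _ _)/redF_eqP.
by rewrite !liftK; apply.
Qed.

Let emb_fix c : emb c ^+ q = emb c.
Proof.
have lq : absF (lift c ^+ q) <= 1 by rewrite (nmX vF) exprn_ile1 ?(nm_ge0 vF).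
have -> : emb c ^+ q = red (lift c ^+ q)%:A.
  rewrite /emb -redX //; congr red.
  by rewrite exprZn expr1n.
rewrite embE //; congr emb.
have redFX i : redF (lift c ^+ i) = redF (lift c) ^+ i.
  elim: i => [|i IH]; rewrite ?redF1 // !exprS redFM ?IH //.
  by rewrite (nmX vF) exprn_ile1 ?(nm_ge0 vF).
by rewrite redFX liftK expf_card.
Qed.

Let p_pchar : p \in [pchar L].
Proof.
rewrite inE p_pr /=; have -> : p%:R = red p%:R.
  elim: p => [|i IH]; rewrite ?red0 // -!natr1 redD ?(nm_nat v) // IH red1 //.
apply/eqP/red_eq0; first exact: nm_nat v _.
by rewrite -(scaler_nat p 1) nm_alg_lt1.
Qed.

Let p_pchark : p \in [pchar k].
Proof.
rewrite inE p_pr /=; have rn i : redF i%:R = i%:R.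
  elim: i => [|i IH]; last by rewrite -!natr1 redFD ?(nm_nat vF) ?(nm1 vF) // IH redF1.
  by apply/redF_eq0; rewrite (nm0 vF).
by rewrite -rn; apply/eqP/redF_eq0; [exact: nm_nat vF _|].
Qed.

Let frobqD (x y : L) : (x + y) ^+ q = x ^+ q + y ^+ q.
Proof.
apply: exprDn_pchar; rewrite (eq_pnat _ (pcharf_eq p_pchar)).
have -> : q = (p ^ logn p #|pPrimeCharType p_pchark|)%N by exact: card_pprimeChar.
by rewrite pnatX pnat_id.
Qed.

Let frobq : L -> L := frob q.

(** The residue field of F contributes q residues, all the roots that X^q - X can have in L. *)
Lemma residue_fixedP l : l ^+ q = l <-> exists2 a, absF a <= 1 & l = red a%:A.
Proof.
rewrite -[_ = l]/(frob q l = l) (frob_fixedP q_gt1 (erefl : #|k| = q) emb_inj emb_fix).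
split=> [[c ->]|[a a1 ->]]; first by exists (lift c).
by exists (redF a); rewrite embE.
Qed.

Section Lift.
Variables (zeta : L) (f : nat).
Hypotheses (zeta0 : zeta != 0) (zgen : forall x, x != 0 -> exists i, x = zeta ^+ i).
Hypothesis zord : forall i, zeta ^+ i = 1 -> (#|L|.-1 %| i)%N.
Hypotheses (f0 : (0 < f)%N) (zf : zeta ^+ (q ^ f) = zeta).
Hypothesis zdist : forall i j, (i < f)%N -> (j < f)%N ->
  zeta ^+ (q ^ i) = zeta ^+ (q ^ j) -> i = j.
Variables (w : F) (P : D).
Hypotheses (w01 : 0 < absF w < 1) (wmax : forall x, absF x < 1 -> absF x <= absF w).
Hypotheses (P01 : 0 < nm P < 1) (Pmax : forall x, nm x < 1 -> nm x <= nm P).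

Let w0 : w != 0. Proof. by apply: (nm_neq0 vF); case/andP: w01 => /gt_eqF ->. Qed.
Let P0 : P != 0. Proof. by apply: (nm_neq0 v); case/andP: P01 => /gt_eqF ->. Qed.

Let expr_inj (x : R) i j : 0 < x < 1 -> x ^+ i = x ^+ j -> i = j.
Proof.
by move=> /andP[x0 x1]; apply: ieexprIn => //; rewrite lt_eqF.
Qed.

(** e is the ramification index. Computing N w both as |w|^(d^2) and as (N P)^e = |Nrd P|^(d e) =
    |w|^(s d e) gives d = s e. *)
Lemma ramification : exists e s, [/\ d = (s * e)%N, nm w%:A = nm P ^+ e &
  absF (nrd P) = absF w ^+ s].
Proof.
have wD1 : nm w%:A < 1 by rewrite nm_alg_lt1; case/andP: w01.
have wD0 : w%:A != 0 :> D by rewrite scaler_eq0 (negPf w0) oner_eq0.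
have [e eE] : exists e, nm w%:A = nm P ^+ e.
  have [e [|eE]] := value_group v P01 Pmax wD0; first by exists e.
  have : nm w%:A * nm P ^+ e < 1.
    apply: le_lt_trans wD1; rewrite ler_piMr ?(nm_ge0 v) // exprn_ile1 ?(nm_ge0 v) //.
    by apply/ltW; case/andP: P01.
  by rewrite eE ltxx.
have nP0 := nrd_neq0 P0.
have nP1 : absF (nrd P) < 1.
  rewrite ltNge; apply/negP => nP; case/andP: P01 => _.
  by rewrite ltNge (nm_nrd P0) exprn_ege1.
have [s sE] : exists s, absF (nrd P) = absF w ^+ s.
  have [s [|sE]] := value_group vF w01 wmax nP0; first by exists s.
  have : absF (nrd P) * absF w ^+ s < 1.
    apply: le_lt_trans nP1; rewrite ler_piMr ?(nm_ge0 vF) // exprn_ile1 ?(nm_ge0 vF) //.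
    by apply/ltW; case/andP: w01.
  by rewrite sE ltxx.
exists e, s; split=> //.
move: eE; rewrite nm_alg (nm_nrd P0) sE -!exprM => /(expr_inj w01).
by move/eqP; rewrite expnS expn1 mulnCA eqn_pmul2l // => /eqP.
Qed.

Variable z : D.
Hypotheses (z_int : nm z <= 1) (redz : red z = zeta).

Lemma residue_expansion x : nm x <= 1 -> exists2 a : nat -> F, (forall i, absF (a i) <= 1) &
  nm (x - \sum_(i < f) (a i)%:A * z ^+ i) < 1.
Proof.
move=> x1; have [c _ cE] := orbit_span q_gt1 frobqD zgen (erefl : #|k| = q)
  emb_inj emb_fix f0 zf (red x).
exists (fun i => lift (c i)) => [i|]; first exact: lift_int.
have int_sum m : nm (\sum_(i < m) (lift (c i))%:A * z ^+ i) <= 1 /\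
   red (\sum_(i < m) (lift (c i))%:A * z ^+ i) = \sum_(i < m) emb (c i) * zeta ^+ i.
  elim: m => [|m [IH1 IH2]]; first by rewrite !big_ord0 (nm0 v) red0.
  rewrite !big_ord_recr /=; have zi := nmX1 m z_int.
  split; first by rewrite (nmD_le v) // nmM1.
  by rewrite redD ?nmM1 // IH2 redM // redX // redz.
have [s1 sE] := int_sum f.
by apply/red_eqP => //; rewrite sE cE.
Qed.

(* If e f < d^2, some nonzero linear form ell kills all z^j P^i with i < e and j < f.
   Successive approximation then gives ell x = w ell x' with x' integral for every integral x,
   so that ell is divisible by all powers of w on integers. *)
Lemma span_bound e : nm w%:A = nm P ^+ e -> (d ^ 2 <= e * f)%N.
Proof.
move=> wP; rewrite leqNgt; apply/negP => ef.
pose W := \matrix_(t < e * f) coordrow (z ^+ (t %% f) * P ^+ (t %/ f)).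
have [lam lam0 Wlam] : exists2 lam : 'cV[F]_(\dim {:D}), lam != 0 & W *m lam = 0.
  have : kermx W^T != 0.
    rewrite kermx_eq0 /row_free mxrank_tr; apply: contraTneq ef => rk.
    by rewrite -leqNgt -dimD -rk rank_leq_row.
  case/rowV0Pn => u /sub_kermxP uW u0; exists u^T; first by rewrite trmx_eq0.
  by apply: trmx_inj; rewrite trmx_mul trmxK uW trmx0.
pose ell (x : D) := (coordrow x *m lam) 0 0.
have ellD x y : ell (x + y) = ell x + ell y.
  by rewrite /ell (_ : coordrow (x + y) = coordrow x + coordrow y) ?mulmxDl ?mxE //;
    apply/rowP => i; rewrite !mxE linearD.
have ellZ a x : ell (a *: x) = a * ell x.
  by rewrite /ell (_ : coordrow (a *: x) = a *: coordrow x) -?scalemxAl ?mxE //;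
    apply/rowP => i; rewrite !mxE linearZ.
have ellW i j : (i < e)%N -> (j < f)%N -> ell (z ^+ j * P ^+ i) = 0.
  move=> ie jf; have tlt : (i * f + j < e * f)%N.
    by apply: leq_trans (_ : i.+1 * f <= _)%N; rewrite ?leq_mul2r ?ie ?orbT // mulSn addnC ltn_add2r.
  have /rowP/(_ 0) := congr1 (row (Ordinal tlt)) Wlam.
  rewrite row_mul rowK /= modnMDl divnMDl // modn_small // divn_small // addn0 /ell => ->.
  by rewrite !mxE.
(* Peels off one power of P: modulo P an integral y is a combination S of the z^j, and [ell] kills S
   P^i as long as i < e. *)
have step i : (i <= e)%N -> forall x, nm x <= 1 ->
    exists2 x', nm x' <= 1 & ell x = ell (x' * P ^+ i).
  elim: i => [|i IH] ie x x1; first by exists x; rewrite ?expr0 ?mulr1.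
  have [y y1 ->] := IH (ltnW ie) x x1.
  have [a a1 aE] := residue_expansion y1.
  set S := \sum_(_ < _) _ in aE; pose y' := (y - S) * P^-1.
  exists y'.
    rewrite (nmM v) (nmV v) ler_pdivrMr ?mul1r ?(nm_gt0 v) //; exact: Pmax.
  have -> : y * P ^+ i = S * P ^+ i + y' * P ^+ i.+1.
    rewrite exprS /y' !mulrA mulrVK ?divD // -mulrDl addrC subrK.
    by [].
  rewrite ellD [X in X + _](_ : _ = 0) ?add0r //.
  rewrite /S mulr_suml; elim/big_ind: _ => [|u u' u0 u'0|j _].
  - by rewrite -(scale0r 1) ellZ mul0r.
  - by rewrite ellD u0 u'0 addr0.
  - by rewrite -mulrA mulr_algl ellZ ellW ?mulr0.
have desc x : nm x <= 1 -> exists2 x', nm x' <= 1 & ell x = w * ell x'.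
  move=> x1; have [y y1 ->] := step e (leqnn e) x x1.
  exists (w^-1 *: (y * P ^+ e)); last by rewrite ellZ mulVKf.
  rewrite -mulr_algl !(nmM v) (nmX v) -wP !nm_alg (nmV vF) exprVn mulrCA mulVf ?mulr1 //.
  by rewrite expf_neq0 // gt_eqF ?(nm_gt0 vF).
have ell_int x : nm x <= 1 -> ell x = 0.
  move=> x1; apply/eqP; apply: contraT => lx0.
  have [B BP] := coord_bound.
  pose C := \sum_i absF (lam i 0).
  have B0 : 0 <= B.
    by apply: le_trans (BP 0 (Ordinal dimD_gt0) int0); exact: nm_ge0 vF _.
  have bnd y : nm y <= 1 -> absF (ell y) <= B * C.
    move=> y1; rewrite /ell mxE; apply: (nm_sum vF) => [|i _].
      by rewrite mulr_ge0 // sumr_ge0 // => i _; exact: nm_ge0 vF _.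
    rewrite (nmM vF) ler_pM ?(nm_ge0 vF) ?BP // /C (bigD1 i) //= lerDl.
    by rewrite sumr_ge0 // => l _; exact: nm_ge0 vF _.
  have iter m y : nm y <= 1 -> absF (ell y) <= absF w ^+ m * (B * C).
    elim: m y => [|m IH] y y1; first by rewrite expr0 mul1r bnd.
    have [y' y'1 ->] := desc y y1.
    by rewrite (nmM vF) exprS -mulrA ler_wpM2l ?(nm_ge0 vF) // IH.
  have lx : 0 < absF (ell x) by rewrite (nm_gt0 vF).
  have BC : 0 < B * C by apply: lt_le_trans (bnd x x1).
  have [m mP] := expr_small w01 (divr_gt0 lx BC).
  by have := iter m x x1; rewrite leNgt -ltr_pdivlMr // mP.
case/eqP: lam0; apply/colP => i; rewrite [RHS]mxE.
have ell_basis : ell (vbasis {:D})`_i = lam i 0.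
  by rewrite /ell coordrow_basis -rowE mxE.
rewrite -ell_basis.
(* A basis vector need not be integral, but its multiple by a high power of w is. *)
have [m mP] : exists m, absF w ^+ m * (nm (vbasis {:D})`_i + 1) <= 1.
  have c0 : 0 < nm (vbasis {:D})`_i + 1 by rewrite ltr_wpDl ?(nm_ge0 v).
  have [m mP] := expr_small w01 (divr_gt0 ltr01 c0).
  by exists m; rewrite -ler_pdivlMr // ltW.
have wm0 : w ^+ m != 0 by rewrite expf_neq0.
apply: (mulfI wm0); rewrite mulr0 -ellZ; apply: ell_int.
rewrite -mulr_algl (nmM v) nm_alg (nmX vF); apply: le_trans mP.
case/andP: w01 => w00 w11.
apply: ler_pM; rewrite ?(nm_ge0 v) ?exprn_ge0 ?(nm_ge0 vF) // ?lerDl //.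
by rewrite -exprM ler_wiXn2l ?(nm_ge0 vF) ?(ltW w11) // leq_pmulr.
Qed.

Lemma red_prod_XsubC (s : seq D) : (forall c, c \in s -> nm c <= 1) ->
  (forall i, nm (\prod_(c <- s) ('X - c%:P))`_i <= 1) /\
  map_poly red (\prod_(c <- s) ('X - c%:P)) = \prod_(c <- s) ('X - (red c)%:P).
Proof.
elim: s => [|c s IH] cs.
  rewrite !big_nil; split=> [i|].
    by rewrite coefC; case: ifP; rewrite ?(nm1 v) ?(nm0 v).
  by apply/polyP => i; rewrite coef_map_id0 // !coefC; case: ifP.
have [|IH1 IH2] := IH; first by move=> b bs; apply: cs; rewrite inE bs orbT.
have c1 : nm c <= 1 by apply: cs; rewrite inE eqxx.
rewrite !big_cons; set h := \prod_(b <- s) ('X - b%:P) in IH1 IH2 *.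
have coefE i : (('X - c%:P) * h)`_i = (if i == 0%N then 0 else h`_i.-1) - c * h`_i.
  by rewrite mulrBl coefB coefXM coefCM.
have int_h i : nm (if i == 0%N then 0 else h`_i.-1) <= 1.
  by case: ifP; rewrite ?(nm0 v).
split=> [i|]; first by rewrite coefE (nmB_le v) // nmM1.
apply/polyP => i; rewrite coef_map_id0 // coefE redB ?nmM1 // redM //.
rewrite -IH2 mulrBl coefB coefXM coefCM !coef_map_id0 //.
by case: ifP => _; rewrite ?red0.
Qed.

(** Conjugation preserves N, so Wedderburn's factorization is integral and reduces to a
    factorization over L, whose roots are residues of conjugates of z'. The coefficients come from
    F, so the reduction is Frobenius-fixed. *)
Lemma lift_minpoly z' : nm z' <= 1 -> red z' = zeta -> exists s r,
  let Q := \prod_(c <- s) ('X - (red c)%:P) in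
  [/\ (r * size s = d)%N, forall c, c \in s -> exists2 u, u != 0 & c = u * z' * u^-1,
      map_poly frobq Q = Q, root Q zeta &
      r = 1%N -> absF (nrd z') <= 1 /\ red (nrd z')%:A = (-1) ^+ d * Q.[0]].
Proof.
move=> z'1 rz'.
have z'0 : z' != 0 by apply: contraNneq zeta0 => z'0; rewrite -rz' z'0 red0.
have [m [r [mmon mirr mz' mmin [rd nE]]]] := minpoly_nrd z'0.
have [s [z's conj sE]] := wedderburn_factorization divD centD mmon mz' mmin.
have s_int c : c \in s -> nm c <= 1.
  move=> /conj[u u0 ->]; rewrite /conjby !(nmM v) (nmV v) mulrAC divff ?mul1r //.
  by rewrite gt_eqF ?(nm_gt0 v).
have [int_c mapE] := red_prod_XsubC s_int.
have m_int i : absF m`_i <= 1.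
  by rewrite -nm_alg_le1; have := int_c i; rewrite -sE coef_map.
have coefQ i : (\prod_(c <- s) ('X - (red c)%:P))`_i = red (m`_i)%:A.
  by rewrite -mapE -sE coef_map_id0 // coef_map.
have ms : (size m).-1 = size s.
  rewrite -(size_map_poly (in_alg D)) sE -(big_map id xpredT (fun c => 'X - c%:P)).
  by rewrite size_prod_XsubC map_id.
exists s, r => /=; split.
- by rewrite -ms.
- by move=> c /conj.
- apply/polyP => i; rewrite [LHS]coef_map_id0; last by rewrite /frobq /frob expr0n gtn_eqF // ltnW.
  by rewrite coefQ; apply/residue_fixedP; exists m`_i.
- rewrite -(big_map red xpredT (fun c => 'X - c%:P)) root_prod_XsubC -rz'.
  exact: map_f.
move=> r1; have nE' : nrd z' = (-1) ^+ d * m`_0 by rewrite nE r1 expr1 horner_coef0.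
have sgn_int : absF ((-1) ^+ d) = 1 by rewrite (nmX vF) (nmN vF) (nm1 vF) expr1n.
split; first by rewrite nE' (nmM vF) sgn_int mul1r.
rewrite horner_coef0 coefQ nE' -scalerA -mulr_algl redM ?nm_alg_le1 ?sgn_int //.
congr (_ * _); have -> : ((-1) ^+ d)%:A = (-1) ^+ d :> D.
  by rewrite -signr_odd -[RHS]signr_odd; case: odd; rewrite ?expr0 ?scale1r // expr1 scaleN1r.
by rewrite redX ?nmN1 // redN // red1.
Qed.

(* e f >= d^2 while f <= d and e <= d. *)
Lemma unramified : exists e, [/\ e = d, f = d & absF (nrd P) = absF w].
Proof.
have [e [s [dE wP nP]]] := ramification.
have [t [r [rt _ QF Qz _]]] := lift_minpoly z_int redz.
have ft : (f <= size t)%N.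
  rewrite -ltnS -[in ltnRHS](size_map red) -(size_prod_XsubC _ id) big_map.
  apply: (size_orbit_le frobqD zdist _ QF Qz).
  by rewrite monic_neq0 // monic_prod // => c _; exact: monicXsubC.
have ef := span_bound wP.
have r0 : (0 < r)%N by case: r rt d_gt0 => // <-.
have s0 : (0 < s)%N by move: d_gt0; rewrite dE muln_gt0 => /andP[].
have e0 : (0 < e)%N by move: d_gt0; rewrite dE muln_gt0 => /andP[].
have ed : (e <= d)%N by rewrite dE leq_pmull.
have fd : (f <= d)%N by rewrite -rt (leq_trans ft) // leq_pmull.
have [ee ff] : e = d /\ f = d by split; move: ef ed fd d_gt0; clear; nia.
exists e; split=> //.
have : s = 1%N by move: dE; rewrite ee; move: d_gt0; clear; nia.
by move=> s1; rewrite nP s1 expr1.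
Qed.

(** Since f = d, the reduced minimal polynomial of any lift of zeta has degree exactly d and is the
    orbit polynomial; its constant term yields the residue of Nrd z'. *)
Lemma red_nrd z' : nm z' <= 1 -> red z' = zeta ->
  absF (nrd z') <= 1 /\ red (nrd z')%:A = orbit_norm q zeta f.
Proof.
move=> z'1 rz'; have [_ [_ fd _]] := unramified.
have [t [r [rt _ QF Qz nE]]] := lift_minpoly z'1 rz'; move: QF Qz nE => /=.
set Q := \prod_(c <- t) _ => QF Qz nE.
have Qmon : Q \is monic by rewrite monic_prod // => c _; exact: monicXsubC.
have sQ : size Q = (size t).+1.
  by rewrite /Q -(big_map red xpredT (fun c => 'X - c%:P)) size_prod_XsubC size_map.
have ft : (f <= size t)%N by rewrite -ltnS -sQ (size_orbit_le frobqD zdist) // monic_neq0.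
have td : size t = d.
  apply/anti_leq/andP; split; last by rewrite -[X in (X <= _)%N]fd.
  by rewrite -rt leq_pmull //; case: (r) rt d_gt0 => // <-.
have r1 : r = 1%N by move/eqP: rt; rewrite td -{2}[d]mul1n eqn_pmul2r // => /eqP.
have [n1 ->] := nE r1; split=> //.
rewrite (orbit_polyE frobqD zdist Qmon _ QF Qz) ?sQ ?td ?fd //.
rewrite /orbit_poly horner_prod /orbit_norm.
under eq_bigr => c _ do rewrite hornerXsubC sub0r.
have prodN (r' : seq L) : \prod_(c <- r') (- c) = (-1) ^+ size r' * \prod_(c <- r') c.
  elim: r' => [|c r' IH]; first by rewrite !big_nil mulr1.
  by rewrite !big_cons IH /= exprS mulN1r !mulNr [c * (_ * _)]mulrCA.
by rewrite prodN size_map size_iota mulrA -expr2 sqrr_sign mul1r.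
Qed.

Variables (K : fieldType) (chi : D -> K).
Hypothesis chiM : forall x y, x != 0 -> y != 0 -> chi (x * y) = chi x * chi y.
Hypothesis chi1 : forall x, nm (x - 1) < 1 -> chi x = 1.

Let chi_1 : chi 1 = 1. Proof. by apply: chi1; rewrite subrr (nm0 v). Qed.

Let chi_neq0 x : x != 0 -> chi x != 0.
Proof.
move=> x0; apply: contra_eq_neq chi_1 => cx.
by rewrite -(divrr (divD x0)) chiM ?invD_neq0 // cx mul0r eq_sym oner_neq0.
Qed.

Let chiX x i : x != 0 -> chi (x ^+ i) = chi x ^+ i.
Proof.
by move=> x0; elim: i => [|i IH]; rewrite ?chi_1 // exprS chiM ?expD_neq0 // IH exprS.
Qed.

Let chi_red x y : nm x = 1 -> nm (x - y) < 1 -> chi x = chi y.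
Proof.
move=> nx xy; have x0 : x != 0 by apply: (nm_neq0 v); rewrite nx oner_neq0.
have y0 : y != 0 by apply: (nm_neq0 v); rewrite (nm_lt_eq v (x := x)) nx ?oner_neq0.
have -> : y = x * (x^-1 * y) by rewrite mulVKr ?divD.
rewrite chiM ?mulD_neq0 ?invD_neq0 // (chi1 (x := x^-1 * y)) ?mulr1 //.
rewrite -(mulVr (divD x0)) -mulrBr (nmM v) (nmV v) nx invr1 mul1r.
by rewrite (nmB_sym v).
Qed.

Let nm_red1 x : nm x <= 1 -> red x != 0 -> nm x = 1.
Proof.
move=> x1 rx; apply/eqP; rewrite eq_le x1 leNgt; apply: contra_neqN rx.
by move/(red_eq0 x1).
Qed.

Let nmz : nm z = 1. Proof. by apply: nm_red1 => //; rewrite redz. Qed.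
Let z0 : z != 0. Proof. by apply: (nm_neq0 v); rewrite nmz oner_neq0. Qed.

(* zeta ^ q is a root of the reduction of the minimal polynomial of z, so by Wedderburn
   it is the residue of a conjugate of z. *)
Lemma chi_lift_order : chi z ^+ q.-1 = 1.
Proof.
have [t [r [_ conj QF Qz _]]] := lift_minpoly z_int redz; move: QF Qz => /= QF Qz.
have := frob_fixed_root frobqD 1 QF Qz.
rewrite expn1 -(big_map red xpredT (fun c => 'X - c%:P)) root_prod_XsubC.
case/mapP => c ct zc; have [u u0 cE] := conj c ct.
have nc : nm c = 1.
  by rewrite cE !(nmM v) (nmV v) nmz mulr1 divff // gt_eqF ?(nm_gt0 v).
have cz : chi c = chi z.
  rewrite cE !chiM ?mulD_neq0 ?invD_neq0 // mulrAC -chiM ?invD_neq0 //.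
  by rewrite divrr ?divD // chi_1 mul1r.
have : chi c = chi (z ^+ q).
  apply: chi_red => //; apply/red_eqP; rewrite ?nc ?nmX1 //.
  by rewrite redX // redz zc.
rewrite cz chiX // => zz; apply: (mulfI (chi_neq0 z0)).
by rewrite -exprS prednK ?mulr1 // ltnW.
Qed.

(** Write x = z^i y with y a principal unit, so chi x = (chi z)^i. If Nrd y is principal too, the
    i-th power of the norm of zeta is 1, so q - 1 divides i and [chi_lift_order] concludes. *)
Lemma chi_kernel x : x != 0 -> absF (nrd x - 1) < 1 -> chi x = 1.
Proof.
move=> x0 nx1.
have nx : absF (nrd x) = 1.
  by rewrite -(nm1 vF); apply: (nm_lt_eq vF); rewrite (nm1 vF) (nmB_sym vF).
have nmx : nm x = 1 by rewrite nm_nrd // nx expr1n.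
have rx : red x != 0.
  by apply/eqP => /(red_eq0 _); rewrite nmx lexx ltxx => /(_ isT).
have [i rE] := zgen rx.
pose y := z^-1 ^+ i * x; have zi0 : z^-1 ^+ i != 0 by rewrite expD_neq0 ?invD_neq0.
have xE : x = z ^+ i * y by rewrite /y exprVn mulVKr ?divD ?expD_neq0.
have nmzi j : nm (z ^+ j) = 1 by rewrite (nmX v) nmz expr1n.
have y1 : nm (y - 1) < 1.
  have -> : y - 1 = (z ^+ i)^-1 * (x - z ^+ i).
    by rewrite mulrBr mulVr ?divD ?expD_neq0 // /y exprVn.
  rewrite (nmM v) (nmV v) nmzi invr1 mul1r; apply/red_eqP; rewrite ?nmx ?nmzi //.
  by rewrite redX // redz.
have y0 : y != 0 by rewrite mulD_neq0.
have nmy : nm y = 1 by rewrite -(nm1 v); apply: (nm_lt_eq v); rewrite (nm1 v) (nmB_sym v).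
rewrite xE chiM ?expD_neq0 // (chi1 y1) mulr1 chiX //.
(* Nrd y is principal because z y is a second lift of zeta: by [red_nrd] Nrd(z y) and Nrd z have the
   same residue. *)
have zy1 : nm (z * y) <= 1 by rewrite nmM1 ?nmy.
have zy : red (z * y) = zeta.
  rewrite redM ?nmy // redz -[RHS]mulr1 -red1; congr (_ * _).
  by apply/red_eqP; rewrite ?nmy.
have [nzi nzE] := red_nrd z_int redz.
have [nzyi nzyE] := red_nrd zy1 zy.
have anz : absF (nrd z) = 1.
  have := nm_nrd z0; rewrite nmz => /esym/eqP.
  by rewrite pexpr_eq1 // ?(nm_ge0 vF) // => /eqP.
have ny1 : absF (nrd y - 1) < 1.
  have : nm ((nrd (z * y))%:A - (nrd z)%:A) < 1.
    by apply/red_eqP; rewrite ?nm_alg_le1 // nzE nzyE.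
  rewrite -scalerBl nm_alg_lt1 nrdM // -[X in _ - X]mulr1 -mulrBr (nmM vF) anz.
  by rewrite mul1r.
have : orbit_norm q zeta f ^+ i = 1.
  rewrite -nzE -redX ?nm_alg_le1 // -red1; apply/red_eqP; rewrite ?nmX1 ?nm_alg_le1 //.
  have -> : (nrd z)%:A ^+ i - 1 = (nrd z ^+ i - 1)%:A :> D.
    rewrite scalerBl scale1r; congr (_ - _).
    by rewrite exprZn expr1n.
  rewrite nm_alg_lt1 -nrdX //.
  have ni : absF (nrd (z ^+ i)) = 1 by rewrite nrdX // (nmX vF) anz expr1n.
  apply: (nm_trans vF (y := nrd x)) => //.
  rewrite xE nrdM ?expD_neq0 // -[X in X - _]mulr1 -mulrBr (nmM vF) ni mul1r.
  by rewrite (nmB_sym vF).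
move/(orbit_norm_order zeta0 q_gt1 frobqD zord (erefl : #|k| = q) emb_inj emb_fix f0 zf zdist).
by case/dvdnP => j ->; rewrite mulnC exprM chi_lift_order expr1n.
Qed.

(** As |Nrd P| = |w|, a power of P matches the absolute value of a; the remaining unit has a residue
    in the fixed field, that is a power of the norm of zeta, and a power of z realizes it. *)
Lemma nrd_dense a : a != 0 -> exists2 y, y != 0 & absF (nrd y - a) < absF a.
Proof.
move=> a0; have [_ [_ _ nP]] := unramified.
have nP0 := nrd_neq0 P0.
have aP : absF (nrd P) != 0 by rewrite gt_eqF ?(nm_gt0 vF).
have [P' P'0 nP'] : exists2 P', P' != 0 & absF (nrd P') = absF a.
  have [i [iE|iE]] := value_group vF w01 wmax a0; rewrite -nP in iE.
    rewrite iE; by exists (P ^+ i); rewrite ?expD_neq0 // nrdX // (nmX vF).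
  exists (P^-1 ^+ i); first by rewrite expD_neq0 ?invD_neq0.
  rewrite nrdX ?invD_neq0 // nrdV // (nmX vF) (nmV vF) exprVn.
  by apply: (mulIf (expf_neq0 i aP)); rewrite mulVf ?expf_neq0 // iE.
have P'n := nrd_neq0 P'0.
pose b := a / nrd P'.
have ab : absF b = 1 by rewrite /b (nmM vF) (nmV vF) nP' divff // gt_eqF ?(nm_gt0 vF).
have rb0 : red b%:A != 0.
  apply/eqP => /(red_eq0 _); rewrite nm_alg_le1 nm_alg_lt1 ab lexx ltxx.
  by move/(_ isT).
have rbF : frob q (red b%:A) = red b%:A.
  by apply/residue_fixedP; exists b; rewrite ?ab.
have [i iE] := orbit_norm_generator zeta0 q_gt1 frobqD zgen zord (erefl : #|k| = q)
  emb_inj emb_fix f0 zf zdist rb0 rbF.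
have [nzi nzE] := red_nrd z_int redz.
exists (z ^+ i * P'); first by rewrite mulD_neq0 ?expD_neq0.
rewrite nrdM ?expD_neq0 //.
have -> : nrd (z ^+ i) * nrd P' - a = (nrd (z ^+ i) - b) * nrd P'.
  by rewrite mulrBl divfK.
rewrite (nmM vF) nP' -[ltRHS]mul1r ltr_pM2r ?(nm_gt0 vF) //.
rewrite -nm_alg_lt1 scalerBl; apply/red_eqP; rewrite ?nm_alg_le1 ?ab //.
  by rewrite nrdX // (nmX vF) exprn_ile1 ?(nm_ge0 vF).
rewrite iE -nzE -redX ?nm_alg_le1 // nrdX //; congr red.
by rewrite exprZn expr1n.
Qed.

(** The character of F is a |-> chi (g a), with g a chosen by [nrd_dense]. Two choices differ by an
    element whose reduced norm is principal, which [chi_kernel] sends to 1. *)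
Lemma character_nrd_lift : exists rho : F -> K,
  [/\ forall a b, a != 0 -> b != 0 -> rho (a * b) = rho a * rho b,
      forall a, absF (a - 1) < 1 -> rho a = 1,
      forall a, a != 0 -> rho a != 0
    & forall x, x != 0 -> chi x = rho (nrd x)].
Proof.
have /choice[g gP] : forall a, exists y, a != 0 -> y != 0 /\ absF (nrd y - a) < absF a.
  move=> a; have [->|a0] := eqVneq a 0; first by exists 0; rewrite eqxx.
  by have [y y0 ya] := nrd_dense a0; exists y.
have main a x : a != 0 -> x != 0 -> absF (nrd x - a) < absF a -> chi (g a) = chi x.
  move=> a0 x0 xa; have [y0 ya] := gP a a0.
  have axE : absF (nrd x) = absF a by apply: (nm_lt_eq vF); rewrite (nmB_sym vF).
  have : chi (x^-1 * g a) = 1.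
    apply: chi_kernel; first by rewrite mulD_neq0 ?invD_neq0.
    rewrite nrdM ?invD_neq0 // nrdV // -(mulVf (nrd_neq0 x0)) -mulrBr (nmM vF) (nmV vF) axE.
    rewrite mulrC ltr_pdivrMr ?mul1r ?(nm_gt0 vF) //.
    by apply: (nm_trans vF ya); rewrite (nmB_sym vF).
  move=> c1; rewrite -[g a](mulVKr (divD x0)) chiM ?c1 ?mulr1 // mulD_neq0 ?invD_neq0 //.
exists (fun a => chi (g a)); split.
- move=> a b a0 b0; have [ya0 ya] := gP a a0; have [yb0 yb] := gP b b0.
  rewrite -chiM //; apply: main; rewrite ?mulf_neq0 ?mulD_neq0 // nrdM //.
  have -> : nrd (g a) * nrd (g b) - a * b = (nrd (g a) - a) * nrd (g b) + a * (nrd (g b) - b).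
    by rewrite mulrBl mulrBr addrA subrK.
  have bE : absF (nrd (g b)) = absF b by apply: (nm_lt_eq vF); rewrite (nmB_sym vF).
  apply: (nmD_lt vF); rewrite !(nmM vF) ?bE.
    by rewrite ltr_pM2r ?(nm_gt0 vF).
  by rewrite ltr_pM2l ?(nm_gt0 vF).
- move=> a a1; have aa : absF a = 1.
    by rewrite -(nm1 vF); apply: (nm_lt_eq vF); rewrite (nm1 vF) (nmB_sym vF).
  have a0 : a != 0 by apply: (nm_neq0 vF); rewrite aa oner_neq0.
  rewrite (main a 1) ?oner_neq0 // -?(expr0 z) ?nrdX ?expr0 //.
  by rewrite aa (nmB_sym vF).
- by move=> a a0; rewrite chi_neq0 //; case: (gP a a0).
- move=> x x0; rewrite (main (nrd x) x) ?nrd_neq0 // subrr (nm0 vF).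
  by rewrite (nm_gt0 vF) // nrd_neq0.
Qed.

End Lift.

Lemma character_nrd_lift_exists (K : fieldType) (chi : D -> K) :
  (forall x y, x != 0 -> y != 0 -> chi (x * y) = chi x * chi y) ->
  (forall x, nm (x - 1) < 1 -> chi x = 1) -> exists rho : F -> K,
  [/\ forall a b, a != 0 -> b != 0 -> rho (a * b) = rho a * rho b,
      forall a, absF (a - 1) < 1 -> rho a = 1,
      forall a, a != 0 -> rho a != 0
    & forall x, x != 0 -> chi x = rho (nrd x)].
Proof.
have [zeta zeta0 [zgen zord]] := finField_generator L.
have [f [f0 zf zdist]] : exists f, [/\ (0 < f)%N, zeta ^+ (q ^ f) = zeta &
    forall i j, (i < f)%N -> (j < f)%N -> zeta ^+ (q ^ i) = zeta ^+ (q ^ j) -> i = j].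
  exact: frob_orbit_exists.
have [w w01 wmax] := value_discrete vF F_nontriv.
have [|P P01 Pmax] := value_discrete v.
  have [a a0 a1] := F_nontriv; exists a%:A; last by rewrite nm_alg_lt1.
  by rewrite scaler_eq0 (negPf a0) oner_eq0.
have [z z1 rz] := red_surj zeta.
exact: (character_nrd_lift zeta0 zgen zord f0 zf zdist w01 wmax P01 Pmax z1 rz).
Qed.

End Characters.

Theorem smooth_character_factors_nrd (R : realType) (p d : nat) (F : fieldType)
    (absF : F -> R) (D : falgType F) (nm : D -> R) (nrd : D -> F)
    (K : fieldType) (chi : D -> K) (r : R) :
  valued absF -> valued nm -> (forall x, nm x = absF (algnorm x)) ->
  (exists B : R, forall x i, nm x <= 1 -> absF (coordrow x 0 i) <= B) ->
  prime p -> absF p%:R < 1 -> (exists2 a, a != 0 & absF a < 1) ->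
  (0 < d)%N -> \dim {:D} = (d ^ 2)%N -> 'Z({:D})%VS = 1%VS ->
  (forall x y, x != 0 -> y != 0 -> nrd (x * y) = nrd x * nrd y) ->
  (forall x m, x != 0 -> m \is monic -> irreducible_poly m -> horner_alg x m = 0 ->
     exists2 r, (r * (size m).-1 = d)%N & nrd x = (-1) ^+ d * (m ^+ r).[0]) ->
  p \in [pchar K] -> 0 < r ->
  (forall x y, x != 0 -> y != 0 -> chi (x * y) = chi x * chi y) ->
  (forall x, nm (x - 1) < r -> chi x = 1) ->
  exists rho : F -> K,
  [/\ forall a b, a != 0 -> b != 0 -> rho (a * b) = rho a * rho b,
      forall a, absF (a - 1) < 1 -> rho a = 1,
      forall a, a != 0 -> rho a != 0
    & forall x, x != 0 -> chi x = rho (nrd x)].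
Proof.
move=> vF v nmE cb p_pr ps nt d0 dimD cD nM nE pK r0 chiM chi1.
have [L [red [redD redM red1 red0 redS]]] := residue_field_exists v.
have [k [redF [redFD redFM redF1 redF0 redFS]]] := residue_field_exists vF.
have pD : nm p%:R < 1.
  rewrite -(scaler_nat p 1) nmE algnorm_alg (nmX vF).
  by rewrite exprn_ilt1 ?(nm_ge0 vF) // -lt0n adim_gt0.
have chi1' := character_principal_unit v p_pr pD pK r0 chiM chi1.
exact: (@character_nrd_lift_exists R p d F absF D nm nrd vF v nmE cb p_pr ps nt d0
  dimD cD nM nE L red redD redM red1 red0 redS k redF redFD redFM redF1 redF0 redFS).
Qed.

Local Open Scope classical_set_scope.
Local Open Scope ring_scope.

(** * Local fields *)

Section LocalField.
Variables (R : realType) (p : nat) (F : topologicalFieldType) (absF : F -> R).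
Hypothesis lf : nonarch_local_field p absF.

Let absF0 : absF 0 = 0. Proof. exact/(absF_eq0 lf). Qed.
Let absF_gt0 x : x != 0 -> 0 < absF x.
Proof.
by move=> x0; rewrite lt_def (absF_ge0 lf) andbT; apply: contraNneq x0 => /(absF_eq0 lf) ->.
Qed.

Let absF1 : absF 1 = 1.
Proof.
have n0 : absF 1 != 0 by rewrite gt_eqF // absF_gt0 ?oner_neq0.
by apply: (mulfI n0); rewrite -(absFM lf) !mulr1.
Qed.

Let absFX x n : absF (x ^+ n) = absF x ^+ n.
Proof. by elim: n => [|n IH]; rewrite ?absF1 // !exprS (absFM lf) IH. Qed.

Let absFV x : absF x^-1 = (absF x)^-1.
Proof.
have [->|x0] := eqVneq x 0; first by rewrite invr0 absF0 invr0.
have nx0 : absF x != 0 by rewrite gt_eqF // absF_gt0.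
by apply: (mulfI nx0); rewrite -(absFM lf) divff // absF1 divff.
Qed.

Let absFN x : absF (- x) = absF x.
Proof.
suff n1 : absF (- 1) = 1 by rewrite -mulN1r (absFM lf) n1 mul1r.
apply/eqP; rewrite -(@eqrXn2 _ 2%N) ?(absF_ge0 lf) // expr1n -absFX sqrrN expr1n.
by rewrite absF1.
Qed.

Lemma absF_small : exists2 w, w != 0 & absF w < 1.
Proof.
have [x x0 x1] := absF_nontrivial lf.
have [lt|gt|eq] := ltgtP (absF x) 1; first by exists x.
  by exists x^-1; rewrite ?invr_eq0 // absFV invf_lt1 // absF_gt0.
by rewrite eq eqxx in x1.
Qed.

Lemma absF_compact_ball : exists2 w, w != 0 & compact [set x | absF x <= absF w].
Proof.
have [U UN [cU clU]] := @locally_compactF _ _ _ _ lf 0 I.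
have /(absF_nbhs lf)[e e0 eU] : nbhs (0 : F) U.
  by apply: (@filterS _ (nbhs (0 : F)) _ [set x | setT x -> U x]) => // x; apply.
have [w w0 w1] := absF_small.
have [k kP] : exists k, absF w ^+ k < e by apply: expr_small; rewrite ?absF_gt0.
exists (w ^+ k); first by rewrite expf_neq0.
apply: subclosed_compact cU _; last first.
  by move=> x /= xw; apply: eU; rewrite /= subr0 (le_lt_trans xw) ?absFX.
have -> : [set x | absF x <= absF (w ^+ k)] = ~` [set x | absF (w ^+ k) < absF x].
  by apply/seteqP; split=> x /=; rewrite leNgt => /negP.
apply: open_closedC; rewrite openE => x /= xw.
apply/(absF_nbhs lf); exists (absF x) => [|y /= yx].
  exact: le_lt_trans (absF_ge0 lf _) xw.
rewrite ltNge; apply/negP => yw.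
have := absF_ultra lf (x - y) y; rewrite subrK leNgt => /negP; apply.
rewrite gt_max -absFN opprB yx; exact: le_lt_trans xw.
Qed.

Lemma valued_absF : valued absF.
Proof.
split; [exact: absF_ge0 lf|exact: absF_eq0 lf|exact: absFM lf|exact: absF_ultra lf| |].
  by move=> x x0; rewrite unitfE.
move=> e M e0; have [w w0 /compact_near_coveringP cw] := absF_compact_ball.
(* Multiplication by a^-1 brings the ball of radius M into the compact ball of radius |w|. *)
have [a a0 Ma] : exists2 a, a != 0 & M <= absF (a * w).
  have [t t0 t1] := absF_small.
  have [M0|M0] := leP M 0; first by exists 1; rewrite ?oner_neq0 // (le_trans M0) ?(absF_ge0 lf).
  have [|k kP] := @expr_small _ (absF t) (absF w / M) _ (divr_gt0 (absF_gt0 w0) M0).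
    by rewrite absF_gt0.
  exists (t ^- k); first by rewrite invr_eq0 expf_neq0.
  rewrite (absFM lf) absFV absFX mulrC ler_pdivlMr ?exprn_gt0 ?absF_gt0 //.
  by rewrite mulrC -ler_pdivlMr // ltW.
(* The filter of all sufficiently large finite lists: with it the near-covering form of compactness
   produces a finite subcover. *)
pose G : set_system (seq F) :=
  [set A | exists s0 : seq F, forall s : seq F, {subset s0 <= s} -> A s].
have GF : Filter G.
  split.
  - by exists [::].
  - move=> A B [s As] [t Bt]; exists (s ++ t) => u stu; split.
      by apply: As => x xs; apply: stu; rewrite mem_cat xs.
    by apply: Bt => x xs; apply: stu; rewrite mem_cat xs orbT.
  - by move=> A B AB [s As]; exists s => u /As /AB.
have := cw _ G (fun s x => exists2 y, y \in s & absF (x - y) < e / absF a) GF.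
case=> [x xw|s /(_ s (fun _ => id)) sP].
  exists ([set x' | absF (x' - x) < e / absF a], [set s : seq F | x \in s]) => /=.
    split; last by exists [:: x] => s; apply; rewrite inE.
    by apply/(absF_nbhs lf); exists (e / absF a) => //; rewrite divr_gt0 ?absF_gt0.
  by move=> [x' s] /= [x'x xs]; exists x.
exists [seq a * y | y <- s] => x xM.
have [|y ys xy] := sP (a^-1 * x).
  by rewrite /= (absFM lf) absFV mulrC ler_pdivrMr ?absF_gt0 // mulrC -(absFM lf) (le_trans xM).
exists (a * y); first exact: map_f.
have -> : x - a * y = a * (a^-1 * x - y) by rewrite mulrBr mulVKf.
by rewrite (absFM lf) mulrC -ltr_pdivlMr ?absF_gt0.
Qed.

(** The determinant is continuous and nonzero on the sphere max |x_i| = |w|, a part of the compact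
    polydisc, so it stays away from 0 there. *)
Lemma det_lower_bound n (M : 'I_n -> 'M[F]_n) :
  (forall x : 'I_n -> F, \det (\sum_i x i *: M i) = 0 -> forall i, x i = 0) ->
  exists w, exists2 c : R, 0 < c & w != 0 /\ forall x : 'I_n -> F,
    (forall i, absF (x i) <= absF w) -> (exists i, absF (x i) = absF w) ->
    c <= absF (\det (\sum_i x i *: M i)).
Proof.
move=> M0; have [w w0 cw] := absF_compact_ball.
pose T : topologicalType := prod_topology (fun _ : 'I_n => F).
pose f (x : T) := \det (\sum_i x i *: M i).
have cf : continuous f.
  have -> : f = fun x : T => \sum_(s : 'S_n) (-1) ^+ s * \prod_i \sum_k x k * M k i (s i).
    apply/funext => x; apply: eq_bigr => s _; congr (_ * _); apply: eq_bigr => i _.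
    by rewrite summxE; apply: eq_bigr => k _; rewrite mxE.
  apply: continuous_big => [|s _]; first exact: add_continuous.
  apply: (@continuousM2 F T (fun=> (-1) ^+ s)); first exact: cst_continuous.
  apply: continuous_big => [|i _]; first exact: mulr_continuous.
  apply: continuous_big => [|k _]; first exact: add_continuous.
  apply: (@continuousM2 F T (fun x => x k) (fun=> M k i (s i))).
    exact: (@proj_continuous _ (fun _ : 'I_n => F)).
  exact: cst_continuous.
have [t t0 t1] := absF_small.
(* The bound is sought among the powers of t. Near a point with some |x_i| >= |w|, |f| is constant
   and exceeds a power of t; near any other point all coordinates stay below |w| and the claim is
   void. Compactness makes the exponent uniform. *)
have := @tychonoff _ (fun _ : 'I_n => F) (fun _ => [set x | absF x <= absF w]) (fun _ => cw).
move/compact_near_coveringP/(_ nat \oo (fun k x => (exists i, absF w <= absF (x i)) ->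
  absF t ^+ k < absF (f x)) _).
case=> [x xw|k _ /(_ k (leqnn k)) kP].
  have [[i xi]|nx] := pselect (exists i, absF w <= absF (x i)).
    have fx : f x != 0.
      apply/eqP => /M0/(_ i) xi0; move: xi.
      by rewrite xi0 absF0 leNgt absF_gt0.
    have [k kP] : exists k, absF t ^+ k < absF (f x).
      by apply: expr_small; rewrite ?absF_gt0.
    exists ([set y | absF (f y - f x) < absF (f x)], [set l | (k <= l)%N]).
      split; last by exists k.
      apply: (cf x [set z | absF (z - f x) < absF (f x)]).
      by apply/(absF_nbhs lf); exists (absF (f x)) => //; rewrite absF_gt0.
    move=> [y l] /= [yx kl] _.
    have -> : absF (f y) = absF (f x).
      by apply: (nm_lt_eq valued_absF); rewrite (nmB_sym valued_absF).
    apply: le_lt_trans kP; rewrite ler_wiXn2l ?(absF_ge0 lf) //; exact: ltW.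
  exists ([set y | forall i, absF (y i - x i) < absF w], setT) => /=.
    split; last exact: filterT.
    apply: (@filter_forall T _ (fun i y => absF (y i - x i) < absF w) (nbhs (x : T))) => i.
    apply: (@proj_continuous _ (fun _ : 'I_n => F) i x [set z | absF (z - x i) < absF w]).
    by apply/(absF_nbhs lf); exists (absF w) => //; rewrite absF_gt0.
  move=> [y l] /= [yx _] [i wy]; case: nx; exists i.
  rewrite leNgt; apply/negP => xw'.
  have := nmD_lt valued_absF (yx i) xw'; rewrite subrK ltNge => /negP; apply.
  exact: wy.
exists w, (absF t ^+ k); first by rewrite exprn_gt0 ?absF_gt0.
split=> // x xw [i xi]; apply/ltW/(kP x) => //; exists i; rewrite xi.
exact: lexx.
Qed.

End LocalField.

(** * The norm of a division algebra over a local field *)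

Lemma expr_le_self (R : realDomainType) (a : R) k : (0 < k)%N -> 0 <= a <= 1 -> a ^+ k <= a.
Proof.
by case: k => // k _ /andP[a0 a1]; rewrite exprS ler_piMr // exprn_ile1.
Qed.

Lemma expr_ge_self (R : realDomainType) (a : R) k : (0 < k)%N -> 1 <= a -> a <= a ^+ k.
Proof.
case: k => // k _ a1; rewrite exprS ler_peMr ?exprn_ege1 //.
exact: le_trans ler01 a1.
Qed.

Section NormD.
Variables (R : realType) (p : nat) (F : topologicalFieldType) (absF : F -> R).
Hypothesis lf : nonarch_local_field p absF.
Variable D : falgType F.
Hypothesis divD : forall x : D, x != 0 -> x \is a GRing.unit.

Local Notation n := (\dim {:D}).
Local Notation e_ := (fun i : 'I_n => (vbasis {:D})`_i).
Let vF := valued_absF lf.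
Local Notation M_ := (fun i : 'I_n => regmx (e_ i)).
Local Notation c_ x i := (coordrow x ord0 i).

Let n_gt0 : (0 < n)%N. Proof. exact: adim_gt0. Qed.

Definition normD (x : D) : R := absF (algnorm x).

Lemma coordrow_sum (x : 'I_n -> F) i : c_ (\sum_i x i *: e_ i) i = x i.
Proof.
by rewrite mxE coord_sum_free // (basis_free (vbasisP _)).
Qed.

Lemma coordrowD (x y : D) i : c_ (x + y) i = c_ x i + c_ y i.
Proof. by rewrite !mxE linearD. Qed.

Lemma coordrowB (x y : D) i : c_ (x - y) i = c_ x i - c_ y i.
Proof. by rewrite !mxE linearB. Qed.

Lemma coordrowZ a (x : D) i : c_ (a *: x) i = a * c_ x i.
Proof. by rewrite !mxE linearZ. Qed.

Lemma algnormZ a x : algnorm (a *: x : D) = a ^+ n * algnorm x.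
Proof. by rewrite -[x in LHS]mul1r scalerAl algnormM algnorm_alg. Qed.

(** The norm is homogeneous of degree n, so scaling the largest coordinate to absolute value |w|
    reduces to the sphere. *)
Lemma normD_lower : exists2 c : R, 0 < c & forall x i, c * absF (c_ x i) ^+ n <= normD x.
Proof.
have [x|w [c c0 [w0 H]]] := @det_lower_bound _ _ _ _ lf n M_.
  move=> dx i; pose y := \sum_i x i *: e_ i.
  have : algnorm y = 0.
    rewrite algnormE -[RHS]dx; congr (\det _); apply: eq_bigr => k _.
    by rewrite coordrow_sum.
  by move/(algnorm_eq0 divD) => y0; rewrite -(coordrow_sum x) -/y y0 mxE linear0.
exists (c / absF w ^+ n) => [|x i]; first by rewrite divr_gt0 ?exprn_gt0 ?(nm_gt0 vF).
have [m mP] : exists m, forall k, absF (c_ x k) <= absF (c_ x m).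
  have [m _ mP] := @Order.TotalTheory.arg_maxP _ _ _ i xpredT (fun k => absF (c_ x k)) isT.
  by exists m => k; exact: mP.
have [xm0|xm0] := eqVneq (c_ x m) 0.
  have -> : absF (c_ x i) = 0.
    by apply/eqP; rewrite eq_le (absF_ge0 lf) andbT (le_trans (mP i)) // xm0 (nm0 vF).
  have n0 : (0 < n)%N by exact: adim_gt0.
  by rewrite expr0n gtn_eqF // mulr0 (absF_ge0 lf).
pose a := w / c_ x m.
have aw : absF a * absF (c_ x m) = absF w by rewrite -(absFM lf) divfK.
have := H (fun k => a * c_ x k) _ _; set dd := \det _.
have -> : absF dd = absF a ^+ n * normD x.
  rewrite -(nmX vF) -(absFM lf) -algnormZ algnormE; congr (absF (\det _)).
  by apply: eq_bigr => k _; rewrite coordrowZ.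
move=> cle; have {cle}: c <= absF a ^+ n * normD x.
  apply: cle; last by exists m; rewrite (absFM lf).
  by move=> k; rewrite (absFM lf) -aw ler_wpM2l ?(absF_ge0 lf).
have a0 : 0 < absF a by rewrite (nm_gt0 vF) // mulf_neq0 // invr_eq0.
rewrite mulrC -ler_pdivrMr ?exprn_gt0 // => cle; apply: le_trans cle.
rewrite -[_ / _ * _]mulrA ler_pM2l // -aw exprMn invfM -mulrA ler_piMr //.
  by rewrite invr_ge0 exprn_ge0 // ltW.
have xm1 : 0 < absF (c_ x m) by rewrite (nm_gt0 vF).
by rewrite mulrC ler_pdivrMr ?exprn_gt0 // mul1r lerXn2r ?nnegrE ?(absF_ge0 lf).
Qed.

Lemma normD_upper : exists2 c : R, 0 < c & forall x s, 0 <= s ->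
  (forall i, absF (c_ x i) <= s) -> normD x <= c * s ^+ n.
Proof.
pose C := 1 + \sum_(i : 'I_n) \sum_(k : 'I_n) \sum_(l : 'I_n) absF (M_ i k l).
have C1 : 1 <= C by rewrite lerDl !sumr_ge0 // => *; rewrite !sumr_ge0 // => *;
  rewrite sumr_ge0 // => *; exact: absF_ge0 lf _.
have CM i k l : absF (M_ i k l) <= C.
  have p1 (f : 'I_n -> R) (j : 'I_n) : (forall j, 0 <= f j) -> f j <= \sum_j f j.
    by move=> f0; rewrite (bigD1 j) //= lerDl sumr_ge0.
  apply: le_trans (_ : \sum_l absF (M_ i k l) <= _).
    by apply: (p1 (fun l => absF (M_ i k l))) => j; exact: absF_ge0 lf _.
  apply: le_trans (_ : \sum_k \sum_l absF (M_ i k l) <= _).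
    by apply: (p1 (fun k => \sum_l absF (M_ i k l))) => j; apply: sumr_ge0 => *; exact: absF_ge0 lf _.
  apply: le_trans (_ : \sum_i \sum_k \sum_l absF (M_ i k l) <= _); last by rewrite lerDr.
  apply: (p1 (fun i => \sum_k \sum_l absF (M_ i k l))) => j.
  by apply: sumr_ge0 => *; apply: sumr_ge0 => *; exact: absF_ge0 lf _.
have C0 : 0 < C by apply: lt_le_trans C1.
exists (C ^+ n); first by rewrite exprn_gt0.
move=> x s s0 xs; rewrite /normD algnormE /determinant.
apply: (nm_sum vF) => [|t _]; first by rewrite mulr_ge0 ?exprn_ge0 // ltW.
rewrite (absFM lf) (nmX vF) (nmN vF) (nm1 vF) expr1n mul1r.
rewrite (big_morph absF (absFM lf) (nm1 vF)).
rewrite -exprMn -[n in _ ^+ n]card_ord -prodr_const; apply: ler_prod => i _.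
rewrite (absF_ge0 lf) /= summxE; apply: (nm_sum vF) => [|k _].
  by rewrite mulr_ge0 // ltW.
rewrite mxE (absFM lf) mulrC; apply: ler_pM => //; exact: absF_ge0 lf _.
Qed.

Lemma normDM x y : normD (x * y) = normD x * normD y.
Proof. by rewrite /normD algnormM (absFM lf). Qed.

Lemma normD1 : normD 1 = 1.
Proof. by rewrite /normD /algnorm rmorph1 det1 (nm1 vF). Qed.

Lemma normDX x k : normD (x ^+ k) = normD x ^+ k.
Proof. by elim: k => [|k IH]; rewrite ?normD1 // !exprS normDM IH. Qed.

Lemma normD_alg a : normD a%:A = absF a ^+ n.
Proof. by rewrite /normD algnorm_alg (nmX vF). Qed.

(* As |x| <= 1 keeps the powers of x bounded, the powers of 1 + x are bounded by the
   binomial formula; this forces |1 + x| <= 1. *)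
Lemma normD_1D x : normD x <= 1 -> normD (x + 1) <= 1.
Proof.
move=> x1; have [c1 c10 low] := normD_lower; have [c2 c20 up] := normD_upper.
have bnd m : normD ((x + 1) ^+ m) <= c2 / c1.
  pose P (y : D) := forall i, absF (c_ y i) ^+ n <= c1^-1.
  have PD y z : P y -> P z -> P (y + z).
    move=> Py Pz i; rewrite coordrowD.
    have [le|lt] := leP (absF (c_ y i)) (absF (c_ z i)).
      by apply: le_trans (Pz i); rewrite lerXn2r ?nnegrE ?(absF_ge0 lf) // (nmD_le vF).
    apply: le_trans (Py i); rewrite lerXn2r ?nnegrE ?(absF_ge0 lf) // (nmD_le vF) //.
    exact: ltW.
  have P0 : P 0.
    by move=> i; rewrite mxE linear0 (nm0 vF) expr0n gtn_eqF ?adim_gt0 // invr_ge0 ltW.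
  have PX k : P (x ^+ k).
    move=> i; rewrite -[c1^-1]mul1r ler_pdivlMr // mulrC (le_trans (low _ _)) //.
    by rewrite normDX exprn_ile1 // (absF_ge0 lf).
  have PM : P ((x + 1) ^+ m).
    rewrite exprD1n; elim/big_ind: _ => // i _.
    by elim: 'C(m, i) => [|k IH]; rewrite ?mulr0n // mulrS; exact: PD.
  have [s s0 [sP [i si]]] : exists2 s, 0 <= s & (forall i, absF (c_ ((x + 1) ^+ m) i) <= s)
     /\ exists i, absF (c_ ((x + 1) ^+ m) i) = s.
    have i0 : 'I_n by exact: Ordinal (adim_gt0 _).
    have [k _ kP] := @Order.TotalTheory.arg_maxP _ _ _ i0 xpredT
       (fun k => absF (c_ ((x + 1) ^+ m) k)) isT.
    exists (absF (c_ ((x + 1) ^+ m) k)); first exact: absF_ge0 lf _.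
    by split=> [i|]; [exact: kP|exists k].
  apply: le_trans (up _ _ s0 sP) _; rewrite -si ler_wpM2l ?(ltW c20) //; exact: PM i.
rewrite leNgt; apply/negP => gt1.
have N0 : 0 < normD (x + 1) by apply: lt_trans gt1.
have [||k kP] := @expr_small _ (normD (x + 1))^-1 (c1 / c2).
- by rewrite invr_gt0 N0 invf_lt1.
- by rewrite divr_gt0.
have := bnd k; rewrite normDX leNgt => /negP; apply.
by move: kP; rewrite exprVn -[c1 / c2]invf_div ltf_pV2 ?posrE ?exprn_gt0 ?divr_gt0.
Qed.

Lemma normD_eq0 x : normD x = 0 <-> x = 0.
Proof. by rewrite -(algnorm_eq0 divD); exact: absF_eq0 lf _. Qed.

(** Dividing by the larger of the two elements reduces to [normD_1D]. *)
Lemma normD_ultra x y : normD (x + y) <= Num.max (normD x) (normD y).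
Proof.
wlog xy : x y / normD x <= normD y.
  move=> H; have [xy|/ltW xy] := leP (normD x) (normD y).
    by apply: le_trans (H _ _ xy) _; rewrite ge_max xy lexx.
  by rewrite addrC; apply: le_trans (H _ _ xy) _; rewrite ge_max xy lexx.
rewrite (max_idPr xy); have [y0|y0] := eqVneq y 0.
  by move: xy; rewrite y0 addr0.
have -> : x + y = (x / y + 1) * y by rewrite mulrDl mul1r mulrVK ?divD.
have Ny : 0 < normD y.
  by rewrite lt_def (absF_ge0 lf) andbT; apply: contraNneq y0 => /normD_eq0 ->.
rewrite normDM ler_piMl ?(absF_ge0 lf) // normD_1D //.
have : normD (x / y) * normD y <= 1 * normD y by rewrite -normDM mulrVK ?divD // mul1r.
by rewrite ler_pM2r.
Qed.

Lemma normD_small_coord (e : R) : 0 < e ->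
  exists2 d : R, 0 < d & forall x, (forall i, absF (c_ x i) < d) -> normD x < e.
Proof.
move=> e0; have [c2 c20 up] := normD_upper.
pose d := Num.min 1 (e / (2 * c2)).
have d0 : 0 < d by rewrite lt_min ltr01 divr_gt0 // mulr_gt0.
exists d => // x xd.
have H : normD x <= c2 * d ^+ n by apply: up => [|i]; [exact: ltW|exact/ltW/xd].
apply: le_lt_trans H _; apply: le_lt_trans (_ : c2 * d < e).
  by rewrite ler_wpM2l ?(ltW c20) // expr_le_self // (ltW d0) ge_min lexx.
rewrite mulrC -ltr_pdivlMr // gt_min; apply/orP; right.
by rewrite ltr_pM2l // ltf_pV2 ?posrE ?mulr_gt0 // ltr_pMl // ltr1n.
Qed.

Lemma coord_small_normD (e : R) : 0 < e ->
  exists2 d : R, 0 < d & forall x, normD x < d -> forall i, absF (c_ x i) < e.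
Proof.
move=> e0; have [c1 c10 low] := normD_lower; exists (c1 * e ^+ n).
  by rewrite mulr_gt0 ?exprn_gt0.
move=> x xe i; have := le_lt_trans (low x i) xe; rewrite ltr_pM2l //.
by rewrite ltr_pXn2r ?nnegrE ?(absF_ge0 lf) ?(ltW e0).
Qed.

Lemma valued_normD : valued normD.
Proof.
split; [by move=> x; exact: absF_ge0 lf _|exact: normD_eq0|exact: normDM
       |exact: normD_ultra|exact: divD|].
move=> e M e0; have [d d0 dP] := normD_small_coord e0.
have [c1 c10 low] := normD_lower.
pose B := Num.max 1 (M / c1).
have [s sP] := nm_cover vF B d0.
exists [seq \sum_(i : 'I_n) nth 0 s (g i : 'I_(size s)) *: e_ i | g : {ffun 'I_n -> 'I_(size s)}].
move=> x xM.
have xB i : absF (c_ x i) <= B.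
  rewrite leNgt; apply/negP; rewrite gt_max => /andP[x1].
  rewrite ltr_pdivrMr // mulrC ltNge => /negP; apply; apply: le_trans xM.
  apply: le_trans (low x i); rewrite ler_wpM2l ?(ltW c10) //.
  by rewrite expr_ge_self // ltW.
have /choice[g gP] : forall i, exists g : 'I_(size s), absF (c_ x i - nth 0 s g) < d.
  move=> i; have [y ys xy] := sP _ (xB i).
  have iy : (index y s < size s)%N by rewrite index_mem.
  by exists (Ordinal iy); rewrite /= nth_index.
exists (\sum_(i : 'I_n) nth 0 s (g i) *: e_ i).
  apply/mapP; exists [ffun i => g i]; first by rewrite mem_enum.
  by apply: eq_bigr => i _; rewrite ffunE.
apply: dP => i; rewrite coordrowB.
by rewrite (coordrow_sum (fun i => nth 0 s (g i))).
Qed.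

(** By the lower and upper bounds, N is small exactly when all coordinates are. *)
Lemma nbhs_algtop (x : algtop D) (A : set (algtop D)) :
  nbhs x A <-> exists2 e : R, 0 < e & [set y | normD (y - x) < e] `<=` A.
Proof.
split; last first.
  case=> e e0 eA; apply: (filterS eA); have [d d0 dP] := normD_small_coord e0.
  have : \forall y \near x, forall i, absF (c_ (y : D) i - c_ (x : D) i) < d.
    apply: (@filter_forall (algtop D) _ (fun i y => absF (c_ (y : D) i - c_ (x : D) i) < d) (nbhs x)).
    move=> i; have : nbhs x ((fun y : algtop D => coord (vbasis {:D}) i (y : D)) @^-1`
         [set z | absF (z - coord (vbasis {:D}) i (x : D)) < d]).
      by apply: coord_continuous; apply/(absF_nbhs lf); exists d.
    by apply: filterS => y /=; rewrite !mxE.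
  by apply: filterS => y yx; apply: dP => i; rewrite coordrowB.
pose r (x : algtop D) : 'rV[F]_n := \row_i coord (vbasis {:D}) i (x : D).
case=> B [[U oU <-] Ux] UA.
have : nbhs (r x) U by exact: open_nbhs_nbhs.
case=> P xP PU.
have /choice[e eP] : forall i, exists e : R, 0 < e /\ [set z | absF (z - r x ord0 i) < e] `<=` P ord0 i.
  by move=> i; have /(absF_nbhs lf)[e e0 eP] := xP ord0 i; exists e.
have [e' e'0 e'P] : exists2 e' : R, 0 < e' & forall i, e' <= e i.
  exists (\big[Num.min/1]_i e i); first by elim/big_ind: _ => // [a b a0 b0|i _];
    [rewrite lt_min a0|case: (eP i)].
  by move=> i; rewrite (bigD1 i) //= ge_min lexx.
have [d d0 dP] := coord_small_normD e'0.
exists d => // y /= /dP yx; apply: UA; apply: PU => i j; rewrite ord1.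
case: (eP j) => _; apply; rewrite /= !mxE -linearB.
by apply: lt_le_trans (e'P j); have := yx j; rewrite mxE.
Qed.

End NormD.

(** * Elements of GL(2, D) *)

Section GL2Elements.
Variables (F : topologicalFieldType) (D : falgType F).
Local Notation T := (algtop D).
Local Notation G := (GL2 D).
Hypothesis divD : forall x : T, x != 0 -> x \is a GRing.unit.

Definition ea (g : G) : T := (uval g : 'M_2) ord0 ord0.
Definition eb (g : G) : T := (uval g : 'M_2) ord0 ord_max.
Definition ec (g : G) : T := (uval g : 'M_2) ord_max ord0.
Definition ed (g : G) : T := (uval g : 'M_2) ord_max ord_max.

Lemma uval_eta g : uval g = mx22 (ea g) (eb g) (ec g) (ed g).
Proof. exact: (@mx22_eta T). Qed.

Lemma G_eq (g h : G) : ea g = ea h -> eb g = eb h -> ec g = ec h -> ed g = ed h -> g = h.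
Proof. by move=> ae be ce de; apply: units_inj; rewrite !uval_eta ae be ce de. Qed.

Lemma uvalMG (g h : G) : uval (g * h)%g = mx22 (ea g) (eb g) (ec g) (ed g)
   *m mx22 (ea h) (eb h) (ec h) (ed h) :> 'M[T]_2.
Proof. by rewrite -!uval_eta. Qed.

Lemma eaM g h : ea (g * h)%g = ea g * ea h + eb g * ec h.
Proof. by rewrite /ea uvalMG mx22M mxE. Qed.
Lemma ebM g h : eb (g * h)%g = ea g * eb h + eb g * ed h.
Proof. by rewrite /eb uvalMG mx22M mxE. Qed.
Lemma ecM g h : ec (g * h)%g = ec g * ea h + ed g * ec h.
Proof. by rewrite /ec uvalMG mx22M mxE. Qed.
Lemma edM g h : ed (g * h)%g = ec g * eb h + ed g * ed h.
Proof. by rewrite /ed uvalMG mx22M mxE. Qed.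
Definition eM := (eaM, ebM, ecM, edM).

Lemma uval1 : uval (1%g : G) = mx22 1 0 0 1 :> 'M[T]_2.
Proof. exact: (@mx22_1 T). Qed.
Lemma ea1 : ea 1%g = 1. Proof. by rewrite /ea uval1 mxE. Qed.
Lemma eb1 : eb 1%g = 0. Proof. by rewrite /eb uval1 mxE. Qed.
Lemma ec1 : ec 1%g = 0. Proof. by rewrite /ec uval1 mxE. Qed.
Lemma ed1 : ed 1%g = 1. Proof. by rewrite /ed uval1 mxE. Qed.
Definition e1 := (ea1, eb1, ec1, ed1).

(* Junk value 1 when Y is not inverse to X. *)
Definition mkG (X Y : 'M[T]_2) : G :=
  if pselect (X *m Y = 1%:M /\ Y *m X = 1%:M) is left XY
  then @mk_unit (mat2 T) X Y XY.1 XY.2 else 1%g.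

Lemma mkGE X Y : X *m Y = 1%:M -> Y *m X = 1%:M -> uval (mkG X Y) = X.
Proof. by move=> XY YX; rewrite /mkG; case: pselect => [//|[]]. Qed.

Definition nU (x : T) : G := mkG (mx22 1 x 0 1) (mx22 1 (- x) 0 1).
Definition nL (x : T) : G := mkG (mx22 1 0 x 1) (mx22 1 0 (- x) 1).
Definition tG (a b : T) : G := mkG (mx22 a 0 0 b) (mx22 a^-1 0 0 b^-1).
Definition wG : G := mkG (mx22 0 (-1) 1 0) (mx22 0 1 (-1) 0).

Arguments nU x%_ring_scope.
Arguments nL x%_ring_scope.
Arguments tG (a b)%_ring_scope.

Lemma nUE x : uval (nU x) = mx22 1 x 0 1 :> 'M[T]_2.
Proof. by apply: mkGE; rewrite mx22M scalar_mx22 !simpr01 ?addNr ?subrr. Qed.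
Lemma nLE x : uval (nL x) = mx22 1 0 x 1 :> 'M[T]_2.
Proof. by apply: mkGE; rewrite mx22M scalar_mx22 !simpr01 ?addNr ?subrr. Qed.
Lemma tGE a b : a != 0 -> b != 0 -> uval (tG a b) = mx22 a 0 0 b :> 'M[T]_2.
Proof.
by move=> a0 b0; apply: mkGE; rewrite mx22M scalar_mx22 !simpr01 ?mulVr ?divrr ?divD.
Qed.
Lemma wGE : uval wG = mx22 0 (-1) 1 0 :> 'M[T]_2.
Proof. by apply: mkGE; rewrite mx22M scalar_mx22 !simpr01 ?mulN1r ?mulrN1 ?opprK. Qed.

Lemma e_nU x : ((ea (nU x) = 1) * (eb (nU x) = x) * (ec (nU x) = 0) * (ed (nU x) = 1))%type.
Proof. by rewrite /ea /eb /ec /ed nUE !mxE. Qed.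
Lemma e_nL x : ((ea (nL x) = 1) * (eb (nL x) = 0) * (ec (nL x) = x) * (ed (nL x) = 1))%type.
Proof. by rewrite /ea /eb /ec /ed nLE !mxE. Qed.
Lemma e_tG a b : a != 0 -> b != 0 ->
  ((ea (tG a b) = a) * (eb (tG a b) = 0) * (ec (tG a b) = 0) * (ed (tG a b) = b))%type.
Proof. by move=> a0 b0; rewrite /ea /eb /ec /ed tGE // !mxE. Qed.
Lemma e_wG : ((ea wG = 0) * (eb wG = -1) * (ec wG = 1) * (ed wG = 0))%type.
Proof. by rewrite /ea /eb /ec /ed wGE !mxE. Qed.

Lemma nUD x y : nU (x + y) = (nU x * nU y)%g.
Proof. by apply: G_eq; rewrite !eM !e_nU !simpr01 // addrC. Qed.
Lemma nU0 : nU 0 = 1%g.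
Proof. by apply: G_eq; rewrite !e_nU !e1. Qed.
Lemma nUN x : nU (- x) = ((nU x)^-1)%g.
Proof. by apply: (@mulgI _ (nU x)); rewrite -nUD subrr nU0 mulgV. Qed.

Lemma mulT_neq0 (x y : T) : x != 0 -> y != 0 -> x * y != 0.
Proof.
move=> x0 y0; apply: contra_neq y0 => xy.
by rewrite -[y](mulKr (divD x0)) xy mulr0.
Qed.
Lemma invT_neq0 (x : T) : x != 0 -> x^-1 != 0.
Proof. by apply: contra_neq => x0; rewrite -[x]invrK x0 invr0. Qed.

Lemma tGM a b c d : a != 0 -> b != 0 -> c != 0 -> d != 0 ->
  tG (a * c) (b * d) = (tG a b * tG c d)%g.
Proof.
by move=> *; apply: G_eq; rewrite !eM !e_tG ?mulT_neq0 // !simpr01.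
Qed.
Lemma tG1 : tG 1 1 = 1%g.
Proof. by apply: G_eq; rewrite ?e_tG ?e1 ?oner_neq0. Qed.

Lemma tG_nU a b x : a != 0 -> b != 0 -> (tG a b * nU x = nU (a * x * b^-1) * tG a b)%g.
Proof.
move=> a0 b0; apply: G_eq; rewrite !eM !e_tG // !e_nU !simpr01 //.
by rewrite mulrVK ?divD.
Qed.
Lemma nU_tG a b x : a != 0 -> b != 0 -> (nU x * tG a b = tG a b * nU (a^-1 * x * b))%g.
Proof.
move=> a0 b0; apply: G_eq; rewrite !eM !e_tG // !e_nU !simpr01 //.
by rewrite !mulrA divrr ?divD // mul1r.
Qed.
Lemma wG_tG a b : a != 0 -> b != 0 -> (wG * tG a b = tG b a * wG)%g.
Proof.
by move=> a0 b0; apply: G_eq; rewrite !eM !e_tG // !e_wG !simpr01 // mulN1r mulrN1.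
Qed.

Lemma borelE g : borel D g <-> ec g = 0.
Proof. by []. Qed.

Lemma borel_diag g : borel D g -> ea g != 0 /\ ed g != 0.
Proof.
move=> /borelE gB; have gV : (g * g^-1)%g = 1%g by rewrite mulgV.
have ed0 : ed g != 0.
  apply/eqP => d0; have := edM g g^-1; rewrite gV ed1 gB d0 !mul0r addr0.
  by move/eqP; rewrite oner_eq0.
split=> //; apply/eqP => a0; have := eaM g^-1 g; rewrite mulVg ea1 gB a0 !mulr0 addr0.
by move/eqP; rewrite oner_eq0.
Qed.

Lemma borel_factor g : borel D g -> g = (tG (ea g) (ed g) * nU ((ea g)^-1 * eb g))%g.
Proof.
move=> gB; have [a0 d0] := borel_diag gB; have /borelE gc := gB.
apply: G_eq; rewrite !eM !e_tG // !e_nU !simpr01 //.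
by rewrite mulVKr ?divD.
Qed.

Lemma borelM g h : borel D g -> borel D h -> borel D (g * h)%g.
Proof. by move=> /borelE gB /borelE hB; apply/borelE; rewrite ecM gB hB mul0r mulr0 addr0. Qed.
Lemma borel1 : borel D 1%g. Proof. exact/borelE/ec1. Qed.
Lemma borel_nU x : borel D (nU x). Proof. by apply/borelE; rewrite e_nU. Qed.
Lemma borel_tG a b : a != 0 -> b != 0 -> borel D (tG a b).
Proof. by move=> a0 b0; apply/borelE; rewrite e_tG. Qed.
Lemma borelV g : borel D g -> borel D g^-1%g.
Proof.
move=> gB; have [a0 d0] := borel_diag gB; rewrite (borel_factor gB) invgM -nUN.
have -> : ((tG (ea g) (ed g))^-1)%g = tG (ea g)^-1 (ed g)^-1.
  apply: (@mulgI _ (tG (ea g) (ed g))); rewrite mulgV -tGM ?invT_neq0 //.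
  by rewrite !divrr ?divD // tG1.
by apply: borelM; [exact: borel_nU|apply: borel_tG; exact: invT_neq0].
Qed.

Lemma tGV a b : a != 0 -> b != 0 -> ((tG a b)^-1)%g = tG a^-1 b^-1.
Proof.
move=> a0 b0; apply: (@mulgI _ (tG a b)); rewrite mulgV -tGM ?invT_neq0 //.
by rewrite !divrr ?divD // tG1.
Qed.

Lemma e_inv_borel g : borel D g ->
  ((ea g^-1%g = (ea g)^-1) * (eb g^-1%g = - ((ea g)^-1 * eb g * (ed g)^-1)) * (ed g^-1%g = (ed g)^-1))%type.
Proof.
move=> gB; have [a0 d0] := borel_diag gB.
rewrite [in (g^-1)%g](borel_factor gB) invgM -nUN tGV // !eM !e_nU !e_tG ?invT_neq0 //.
by rewrite !simpr01 mulNr.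
Qed.

(* Bruhat decomposition: off the Borel subgroup g = bruhat g * w * n(c^-1 d). *)
Definition coordG (g : G) : T := (ec g)^-1 * ed g.
Definition bruhat (g : G) : G := (g * (wG * nU (coordG g))^-1)%g.

Lemma bruhatE g : g = (bruhat g * (wG * nU (coordG g)))%g.
Proof. by rewrite /bruhat mulgVK. Qed.

Lemma e_wnU x : ((ea (wG * nU x)%g = 0) * (eb (wG * nU x)%g = -1) *
   (ec (wG * nU x)%g = 1) * (ed (wG * nU x)%g = x))%type.
Proof. by rewrite !eM !e_wG !e_nU !simpr01. Qed.

Lemma borel_bruhat g : ec g != 0 -> borel D (bruhat g).
Proof.
move=> c0; apply/borelE; have := bruhatE g => gE.
have := ecM (bruhat g) (wG * nU (coordG g))%g; rewrite -gE !e_wnU !simpr01 => cE.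
have := edM (bruhat g) (wG * nU (coordG g))%g; rewrite -gE !e_wnU mulrN1 -cE.
rewrite /coordG mulVKr ?divD // => /eqP; rewrite -subr_eq0 opprD opprK addrCA subrr addr0.
by move/eqP.
Qed.

Lemma coordG_wnU x : coordG (wG * nU x)%g = x.
Proof. by rewrite /coordG !e_wnU invr1 mul1r. Qed.

(** As y tends to 0 the left side tends to 1 while the coordinate y^-1 in the big cell goes to
    infinity: this ties f(1) to f on the big cell. *)
Lemma nL_bruhat y : y != 0 -> nL y = (tG y^-1 y * nU y * (wG * nU y^-1))%g.
Proof.
move=> y0; apply: G_eq; rewrite !eM !e_tG ?invT_neq0 // !e_nU !e_wG e_nL !simpr01 //.
- by rewrite mulVr ?divD.
- by rewrite mulrN1 mulVr ?divD // mul1r addNr.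
- by rewrite divrr ?divD.
Qed.

End GL2Elements.
Arguments nU {F D} x%_ring_scope.
Arguments nL {F D} x%_ring_scope.
Arguments tG {F D} (a b)%_ring_scope.
Arguments wG {F D}.

(** * Congruence subgroups *)

Section TopologicalGroups.
Variable G : topologicalGroupType.

Lemma group_closed1 (U : set G) : group_closed (mem U) -> U 1%g.
Proof. by case=> /set_mem. Qed.
Lemma group_closedMV (U : set G) g h : group_closed (mem U) -> U g -> U h -> U (g * h^-1)%g.
Proof. by case=> _ H gU hU; apply/set_mem/H; exact: mem_set. Qed.
Lemma group_closed_inv (U : set G) g : group_closed (mem U) -> U g -> U (g^-1)%g.
Proof.
move=> UG gU; rewrite -[(g^-1)%g]mul1g; apply: group_closedMV => //.
exact: group_closed1.
Qed.
Lemma group_closed_mul (U : set G) g h : group_closed (mem U) -> U g -> U h -> U (g * h)%g.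
Proof.
move=> UG gU hU; rewrite -[h]invgK; apply: group_closedMV => //.
exact: group_closed_inv.
Qed.
Lemma group_closedI (U : set G) : U 1%g -> (forall g h, U g -> U h -> U (g * h^-1)%g) ->
  group_closed (mem U).
Proof. by move=> U1 UM; split=> [|g h /set_mem gU /set_mem hU]; apply: mem_set; [|exact: UM]. Qed.

Lemma open_subgroup_nbhs1 (U : set G) : group_closed (mem U) -> nbhs 1%g U -> open U.
Proof.
move=> UG U1; rewrite openE => g gU.
have cg : {for g, continuous (fun h : G => (g^-1 * h)%g)}.
  apply: (@continuous_comp _ _ _ (fun h => (g^-1, h)%g) (fun z : G * G => (z.1 * z.2)%g)).
    by apply: (@cvg_pair _ _ _ _ (nbhs _) (nbhs _)); [exact: cvg_cst|exact: cvg_id].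
  exact: mulg_continuous.
have : nbhs g [set h | U (g^-1 * h)%g] by apply: cg; rewrite mulVg.
apply: filterS => h gh; rewrite -[h](mulVKg g).
exact: group_closed_mul.
Qed.

Lemma open_subgroupTP (U : set G) : open_subgroup setT U <-> group_closed (mem U) /\ nbhs 1%g U.
Proof.
split=> [[UG [O oO UO]]|[UG U1]]; split=> //.
  move: UO; rewrite setIT => UO; rewrite UO; apply: open_nbhs_nbhs; split=> //.
  by rewrite -UO; exact: group_closed1.
by exists U; [exact: open_subgroup_nbhs1|rewrite setIT].
Qed.

End TopologicalGroups.

Section Congruence.
Variables (R : realType) (p : nat) (F : topologicalFieldType) (absF : F -> R).
Hypothesis lf : nonarch_local_field p absF.
Variable D : falgType F.
Local Notation T := (algtop D).
Local Notation G := (GL2 D).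
Hypothesis divD : forall x : T, x != 0 -> x \is a GRing.unit.

Definition nT (x : T) : R := normD absF (x : D).
Local Notation N := nT.

Lemma valued_nT : @valued R T nT.
Proof. exact: (valued_normD lf divD). Qed.
Let v := valued_nT.

Lemma nbhs_nT (x : T) (A : set T) :
  nbhs x A <-> exists2 e : R, 0 < e & [set y | N (y - x) < e] `<=` A.
Proof. exact: (nbhs_algtop lf divD). Qed.

Lemma entry_continuous i j : continuous (fun g : G => (uval g : 'M[T]_2) i j).
Proof.
move=> g; apply: (@continuous_comp _ _ _ (@uval (mat2 T)) (fun m : mat2 T => m i j)).
  exact: uval_continuous.
exact: (@continuous_mxcoord T 2 2 i j).
Qed.

Lemma entry_ball i j (g : G) (r : R) : 0 < r ->
  nbhs g [set h : G | N ((uval h : 'M[T]_2) i j - (uval g : 'M[T]_2) i j) < r].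
Proof.
move=> r0; have : nbhs ((uval g : 'M[T]_2) i j) [set y | N (y - (uval g : 'M[T]_2) i j) < r].
  by apply/nbhs_nT; exists r.
by move/(@entry_continuous i j g).
Qed.

Definition near1 (r : R) : set G :=
  [set g | [/\ N (ea g - 1) < r, N (eb g) < r, N (ec g) < r & N (ed g - 1) < r]].

(** The topology of units controls an element together with its inverse; imposing both conditions
    makes this a group without estimating inverse matrices. *)
Definition Kr (r : R) : set G := [set g | near1 r g /\ near1 r (g^-1)%g].

Lemma nbhs1_near1 r : 0 < r -> nbhs (1%g : G) (near1 r).
Proof.
move=> r0; have H i j := @entry_ball i j 1%g r r0.
apply: filterS (filterI (filterI (H ord0 ord0) (H ord0 ord_max))
  (filterI (H ord_max ord0) (H ord_max ord_max))) => g [[/= ha hb] [/= hc hd]].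
split.
- by move: ha; rewrite -/(ea g) -/(ea 1%g) ea1.
- by move: hb; rewrite -/(eb g) -/(eb 1%g) eb1 subr0.
- by move: hc; rewrite -/(ec g) -/(ec 1%g) ec1 subr0.
- by move: hd; rewrite -/(ed g) -/(ed 1%g) ed1.
Qed.

Lemma nbhs1_Kr r : 0 < r -> nbhs (1%g : G) (Kr r).
Proof.
move=> r0; apply: filterI; first exact: nbhs1_near1.
have := @invg_continuous G 1%g (near1 r); rewrite invg1 => H.
apply: H; exact: nbhs1_near1.
Qed.

Lemma nbhs_mat2 (X : mat2 T) (A : set (mat2 T)) : nbhs X A ->
  exists2 r : R, 0 < r & forall Y : mat2 T, (forall i j, N ((Y : 'M_2) i j - (X : 'M_2) i j) < r) -> A Y.
Proof.
case=> P XP PA.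
have /choice[e eP] : forall ij : 'I_2 * 'I_2, exists e : R, 0 < e /\
    [set y | N (y - (X : 'M_2) ij.1 ij.2) < e] `<=` P ij.1 ij.2.
  by move=> [i j]; have /nbhs_nT[e e0 eP] := XP i j; exists e.
exists (\big[Num.min/1]_ij e ij).
  by elim/big_ind: _ => // [a b a0 b0|ij _]; [rewrite lt_min a0|case: (eP ij)].
move=> Y YX; apply: PA => i j; case: (eP (i, j)) => _; apply => /=.
by apply: lt_le_trans (YX i j) _; rewrite (bigD1 (i, j)) //= ge_min lexx.
Qed.

Lemma Kr_subset (A : set G) : nbhs (1%g : G) A -> exists r : R, [/\ 0 < r, r <= 1 & Kr r `<=` A].
Proof.
case=> B [[U oU <-] U1] UA.
have : nbhs ((uval (1%g : G), uinv (1%g : G)) : mat2 T * mat2 T) U by exact: open_nbhs_nbhs.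
case=> -[P Q] /= [P1 Q1] PQ.
have [r1 r10 r1P] := nbhs_mat2 P1; have [r2 r20 r2Q] := nbhs_mat2 Q1.
exists (Num.min 1 (Num.min r1 r2)); split.
- by rewrite !lt_min ltr01 r10.
- by rewrite ge_min lexx.
have u1 : uinv (1%g : G) = 1 by [].
have aux (Y : 'M[T]_2) (g : G) r : uval g = Y -> near1 r g -> forall i j, N (Y i j - (1 : 'M[T]_2) i j) < r.
  move=> <- [ha hb hc hd] i j; rewrite [1](@mx22_1 T) mxE.
  by move: i j; apply: forall_I2; apply: forall_I2; rewrite ?eqxx //= subr0.
move=> g [g1 g2]; apply: UA; apply: PQ; split=> /=.
  apply: r1P => i j; apply: lt_le_trans (aux _ g _ erefl g1 i j) _.
  by rewrite !ge_min lexx orbT.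
apply: r2Q => i j; apply: lt_le_trans (aux _ (g^-1)%g _ erefl g2 i j) _.
by rewrite !ge_min lexx !orbT.
Qed.

Lemma near1M r g h : 0 < r <= 1 -> near1 r g -> near1 r h -> near1 r (g * h)%g.
Proof.
move=> /andP[r0 r1] [ga gb gc gd] [ha hb hc hd].
have le1 x : N (x - 1) < r -> N x <= 1.
  move=> x1; rewrite -[x](subrK 1); apply: (nmD_le v); rewrite ?(nm1 v) //.
  by apply: le_trans (ltW x1) r1.
have small x y : N x < r -> N y <= 1 -> N (x * y) < r.
  move=> xr y1; rewrite (nmM v); apply: le_lt_trans xr; rewrite ler_piMr //; exact: nm_ge0 v _.
have small' x y : N x <= 1 -> N y < r -> N (x * y) < r.
  move=> x1 yr; rewrite (nmM v); apply: le_lt_trans yr; rewrite ler_piMl //; exact: nm_ge0 v _.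
have le x : N x < r -> N x <= 1 by move=> xr; apply: le_trans (ltW xr) r1.
have mul1 x y : N (x - 1) < r -> N (y - 1) < r -> N (x * y - 1) < r.
  move=> xr yr; have -> : x * y - 1 = (x - 1) * y + (y - 1) by rewrite mulrBl mul1r addrA subrK.
  by apply: (nmD_lt v) => //; apply: small => //; exact: le1.
split; rewrite !eM.
- rewrite addrAC; apply: (nmD_lt v); first exact: mul1.
  by apply: small => //; exact: le.
- by apply: (nmD_lt v); [apply: small' => //; exact: le1|apply: small => //; exact: le1].
- by apply: (nmD_lt v); [apply: small => //; exact: le1|apply: small' => //; exact: le1].
rewrite -addrA; apply: (nmD_lt v); last exact: mul1.
by apply: small => //; exact: le.
Qed.

Lemma near1_1 r : 0 < r -> near1 r 1%g.
Proof. by move=> r0; split; rewrite ?e1 ?subrr (nm0 v). Qed.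

Lemma Kr_group r : 0 < r <= 1 -> group_closed (mem (Kr r)).
Proof.
move=> r01; have /andP[r0 _] := r01; apply: group_closedI.
  by split; rewrite ?invg1; exact: near1_1.
move=> g h [g1 g2] [h1 h2]; split; first exact: near1M.
by rewrite invgM invgK; exact: near1M.
Qed.

Lemma Kr_inv r g : Kr r g -> Kr r (g^-1)%g.
Proof. by case=> g1 g2; split=> //; rewrite invgK. Qed.

Lemma Kr_open r : 0 < r <= 1 -> open_subgroup setT (Kr r).
Proof.
move=> r01; apply/open_subgroupTP; split; first exact: Kr_group.
by apply: nbhs1_Kr; case/andP: r01.
Qed.

Lemma Kr_nL r y : 0 < r -> N y < r -> Kr r (nL y).
Proof.
move=> r0 yr; have nLV : ((nL y)^-1)%g = nL (- y).
  apply: (@mulgI _ (nL y)); rewrite mulgV; apply: G_eq; rewrite !eM !e_nL !e1 !simpr01 //.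
  by rewrite subrr.
by split; rewrite ?nLV; split; rewrite ?e_nL ?subrr ?(nmN v) ?(nm0 v).
Qed.

Lemma Kr_nU r y : 0 < r -> N y < r -> Kr r (nU y).
Proof.
move=> r0 yr; split; rewrite -?nUN; split;
  by rewrite ?e_nU ?subrr ?(nmN v) ?(nm0 v).
Qed.

Definition Ubor (r s : R) : set G :=
  [set g | borel D g /\ [/\ N (ea g - 1) < r, N (ed g - 1) < r & N (eb g) < s]].

Lemma nT_near1 x r : r <= 1 -> N (x - 1) < r -> N x = 1.
Proof.
move=> r1 x1; rewrite -(nm1 v); apply: (nm_lt_eq v).
by rewrite (nmB_sym v) (nm1 v); apply: lt_le_trans r1.
Qed.

Lemma nT_inv_near1 x r : r <= 1 -> N (x - 1) < r -> N (x^-1 - 1) < r.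
Proof.
move=> r1 x1; have nx := nT_near1 r1 x1.
have x0 : x != 0 by apply: (nm_neq0 v); rewrite nx oner_neq0.
have -> : x^-1 - 1 = x^-1 * (1 - x) by rewrite mulrBr mulr1 mulVr ?divD.
by rewrite (nmM v) (nmV v) nx invr1 mul1r (nmB_sym v).
Qed.

Lemma nT_mul_near1 x y r : r <= 1 -> N (x - 1) < r -> N (y - 1) < r -> N (x * y - 1) < r.
Proof.
move=> r1 xr yr; have -> : x * y - 1 = (x - 1) * y + (y - 1) by rewrite mulrBl mul1r addrA subrK.
by apply: (nmD_lt v) => //; rewrite (nmM v) (nT_near1 r1 yr) mulr1.
Qed.

Lemma Ubor_group r s : 0 < r <= 1 -> 0 < s -> group_closed (mem (Ubor r s)).
Proof.
move=> /andP[r0 r1] s0; apply: group_closedI.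
  by split; [exact: borel1|split; rewrite ?e1 ?subrr ?(nm0 v)].
move=> g h [gB [ga gd gb]] [hB [ha hd hb]].
split; first by apply: borelM => //; exact: borelV.
have /borelE hc : borel D (h^-1)%g by exact: borelV.
have /borelE gc := gB.
rewrite !eM hc gc !simpr01 !(e_inv_borel divD hB).
have na := nT_near1 r1 ha; have nd := nT_near1 r1 hd.
split; try (apply: nT_mul_near1 => //; exact: nT_inv_near1).
apply: (nmD_lt v); rewrite ?(nmM v) ?(nmN v) ?(nmM v) ?(nmV v) ?na ?nd invr1 ?mulr1 ?mul1r //.
by rewrite (nT_near1 r1 ga) mul1r.
Qed.

Lemma Ubor_open r s : 0 < r <= 1 -> 0 < s -> open_subgroup (borel D) (Ubor r s).
Proof.
move=> r01 s0; have /andP[r0 r1] := r01; split; first exact: Ubor_group.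
exists [set g : G | [/\ N (ea g - 1) < r, N (ed g - 1) < r & N (eb g) < s]]; last first.
  by apply/seteqP; split=> g /=; case.
have tr (x y z : T) e : N (x - y) < e -> N (y - z) < e -> N (x - z) < e by exact: (nm_trans v).
rewrite openE => g [ga gd gb].
apply: filterS (filterI (filterI (@entry_ball ord0 ord0 g r r0)
  (@entry_ball ord_max ord_max g r r0)) (@entry_ball ord0 ord_max g s s0)).
move=> h [[/= ha hd] hb]; split.
- exact: tr ha ga.
- exact: tr hd gd.
- by rewrite -[eb h]subr0; apply: tr hb _; rewrite subr0.
Qed.

Lemma open_in_borel (A : set G) : open_in (borel D) A -> A 1%g ->
  exists r : R, [/\ 0 < r, r <= 1 & Ubor r r `<=` A].
Proof.
case=> O oO -> [O1 _].
have [r [r0 r1 rO]] : exists r : R, [/\ 0 < r, r <= 1 & Kr r `<=` O].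
  by apply: Kr_subset; exact: open_nbhs_nbhs.
exists r; split=> // g gU; split; last by case: gU.
have nU' h : Ubor r r h -> near1 r h.
  by case=> /borelE hc [ha hd hb]; split; rewrite ?hc ?(nm0 v).
apply: rO; split; apply: nU' => //.
by apply: group_closed_inv => //; apply: Ubor_group; rewrite ?r0.
Qed.

End Congruence.

(** * Submodules and eigenvectors *)

Section Submodules.
Variables (K : fieldType) (V : lmodType K) (S : {pred V}).
Hypothesis Ssub : submod_closed S.

Lemma submod0 : 0 \in S. Proof. by case: Ssub. Qed.
Lemma submodP a u v : u \in S -> v \in S -> a *: u + v \in S.
Proof. by move=> uS vS; case: Ssub => _; apply. Qed.
Lemma submodZ a u : u \in S -> a *: u \in S.
Proof. by move=> uS; rewrite -[a *: u]addr0; apply: submodP => //; exact: submod0. Qed.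
Lemma submodD u v : u \in S -> v \in S -> u + v \in S.
Proof. by move=> uS vS; rewrite -[u]scale1r; exact: submodP. Qed.
Lemma submodB u v : u \in S -> v \in S -> u - v \in S.
Proof. by move=> uS vS; rewrite -scaleN1r addrC; exact: submodP. Qed.
Lemma submod_sum (I : Type) (r : seq I) (P : pred I) (f : I -> V) :
  (forall i, P i -> f i \in S) -> \sum_(i <- r | P i) f i \in S.
Proof. by move=> fS; elim/big_ind: _ => //; [exact: submod0|exact: submodD]. Qed.

End Submodules.

Section Endomorphisms.
Variables (K : fieldType) (V : lmodType K) (phi : {linear V -> V}).

(** P(phi) applied to one vector; V may have infinite dimension, as the induced representation
    does. *)
Definition pact (P : {poly K}) (v : V) : V := \sum_(i < size P) P`_i *: iter i phi v.

Lemma pactE n (P : {poly K}) v : (size P <= n)%N ->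
  pact P v = \sum_(i < n) P`_i *: iter i phi v.
Proof.
move=> Pn; rewrite /pact (big_ord_widen _ (fun i => P`_i *: iter i phi v) Pn).
rewrite big_mkcond; apply: eq_bigr => i _; case: ltnP => // iP.
by rewrite nth_default ?scale0r.
Qed.

Lemma pactD P Q v : pact (P + Q) v = pact P v + pact Q v.
Proof.
set n := maxn (size P) (size Q).
rewrite (@pactE n (P + Q)) ?size_polyD // (@pactE n P) ?leq_maxl // (@pactE n Q) ?leq_maxr //.
by rewrite -big_split; apply: eq_bigr => i _; rewrite coefD scalerDl.
Qed.

Lemma pactZ c P v : pact (c *: P) v = c *: pact P v.
Proof.
rewrite (@pactE (size P) (c *: P)) ?size_scale_leq // /pact scaler_sumr.
by apply: eq_bigr => i _; rewrite coefZ scalerA.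
Qed.

Lemma pactXn n v : pact 'X^n v = iter n phi v.
Proof.
rewrite (@pactE n.+1) ?size_polyXn // big_ord_recr /= coefXn eqxx scale1r big1 ?add0r // => i _.
by rewrite coefXn ltn_eqF ?scale0r.
Qed.

Lemma pact_factor c P v : pact (('X - c%:P) * P) v = phi (pact P v) - c *: pact P v.
Proof.
rewrite mulrBl mul_polyC pactD -scaleNr pactZ scaleNr; congr (_ - _).
rewrite (@pactE (size P).+1); last first.
  have [->|P0] := eqVneq P 0; first by rewrite mulr0 size_poly0.
  by rewrite mulrC size_mulX.
rewrite big_ord_recl coefXM scale0r add0r /pact linear_sum.
by apply: eq_bigr => i _; rewrite coefXM linearZ.
Qed.

Lemma pactX P v : pact ('X * P) v = phi (pact P v).
Proof. by have := pact_factor 0 P v; rewrite polyC0 !subr0 scale0r subr0. Qed.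

Lemma pactC c v : pact c%:P v = c *: v.
Proof. by rewrite -[c%:P]mulr1 mul_polyC pactZ -(expr0 'X) pactXn. Qed.

Lemma pact_stable (S : {pred V}) P v : submod_closed S ->
  (forall u, u \in S -> phi u \in S) -> v \in S -> pact P v \in S.
Proof.
move=> Ssub Sphi vS; apply: submod_sum => // i _; apply: submodZ => //.
by elim: (nat_of_ord i) => //= n IH; exact: Sphi.
Qed.

(** Apply the factors one after the other: the last nonzero vector obtained is an eigenvector. *)
Lemma pact_prod_eigenvector (S : {pred V}) (s : seq K) v : submod_closed S ->
  (forall u, u \in S -> phi u \in S) -> v \in S -> v != 0 ->
  pact (\prod_(c <- s) ('X - c%:P)) v = 0 ->
  exists c u, [/\ c \in s, u \in S, u != 0 & phi u = c *: u].
Proof.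
move=> Ssub Sphi vS v0; elim: s => [|c s IH].
  by rewrite big_nil -polyC1 pactC scale1r => /eqP; rewrite (negPf v0).
rewrite big_cons pact_factor => /eqP; rewrite subr_eq0 => /eqP pE.
have [/IH[c' [u [cs uS u0 uE]]]|p0] := eqVneq (pact (\prod_(c <- s) ('X - c%:P)) v) 0.
  by exists c', u; rewrite inE cs orbT.
by exists c, (pact (\prod_(c <- s) ('X - c%:P)) v); rewrite inE eqxx pact_stable.
Qed.

(** In characteristic p, X^(p^e) - 1 = (X - 1)^(p^e), so 1 is the only possible eigenvalue. *)
Lemma unipotent_fixed_vector (p e : nat) (S : {pred V}) v : p \in [pchar K] ->
  submod_closed S -> (forall u, u \in S -> phi u \in S) -> v \in S -> v != 0 ->
  iter (p ^ e) phi v = v -> exists u, [/\ u \in S, u != 0 & phi u = u].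
Proof.
move=> pK Ssub Sphi vS v0 phiv.
have pP : p \in [pchar {poly K}] by rewrite pchar_poly.
have XE : ('X - (1 : K)%:P) ^+ (p ^ e) = 'X^(p ^ e) - 1 :> {poly K}.
  elim: e {phiv} => [|e IH]; first by rewrite !expr1.
  by rewrite expnSr exprM IH -(pFrobenius_autE pP) pFrobenius_autB_comm ?pFrobenius_autE
       ?expr1n -?exprM //; exact: mulrC.
have [|c [u [cs uS u0 uE]]] := @pact_prod_eigenvector S (nseq (p ^ e) 1) v Ssub Sphi vS v0.
  by rewrite big_nseq -Monoid.iteropE -/(_ ^+ _) XE pactD pactXn phiv -polyC1 -polyCN pactC scaleN1r subrr.
by exists u; split=> //; rewrite uE; move: cs; rewrite mem_nseq => /andP[_ /eqP->]; rewrite scale1r.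
Qed.

Lemma iter_dependent (A : set V) v : finite_dimensional A -> (forall u, A u -> A (phi u)) ->
  A v -> exists2 P : {poly K}, P != 0 & pact P v = 0.
Proof.
move=> [n [e eP]] Aphi Av.
have Ai i : A (iter i phi v) by elim: i => //= i; exact: Aphi.
have [|c [i ci] cE] := @lin_dependent K V n e n.+1 (fun i : 'I__ => iter i phi v) (ltnSn n).
  by move=> i; exact: eP.
pose P := \poly_(i < n.+1) c (inord i); have cP (j : 'I_n.+1) : P`_j = c j.
  by rewrite coef_poly ltn_ord inord_val.
exists P; first by apply: contraNneq ci => P0; rewrite -cP P0 coef0.
rewrite (@pactE n.+1) ?size_poly // -[RHS]cE.
by apply: eq_bigr => j _; rewrite cP.
Qed.

(** Injectivity removes powers of X from a polynomial that annihilates v, so its constant term may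
    be taken nonzero; solving for v exhibits a preimage that is a polynomial in phi applied to v,
    hence in A. *)
Lemma injective_finite_dimensional_surj (A : set V) : finite_dimensional A ->
  injective phi -> A 0 -> (forall a u v, A u -> A v -> A (a *: u + v)) ->
  (forall u, A u -> A (phi u)) -> forall v, A v -> exists2 u, A u & phi u = v.
Proof.
move=> finA phi_inj A0 AP Aphi v Av.
have [P P0 PE] := iter_dependent finA Aphi Av.
have {P P0 PE} : exists P : {poly K}, P`_0 != 0 /\ pact P v = 0.
  have [m [Q Q0 PQ]] : exists m, exists2 Q : {poly K}, Q`_0 != 0 & P = 'X^m * Q.
    have [m [Q Qr PE']] := multiplicity_XsubC P 0.
    exists m, Q; last by rewrite PE' subr0 mulrC.
    by move: Qr; rewrite P0 /= /root horner_coef0.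
  exists Q; split=> //; move: PE; rewrite PQ.
  elim: m {PQ} => [|m IH]; first by rewrite expr0 mul1r.
  rewrite exprS -mulrA pactX => /eqP.
  by rewrite -[X in _ == X](linear0 phi) => /eqP/phi_inj.
case=> P [P0 PE].
pose Q := \poly_(i < size P) P`_i.+1.
have PQ : P = 'X * Q + (P`_0)%:P.
  apply/polyP => -[|i]; rewrite coefD coefXM coefC /= ?add0r // addr0 coef_poly.
  by case: ltnP => // iP; rewrite nth_default // (leq_trans iP).
exists (- (P`_0)^-1 *: pact Q v).
  rewrite -[_ *: _]addr0; apply: (AP) => //.
  rewrite /pact; elim/big_ind: _ => // [a b Aa Ab|i _].
    by rewrite -[a]scale1r; exact: AP.
  rewrite -[_ *: _]addr0; apply: (AP) => //.
  by elim: (nat_of_ord i) => //= j; exact: Aphi.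
move: PE; rewrite {1}PQ pactD pactX pactC => /eqP; rewrite addr_eq0 => /eqP phE.
by rewrite linearZ /= phE scalerN scaleNr opprK scalerA mulVf // scale1r.
Qed.

End Endomorphisms.

Lemma eigenvector_exists (K : closedFieldType) (V : lmodType K) (phi : {linear V -> V}) (v : V) :
  @finite_dimensional K V setT -> v != 0 -> exists (c : K) (u : V), u != 0 /\ phi u = c *: u.
Proof.
move=> finV v0; have [P P0 PE] := @iter_dependent K V phi setT v finV (fun _ _ => I) I.
have [r PrE] := closed_field_poly_normal P.
have S1 : submod_closed (predT : {pred V}) by [].
have [|c [u [_ _ u0 uE]]] := @pact_prod_eigenvector K V phi predT r v S1 (fun _ _ => isT) isT v0.
  move: PE; rewrite PrE pactZ => /eqP; rewrite scaler_eq0 lead_coef_eq0 (negPf P0) /=.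
  by move/eqP.
by exists c, u.
Qed.

(** * Irreducible admissible representations of B *)

Section BorelRepresentation.
Variables (R : realType) (p : nat) (F : topologicalFieldType) (absF : F -> R).
Hypothesis lf : nonarch_local_field p absF.
Variable D : falgType F.
Local Notation T := (algtop D).
Local Notation G := (GL2 D).
Hypothesis divD : forall x : T, x != 0 -> x \is a GRing.unit.
Local Notation N := (@nT R F absF D).
Let v : valued N := valued_nT lf divD.

(** Despite the name, w need not generate the maximal ideal: what matters is that its powers
    contract. *)
Lemma uniformizer_exists : exists2 w : F, w != 0 & 0 < absF w < 1.
Proof.
have vF := valued_absF lf.
have [x x0 x1] := absF_nontrivial lf.
have xg : 0 < absF x := nm_gt0 vF x0.
case: (ltgtP (absF x) 1) => [x1'|x1'|x1']; last by rewrite x1' eqxx in x1.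
  by exists x; rewrite ?xg.
exists x^-1; first by rewrite invr_eq0.
by rewrite (nmV vF) invr_gt0 xg invf_lt1.
Qed.

Variable w : F.
Hypothesis w0 : w != 0.
Hypothesis w01 : 0 < absF w < 1.

Definition ctr (k : nat) : T := ((w ^+ k)%:A : D).

Lemma ctr_neq0 k : ctr k != 0.
Proof. by rewrite /ctr scaler_eq0 oner_eq0 orbF expf_neq0. Qed.

Lemma ctrC k (x : T) : ctr k * x = x * ctr k.
Proof. by rewrite /ctr -[LHS]scalerAl -[RHS]scalerAr mul1r mulr1. Qed.

Lemma nm_ctr k : N (ctr k) = (absF w ^+ (\dim {:D})) ^+ k.
Proof. by rewrite /nT /ctr (normD_alg lf) (nmX (valued_absF lf)) exprAC. Qed.

Lemma nm_ctr1 : 0 < absF w ^+ (\dim {:D}) < 1.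
Proof.
case/andP: w01 => w1 w2; rewrite exprn_gt0 //= exprn_ilt1 ?(ltW w1) //.
by rewrite -lt0n adim_gt0.
Qed.

Lemma ctr_small (M e : R) : 0 < e -> exists k, N (ctr k) * M < e.
Proof.
move=> e0; have M1 : 0 < 1 + `|M| by rewrite ltr_pwDl.
have [k ke] := expr_small nm_ctr1 (divr_gt0 e0 M1).
exists k; rewrite nm_ctr; move: ke; rewrite ltr_pdivlMr //; apply: le_lt_trans; apply: ler_wpM2l; first by rewrite exprn_ge0 // ltW //; case/andP: nm_ctr1.
by apply: le_trans (ler_norm M) _; rewrite lerDr ler01.
Qed.

Variables (K : closedFieldType) (rho : rep K (borel D)).
Hypothesis smooth_rho : smooth rho.
Local Notation RA := (rep_act rho).
Local Notation Ub := (@Ubor R F absF D).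

Lemma RAM g h x : borel D g -> borel D h -> RA (g * h)%g x = RA g (RA h x).
Proof. by move=> gB hB; rewrite rep_actM. Qed.

Lemma RAK g : borel D g -> cancel (RA g) (RA (g^-1)%g).
Proof. by move=> gB x; rewrite -RAM ?mulVg ?rep_act1 //; exact: borelV. Qed.

Lemma RA_inj g : borel D g -> injective (RA g).
Proof. by move=> gB; apply: can_inj (RAK gB). Qed.

Lemma smooth_fixed u : exists r : R, [/\ 0 < r, r <= 1 & forall g, Ub r r g -> RA g u = u].
Proof.
have [|r [r0 r1 rS]] := open_in_borel lf divD (smooth_rho u).
  by split; [exact: borel1|rewrite rep_act1].
by exists r; split=> // g /rS [].
Qed.

Hypothesis adm : admissible rho.

Lemma tG_ctr_commute k g : borel D g ->
  (tG (ctr k) 1 * g * tG (ctr k)^-1 1)%g = (tG (ea g) (ed g) * nU ((ea g)^-1 * (ctr k * eb g)))%g.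
Proof.
move=> gB; have c0 := ctr_neq0 k; have [a0 d0] := borel_diag gB.
have cV0 := invT_neq0 c0; have /borelE gc := gB.
apply: G_eq; rewrite !eM !(e_tG divD) ?oner_neq0 // !e_nU gc !simpr01 //.
- by rewrite ctrC mulrK ?divD.
- by rewrite mulVKr ?divD.
Qed.

(* t = diag(ctr k, 1)^-1 maps the vectors fixed by Ub r r injectively, hence bijectively by
   admissibility, to themselves; and n(x) t = t n(ctr k * x), where n(ctr k * x) is in Ub r r. *)
Lemma rho_unipotent x u : RA (nU x) u = u.
Proof.
have [r [r0 r1 rU]] := smooth_fixed u.
have r01 : 0 < r <= 1 by rewrite r0.
have [k kx] := ctr_small (N x) r0.
have c0 := ctr_neq0 k; have cV0 := invT_neq0 c0; have o0 : (1 : T) != 0 := oner_neq0 _.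
have tB : borel D (tG (ctr k)^-1 1) by exact: borel_tG.
have tV : ((tG (ctr k)^-1 1)^-1)%g = tG (ctr k) 1 by rewrite tGV // invrK invr1.
have c1 : N (ctr k) <= 1.
  rewrite nm_ctr exprn_ile1 //; first by case/andP: nm_ctr1 => /ltW.
  by case/andP: nm_ctr1 => _ /ltW.
have [] := @injective_finite_dimensional_surj K rho (RA (tG (ctr k)^-1 1)) (invariants (V:=rho) (Ub r r)) _ _ _ _ _ u.
- by apply: (adm.2); exact: (Ubor_open lf divD).
- exact: RA_inj.
- by move=> g _; rewrite linear0.
- by move=> a u1 u2 u1A u2A g gU; rewrite linearP u1A // u2A.
- move=> u1 u1A g gU; have gB : borel D g by case: gU.
  rewrite -RAM // -[g in LHS](mulVKg (tG (ctr k)^-1 1)) -!mulgA RAM //; last first.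
    by rewrite tV mulgA tG_ctr_commute //; apply: borelM; [apply: borel_tG; case: (borel_diag gB)|exact: borel_nU].
  congr (RA _ _); rewrite tV mulgA; apply: u1A; rewrite tG_ctr_commute //.
  have [a0 d0] := borel_diag gB; case: gU => _ [ga gd gb].
  split; first by apply: borelM; [exact: borel_tG|exact: borel_nU].
  rewrite !eM !(e_tG divD) // !e_nU !simpr01; split=> //.
  rewrite mulVKr ?divD // (nmM v); apply: le_lt_trans gb.
  by rewrite ler_piMl // (nm_ge0 v).
- by move=> g gU; exact: rU.
move=> u' u'A <-; rewrite -RAM //; last exact: borel_nU.
rewrite nU_tG // invrK mulr1 RAM //; last exact: borel_nU.
congr (RA _ _); apply: u'A; split; first exact: borel_nU.
by rewrite !e_nU subrr (nm0 v) (nmM v).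
Qed.

Lemma RA_diag b u : borel D b -> RA b u = RA (tG (ea b) (ed b)) u.
Proof.
move=> bB; have [a0 d0] := borel_diag bB.
rewrite [in LHS](borel_factor divD bB) RAM ?rho_unipotent //; last exact: borel_nU.
exact: borel_tG.
Qed.

Hypothesis irr : irreducible rho.

Lemma rho_submodule_full (S : {pred rho}) u : submod_closed S ->
  (forall b x, borel D b -> x \in S -> RA b x \in S) -> u \in S -> u != 0 -> forall x, x \in S.
Proof.
move=> Ssub SB uS u0; case: irr => _ /(_ S Ssub) [||//]; first by move=> *; exact: SB.
by move=> /(_ u uS) u00; rewrite u00 eqxx in u0.
Qed.

Lemma rho_near1 : exists r : R, [/\ 0 < r, r <= 1 &
  forall b x, borel D b -> N (ea b - 1) < r -> N (ed b - 1) < r -> RA b x = x].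
Proof.
have [[u u0] _] := irr; have [r [r0 r1 rU]] := smooth_fixed u.
pose S : {pred rho} := fun x => `[< forall b, borel D b -> N (ea b - 1) < r ->
   N (ed b - 1) < r -> RA b x = x >].
have Ssub : submod_closed S.
  split; first by apply/asboolP => b *; rewrite linear0.
  move=> a x y /asboolP xS /asboolP yS; apply/asboolP => b *.
  by rewrite linearP xS // yS.
exists r; split=> // b x bB ba bd.
suff /asboolP xS : x \in S by exact: xS.
apply: (@rho_submodule_full S u Ssub) => //; last first.
  apply/asboolP => b' b'B ba' bd'; rewrite RA_diag //; apply: rU.
  have [a0 d0] := borel_diag b'B.
  by split; [exact: borel_tG|rewrite !(e_tG divD) // (nm0 v)].
move=> h y hB /asboolP yS; apply/asboolP => b' b'B ba' bd'.
have hVB := borelV divD hB; have bhB := borelM b'B hB.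
have [a0 d0] := borel_diag hB.
have conj1 (z t : T) : z != 0 -> N (t - 1) < r -> N (z^-1 * (t * z) - 1) < r.
  move=> z0 t1; have -> : z^-1 * (t * z) - 1 = z^-1 * ((t - 1) * z).
    by rewrite mulrBl mul1r mulrBr mulVr ?divD.
  by rewrite !(nmM v) mulrC -mulrA -(nmM v) divrr ?divD // (nm1 v) mulr1.
rewrite -RAM // -[(b' * h)%g](mulVKg h) RAM //; last exact: borelM.
congr (RA _ _); apply: yS; first exact: borelM.
  rewrite !eM !(e_inv_borel divD hB); move/borelE: hB => ->.
  by move/borelE: b'B => ->; rewrite ?simpr01; apply: conj1.
rewrite !eM !(e_inv_borel divD hB).
move/borelE: b'B => ->; move/borelE: hVB => ->; rewrite ?simpr01; exact: conj1.
Qed.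

Lemma rho_finite_dimensional : @finite_dimensional K rho setT.
Proof.
have [r [r0 r1 rU]] := rho_near1.
have oU : open_subgroup (borel D) (Ub r r) by apply: (Ubor_open lf divD); rewrite ?r0.
have [n [e eP]] := adm.2 _ oU.
by exists n, e => x _; apply: eP => g [gB [ga gd _]]; exact: rU.
Qed.

Lemma schur_scalar (phi : {linear rho -> rho}) :
  (forall b x, borel D b -> phi (RA b x) = RA b (phi x)) -> exists c, forall x, phi x = c *: x.
Proof.
move=> phiC; have [[u u0] _] := irr.
have [c [e [e0 eE]]] := eigenvector_exists phi rho_finite_dimensional u0.
exists c => x; pose S : {pred rho} := fun x => phi x == c *: x.
suff : x \in S by move/eqP.
apply: (@rho_submodule_full S e) => //; last by apply/eqP.
- split; first by apply/eqP; rewrite linear0 scaler0.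
  move=> a y z /eqP yS /eqP zS; apply/eqP.
  by rewrite linearP yS zS scalerDr !scalerA mulrC.
- by move=> b y bB /eqP yS; apply/eqP; rewrite phiC // yS linearZ.
Qed.

End BorelRepresentation.

(** * The induced representation *)

Section InducedRepresentation.
Variables (R : realType) (p : nat) (F : topologicalFieldType) (absF : F -> R).
Hypothesis lf : nonarch_local_field p absF.
Variable D : falgType F.
Local Notation T := (algtop D).
Local Notation G := (GL2 D).
Hypothesis divD : forall x : T, x != 0 -> x \is a GRing.unit.
Local Notation N := (@nT R F absF D).
Let v : valued N := valued_nT lf divD.
Variables (K : closedFieldType) (rho : rep K (borel D)).
Local Notation RA := (rep_act rho).
Local Notation Ub := (@Ubor R F absF D).
Local Notation Kr := (@Kr R F absF D).
Hypothesis rhoU : forall x u, RA (nU x) u = u.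
Local Notation I := (ind_space rho).

Lemma ind_eq (f h : I) : (forall g, f g = h g) -> f = h.
Proof. by move=> fh; apply/val_inj/funext. Qed.

Lemma ind_funD (f h : I) g : (f + h) g = f g + h g. Proof. by []. Qed.
Lemma ind_funB (f h : I) g : (f - h) g = f g - h g. Proof. by []. Qed.
Lemma ind_funZ c (f : I) g : (c *: f) g = c *: f g. Proof. by []. Qed.
Lemma ind_fun_sum (J : Type) (s : seq J) (P : pred J) (f : J -> I) g :
  (\sum_(j <- s | P j) f j) g = \sum_(j <- s | P j) f j g.
Proof. by elim/big_rec2: _ => // j a b _ <-. Qed.

Lemma ind_actE x (f : I) g : ind_act x f g = f (g * x)%g. Proof. by []. Qed.

Lemma ind_borel (f : I) b g : borel D b -> f (b * g)%g = RA b (f g).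
Proof. by have /asboolP[H _] := ind_funP f; exact: H. Qed.

Lemma ind_smooth (f : I) : exists r, [/\ 0 < r, r <= 1 & forall g k, Kr r k -> f (g * k)%g = f g].
Proof.
have /asboolP[_ [U /open_subgroupTP[UG U1] fU]] := ind_funP f.
have [r [r0 r1 rU]] := Kr_subset lf divD U1.
by exists r; split=> // g k /rU; exact: fU.
Qed.

(** The restriction of f to representatives of B \ B w N. Together with f(1) it determines f, since
    G is the union of B and B w N. *)
Definition ft (f : I) (x : T) : rho := f (wG * nU x)%g.

Lemma ftE (f : I) g : ec g != 0 -> f g = RA (bruhat g) (ft f (coordG g)).
Proof.
by move=> c0; rewrite [in LHS](bruhatE g) ind_borel //; exact: borel_bruhat.
Qed.

Lemma ind_at_borel (f : I) b : borel D b -> f b = RA b (f 1%g).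
Proof. by move=> bB; rewrite -ind_borel // mulg1. Qed.

Lemma ind_ft_eq (f h : I) : f 1%g = h 1%g -> ft f =1 ft h -> f = h.
Proof.
move=> fh1 fh; apply: ind_eq => g; have [gB|c0] := eqVneq (ec g) 0.
  have gB' : borel D g := gB.
  by rewrite (ind_at_borel f gB') (ind_at_borel h gB') fh1.
by rewrite !ftE // fh.
Qed.

(** For small y smoothness gives f(1) = f(n^-(y)), and [nL_bruhat] rewrites the right side. *)
Lemma ft_at_infinity (f : I) : exists r, [/\ 0 < r, r <= 1 & forall y, y != 0 -> N y < r ->
   f 1%g = RA (tG y^-1 y) (ft f y^-1)].
Proof.
have [r [r0 r1 fr]] := ind_smooth f; exists r; split=> // y y0 yr.
rewrite -[in LHS](fr 1%g (nL y)) ?mul1g; last exact: (Kr_nL lf divD).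
have tB : borel D (tG y^-1 y) by apply: borel_tG => //; exact: invT_neq0.
rewrite nL_bruhat // ind_borel; last by apply: borelM => //; exact: borel_nU.
by rewrite rep_actM //= ?rhoU //; exact: borel_nU.
Qed.

Lemma ft_compact_support (f : I) : f 1%g = 0 -> exists2 M, 0 < M & forall x, M <= N x -> ft f x = 0.
Proof.
move=> f1; have [r [r0 r1 fr]] := ft_at_infinity f.
exists (r^-1 + 1) => [|x xM]; first by rewrite addr_gt0 ?invr_gt0.
have xr : r^-1 < N x by apply: lt_le_trans xM; rewrite ltrDl.
have x0 : x != 0.
  by apply: (nm_neq0 v); rewrite gt_eqF // (lt_trans _ xr) ?invr_gt0.
have xV := invT_neq0 x0; have tB : borel D (tG x x^-1) by exact: borel_tG.
have := fr _ xV; rewrite invrK f1 (nmV v) => H.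
apply: (RA_inj divD tB); rewrite linear0 -H //.
by rewrite -[r]invrK ltf_pV2 // ?posrE ?invr_gt0 // (lt_trans _ xr) ?invr_gt0.
Qed.

Lemma ft_nU y (f : I) x : ft (ind_act (nU y) f) x = ft f (x + y).
Proof. by rewrite /ft ind_actE nUD mulgA. Qed.

Lemma ft_shift (f : I) r (x y : T) : 0 < r -> (forall g k, Kr r k -> f (g * k)%g = f g) ->
  N y < r -> ft f (x + y) = ft f x.
Proof.
move=> rpos fr yr; rewrite /ft nUD mulgA; apply: (fr (wG * nU x)%g).
exact: (Kr_nU lf divD).
Qed.

Lemma ind_nU_at1 y (f : I) : ind_act (nU y) f 1%g = f 1%g.
Proof. by rewrite ind_actE mul1g ind_at_borel ?rhoU //; exact: borel_nU. Qed.

Lemma ft_tG a b (f : I) x : a != 0 -> b != 0 ->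
  ft (ind_act (tG a b) f) x = RA (tG b a) (ft f (a^-1 * x * b)).
Proof.
move=> a0 b0; rewrite /ft ind_actE -mulgA nU_tG // mulgA wG_tG // -mulgA.
have tB : borel D (tG b a) by apply: borel_tG.
by rewrite (ind_borel f _ tB).
Qed.

Lemma ind_borel_at1 b (f : I) : borel D b -> ind_act b f 1%g = RA b (f 1%g).
Proof. by move=> bB; rewrite ind_actE mul1g ind_at_borel. Qed.

Lemma ftD (f h : I) x : ft (f + h) x = ft f x + ft h x. Proof. by []. Qed.
Lemma ftB (f h : I) x : ft (f - h) x = ft f x - ft h x. Proof. by []. Qed.
Lemma ftZ c (f : I) x : ft (c *: f) x = c *: ft f x. Proof. by []. Qed.
Lemma ft_sum (J : Type) (s : seq J) (P : pred J) (f : J -> I) x :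
  ft (\sum_(j <- s | P j) f j) x = \sum_(j <- s | P j) ft (f j) x.
Proof. exact: ind_fun_sum. Qed.

Variable r0 : R.
Hypothesis r0_gt0 : 0 < r0.
Hypothesis r0_le1 : r0 <= 1.
Hypothesis rho1 : forall b x, borel D b -> N (ea b - 1) < r0 -> N (ed b - 1) < r0 -> RA b x = x.

Lemma e_wGV : ((ea (wG^-1 : G)%g = 0) * (eb (wG^-1 : G)%g = 1) *
  (ec (wG^-1 : G)%g = -1) * (ed (wG^-1 : G)%g = 0))%type.
Proof.
have -> : (wG^-1 : G)%g = (wG * wG * wG)%g.
  apply: (@mulgI _ wG); rewrite mulgV; apply: G_eq; rewrite !eM !e_wG !e1 !simpr01 //;
  by rewrite ?mulN1r ?mulrN1 ?opprK.
by rewrite !eM !e_wG !simpr01 ?mulrN1 ?mulN1r ?opprK.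
Qed.

Lemma e_bruhat (g : G) : ea (bruhat g) = ea g * coordG g - eb g /\ ed (bruhat g) = ec g.
Proof.
have -> : bruhat g = (g * (nU (- coordG g) * wG^-1))%g by rewrite /bruhat invgM nUN.
by rewrite !eM !e_wGV !e_nU !simpr01 ?mulrN1 ?opprK.
Qed.

(** * Functions supported on one ball of the big cell *)

Section BallFunction.
Variables (s : R) (u : rho).
Hypothesis s0 : 0 < s.

Definition in_cell (g : G) : bool := (ec g != 0) && (N (coordG g) < s).

Definition ball_fun (g : G) : rho :=
  if in_cell g then RA (bruhat g) u else 0.

Lemma bruhat_mull b g : borel D b -> ec g != 0 ->
  [/\ ec (b * g)%g != 0, coordG (b * g)%g = coordG g & bruhat (b * g)%g = (b * bruhat g)%g].
Proof.
move=> bB c0; have [_ d0] := borel_diag bB; move/borelE: bB => bc.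
have cE : ec (b * g)%g = ed b * ec g by rewrite ecM bc mul0r add0r.
have cB : coordG (b * g)%g = coordG g.
  have U1 := divD d0; have U2 := divD c0.
  rewrite /coordG cE edM bc mul0r add0r invrM // -mulrA; congr (_ * _).
  by rewrite mulKr.
split=> //; first by rewrite cE mulT_neq0.
by rewrite /bruhat cB mulgA.
Qed.

Lemma ball_fun_borel b g : borel D b -> ball_fun (b * g)%g = RA b (ball_fun g).
Proof.
move=> bB.
have cell h b' : borel D b' -> in_cell h -> in_cell (b' * h)%g.
  by move=> b'B /andP[c0 hs]; have [c1 cE _] := bruhat_mull b'B c0; rewrite /in_cell c1 cE.
rewrite /ball_fun; have [gc|ng] := boolP (in_cell g).
  have /andP[c0 _] := gc; rewrite cell //; have [_ _ ->] := bruhat_mull bB c0.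
  by rewrite rep_actM //; exact: borel_bruhat.
case: ifP => [bg|_]; last by rewrite linear0.
by case/negP: ng; rewrite -(mulKg b g); apply: cell => //; exact: borelV.
Qed.

(** Three demands on k in [Kr]: level <= s keeps the coordinate inside the ball, while level <= r0
    and level * s <= r0 keep the Borel part of w n(x) k where rho is trivial. The divisor 1 + s
    ensures the third. *)
Definition ball_level : R := Num.min (Num.min s r0) (r0 / (1 + s)).

Lemma ball_level_gt0 : 0 < ball_level.
Proof. by rewrite !lt_min s0 r0_gt0 divr_gt0 // addr_gt0. Qed.

Lemma ball_level_le1 : ball_level <= 1.
Proof. by rewrite !ge_min r0_le1 orbT. Qed.

Lemma ball_levelP : [/\ ball_level <= s, ball_level <= r0 & ball_level * s <= r0].
Proof.
split; rewrite ?ge_min ?lexx ?orbT //.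
have s1 : 0 < 1 + s by rewrite addr_gt0.
have : ball_level * (1 + s) <= r0 by rewrite -ler_pdivlMr // ge_min lexx orbT.
by apply: le_trans; rewrite mulrDr mulr1 lerDr ltW // ball_level_gt0.
Qed.

(* The case g = w n(x): then wn(x)k has lower row (k11 + x k21, k12 + x k22). *)
Lemma in_cell_wnU x k : N x < s -> Kr ball_level k ->
  in_cell (wG * nU x * k)%g /\ RA (bruhat (wG * nU x * k)%g) u = u.
Proof.
have [ls lr lsr] := ball_levelP; have l0 := ball_level_gt0.
move=> xs [[ka kb kc kd] _]; set g := (_ * k)%g.
have gc : ec g = ea k + x * ec k by rewrite ecM !e_wnU mul1r.
have gd : ed g = eb k + x * ed k by rewrite edM !e_wnU mul1r.
have ga : ea g = - ec k by rewrite eaM !e_wnU mul0r add0r mulN1r.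
have xk : N (x * ec k) < r0.
  rewrite (nmM v); apply: lt_le_trans lsr; rewrite mulrC.
  by apply: ltr_pM => //; exact: (nm_ge0 v).
have gc1 : N (ec g - 1) < r0.
  by rewrite gc addrAC; apply: (nmD_lt v) => //; exact: lt_le_trans lr.
have ngc : N (ec g) = 1 by apply: (nT_near1 lf divD) gc1.
have gc0 : ec g != 0 by apply: (nm_neq0 v); rewrite ngc oner_neq0.
have nd : N (ed k) = 1 by apply: (nT_near1 lf divD ball_level_le1) kd.
have gd' : N (ed g) < s.
  rewrite gd; apply: (nmD_lt v); first exact: lt_le_trans ls.
  by rewrite (nmM v) nd mulr1.
have cs : N (coordG g) < s by rewrite /coordG (nmM v) (nmV v) ngc invr1 mul1r.
split; first by rewrite /in_cell gc0.
have bB := borel_bruhat divD gc0.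
have [bra brd] := e_bruhat g.
apply: rho1 => //; rewrite ?brd // bra ga ebM !e_wnU mul0r add0r mulN1r opprK -addrA addrC mulNr; apply: (nmD_lt v); first exact: lt_le_trans kd lr.
rewrite (nmN v) (nmM v); apply: lt_le_trans lsr.
by apply: ltr_pM => //; exact: (nm_ge0 v).
Qed.

Lemma ball_fun_smooth g k : Kr ball_level k -> ball_fun (g * k)%g = ball_fun g.
Proof.
have fwd h k' : Kr ball_level k' -> in_cell h -> in_cell (h * k')%g /\ ball_fun (h * k')%g = ball_fun h.
  move=> k'K hc; have /andP[c0 hs] := hc; have bB := borel_bruhat divD c0.
  have [/andP[c1 n1] RE] := in_cell_wnU hs k'K.
  have [c2 n2 bE] := bruhat_mull bB c1.
  have hE : (h * k')%g = (bruhat h * (wG * nU (coordG h) * k'))%g by rewrite mulgA -bruhatE.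
  have ic : in_cell (h * k')%g by rewrite /in_cell hE c2 n2.
  split; first exact: ic.
  have bB' := borel_bruhat divD c1.
  by rewrite /ball_fun ic hc hE bE (rep_actM bB bB') /comp RE.
move=> kK; have [/fwd H|ng] := boolP (in_cell g); first by case: (H k kK).
rewrite /ball_fun (negPf ng); case: ifP => // gk.
by case/negP: ng; have := fwd _ _ (Kr_inv kK) gk; rewrite mulgK; case.
Qed.

Fact ball_ind_subproof : ball_fun \in @ind_pred K G (borel D) rho.
Proof.
apply/asboolP; split=> [b g|]; first exact: ball_fun_borel.
exists (Kr ball_level); last exact: ball_fun_smooth.
by apply: (Kr_open lf divD); rewrite ball_level_gt0 ball_level_le1.
Qed.

Definition ball_ind : I := IndSpace ball_ind_subproof.

Lemma ball_ind1 : ball_ind 1%g = 0.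
Proof. by rewrite /= /ball_fun /in_cell ec1 eqxx. Qed.

Lemma ft_ball x : ft ball_ind x = if N x < s then u else 0.
Proof.
rewrite /ft /= /ball_fun /in_cell coordG_wnU e_wnU oner_neq0 /=.
by rewrite /bruhat coordG_wnU mulgV rep_act1.
Qed.

End BallFunction.

Lemma ft_translated_ball s u (s0 : 0 < s) y x :
  ft (ind_act (nU (- y)) (ball_ind u s0)) x = if N (x - y) < s then u else 0.
Proof. by rewrite ft_nU ft_ball. Qed.

Lemma ind_ball_sum (f : I) (s M : R) (ys : seq T) (s0 : 0 < s) : f 1%g = 0 -> s <= M ->
  (forall x, M <= N x -> ft f x = 0) -> (forall x y : T, N y < s -> ft f (x + y) = ft f x) ->
  net N s M ys -> f = \sum_(y <- ys) ind_act (nU (- y)) (ball_ind (ft f y) s0).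
Proof.
move=> f1 sM fM fs ysP; apply: ind_ft_eq.
  by rewrite f1 ind_fun_sum big1 // => y _; rewrite ind_nU_at1 ball_ind1.
move=> x; rewrite ft_sum.
under eq_bigr => y _ do rewrite ft_translated_ball.
have cst y : N (x - y) < s -> ft f y = ft f x.
  by move=> xy; rewrite -[in RHS](subrK y x) addrC fs.
have [Mx|xM] := ltP M (N x).
  rewrite fM ?(ltW Mx) // big_seq big1 // => y yys; case: ifP => // xy.
  by rewrite cst // fM // ltW.
have [y [yys xy yP]] := net_filter v s0 ysP xM.
have [uys _ _ _] := ysP.
rewrite (bigD1_seq y) //= xy (cst _ xy) big_seq_cond big1 ?addr0 // => z /andP[zys zy].
by rewrite yP // (negPf zy).
Qed.

Lemma ball_ind_linear s (s0 : 0 < s) a u u' :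
  ball_ind (a *: u + u') s0 = a *: ball_ind u s0 + ball_ind u' s0.
Proof.
apply: ind_ft_eq; first by rewrite ind_funD ind_funZ !ball_ind1 scaler0 addr0.
by move=> x; rewrite ftD ftZ !ft_ball; case: ifP => //; rewrite scaler0 addr0.
Qed.

Lemma ball_indZ s (s0 : 0 < s) a u : ball_ind (a *: u) s0 = a *: ball_ind u s0.
Proof.
apply: ind_ft_eq; first by rewrite ind_funZ !ball_ind1 scaler0.
by move=> x; rewrite ftZ !ft_ball; case: ifP => //; rewrite scaler0.
Qed.

Lemma ball_ind0 s (s0 : 0 < s) : ball_ind 0 s0 = 0.
Proof. by rewrite -[X in ball_ind X _](scale0r (0 : rho)) ball_indZ scale0r. Qed.

Lemma ball_ind_eq0 s (s0 : 0 < s) u : ball_ind u s0 = 0 -> u = 0.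
Proof.
move=> u0; have : ft (ball_ind u s0) 0 = 0 by rewrite u0.
by rewrite ft_ball (nm0 v) s0.
Qed.

(** Passing through w swaps the entries, so diag(b, a) acts on the value, while x |-> a^-1 x b
    rescales the ball by N(a) / N(b). *)
Lemma ball_ind_tG a b s s' (s0 : 0 < s) (s'0 : 0 < s') u : a != 0 -> b != 0 ->
  s' * N b = s * N a -> ind_act (tG a b) (ball_ind u s0) = ball_ind (RA (tG b a) u) s'0.
Proof.
move=> a0 b0 ss; have tB : borel D (tG a b) by exact: borel_tG.
apply: ind_ft_eq; first by rewrite ind_borel_at1 // !ball_ind1 linear0.
have na := nm_gt0 v a0; have nb := nm_gt0 v b0.
move=> x; rewrite ft_tG // !ft_ball !(nmM v) (nmV v).
have -> : ((N a)^-1 * N x * N b < s) = (N x < s').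
  by rewrite -mulrA mulrC ltr_pdivrMr // -ss ltr_pM2r.
by case: ifP => //; rewrite linear0.
Qed.

(** N p < 1, so translations by bounded elements have p-power order modulo translations by small
    ones. *)
Lemma p_power_small (y : T) (r : R) : 0 < r -> exists e, N (y *+ p ^ e) < r.
Proof.
move=> rpos; have [p_pr ps] := residue_pchar lf.
have pD : N p%:R < 1.
  rewrite /nT -(scaler_nat p 1) (normD_alg lf) exprn_ilt1 ?(absF_ge0 lf) //.
  by rewrite -lt0n adim_gt0.
have yE e : N (y *+ p ^ e) = N p%:R ^+ e * N y.
  by rewrite -(mulr_natl y (p ^ e)) natrX (nmM v) (nmX v).
have [p0|p0] := eqVneq (N p%:R) 0.
  by exists 1%N; rewrite yE p0 expr1 mul0r.
have p0' : 0 < N p%:R < 1 by rewrite lt_def p0 (nm_ge0 v).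
have [|e ee] := expr_small p0' (_ : 0 < r / (N y + 1)).
  by rewrite divr_gt0 // ltr_wpDl // (nm_ge0 v).
exists e; rewrite yE; move: ee; rewrite ltr_pdivlMr; last by rewrite ltr_wpDl // (nm_ge0 v).
by apply: le_lt_trans; rewrite ler_wpM2l ?exprn_ge0 ?(nm_ge0 v) // lerDl.
Qed.

Hypothesis irr : irreducible rho.
Hypothesis schur : forall phi : {linear rho -> rho},
  (forall b x, borel D b -> phi (RA b x) = RA b (phi x)) -> exists c, forall x, phi x = c *: x.
Hypothesis pK : p \in [pchar K].
Variable w : F.
Hypothesis w0 : w != 0.
Hypothesis w01 : 0 < absF w < 1.
Local Notation ctr := (@ctr F D w).

(** * Subspaces stable under B *)

Section BorelStable.
Variable S : {pred I}.
Hypothesis Ssub : submod_closed S.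
Hypothesis SB : forall b f, borel D b -> f \in S -> ind_act b f \in S.

(** All functions in play vanish for N x >= M and are invariant under translations smaller than r;
    so invariance under the open ball of radius M amounts to invariance under the finitely many net
    points in it. *)
Lemma submod_contains_ball f : f \in S -> f != 0 -> f 1%g = 0 ->
  exists s (s0 : 0 < s) u, u != 0 /\ ball_ind u s0 \in S.
Proof.
move=> fS f0 f1; have [r [rpos r1 fr]] := ind_smooth f.
have [M0 M00 fM0] := ft_compact_support f1.
pose M := Num.max M0 r; have M1 : 0 < M by rewrite lt_max M00.
have fM x : M <= N x -> ft f x = 0.
  by move=> xM; apply: fM0; apply: le_trans xM; rewrite le_max lexx.
have rM : r <= M by rewrite le_max lexx orbT.
pose S' (h : I) := [/\ h \in S, h 1%g = 0, forall x, M <= N x -> ft h x = 0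
  & forall x y : T, N y < r -> ft h (x + y) = ft h x].
pose S2 (ys : seq T) : {pred I} := fun h =>
  `[< S' h /\ forall y x : T, y \in ys -> ft h (x + y) = ft h x >].
have S2sub ys : submod_closed (S2 ys).
  split; first by apply/asboolP; split=> //; split=> //; exact: submod0.
  move=> a h h' /asboolP[[hS h1 hM hr] hy] /asboolP[[h'S h'1 h'M h'r] h'y].
  apply/asboolP; split; last by move=> y x ys_y; rewrite !ftD !ftZ hy // h'y.
  split.
  - exact: submodP.
  - by rewrite ind_funD ind_funZ h1 h'1 scaler0 addr0.
  - by move=> x xM; rewrite ftD ftZ hM // h'M // scaler0 addr0.
  - by move=> x y yr; rewrite !ftD !ftZ hr // h'r.
have S2nU ys y h : N y < M -> h \in S2 ys -> ind_act (nU y) h \in S2 ys.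
  move=> yM /asboolP[[hS h1 hM hr] hy]; apply/asboolP; split; last first.
    by move=> z x ys_z; rewrite (ft_nU _ h (x + z)) (ft_nU _ h x) addrAC; exact: hy.
  split.
  - by apply: SB => //; exact: borel_nU.
  - by rewrite ind_nU_at1.
  - move=> x xM; rewrite ft_nU hM // (nm_lt_eq v (x := x)) //.
    by rewrite opprD addrA subrr add0r (nmN v) (lt_le_trans yM).
  - by move=> x z zr; rewrite (ft_nU _ h (x + z)) (ft_nU _ h x) addrAC; exact: hr.
(* Net points are added one at a time: n(y) preserves [S2 ys] since translations commute, and a
   p-power of it is a translation smaller than r, which acts trivially there. So it has a nonzero
   fixed vector in [S2 ys]. *)
have fix_all ys : (forall y, y \in ys -> N y < M) -> exists2 h, h != 0 & h \in S2 ys.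
  elim: ys => [_|y ys IH ysM].
    exists f => //; apply/asboolP; split=> //; split=> //.
    by move=> x y; exact: ft_shift rpos fr.
  have [|h h0 hS] := IH; first by move=> z zys; apply: ysM; rewrite inE zys orbT.
  have yM : N y < M by apply: ysM; rewrite inE eqxx.
  have [e ye] := p_power_small y rpos.
  have itE n : iter n (ind_act (nU y)) h = ind_act (nU (y *+ n)) h.
    elim: n => [|n IHn]; first by rewrite mulr0n nU0 ind_act1.
    by rewrite iterS IHn mulrS nUD ind_actM.
  have [||h' [h'S h'0 h'y]] := @unipotent_fixed_vector K I (ind_act (nU y)) p e (S2 ys) h pK (S2sub ys) _ hS h0.
  - by move=> g gS; exact: S2nU.
  - rewrite itE; apply: ind_ft_eq; first by rewrite ind_nU_at1.
    by move=> x; rewrite ft_nU; move/asboolP: hS => [[_ _ _ hr] _]; exact: hr.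
  exists h' => //; move/asboolP: h'S => [h'S h'ys]; apply/asboolP; split=> // z x.
  rewrite inE => /orP[/eqP->|]; last exact: h'ys.
  by rewrite -ft_nU h'y.
have [ys ysP] := net_exists v M rpos; have [_ _ _ ysc] := ysP.
have [|h h0 /asboolP[[hS h1 hM hr] hy]] := fix_all [seq y <- ys | N y < M].
  by move=> y; rewrite mem_filter => /andP[].
exists M, M1, (ft h 0).
have hE : h = ball_ind (ft h 0) M1.
  apply: ind_ft_eq; first by rewrite ball_ind1.
  move=> x; rewrite ft_ball; case: ltP => xM; last exact: hM.
  have [y yys xy] := ysc x (ltW xM).
  have yM : N y < M.
    rewrite -[y](subKr x); apply: (nmB_lt v) => //; exact: lt_le_trans rM.
  rewrite -[x](subrK y) addrC hr // -[y]add0r hy // mem_filter yM //.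
rewrite -hE; split=> //; apply: contraNneq h0 => u0.
by rewrite hE u0 ball_ind0.
Qed.

(** The larger ball is a finite disjoint union of translates of the smaller one, by the points of a
    net. *)
Lemma ball_ind_grow s1 s2 (s10 : 0 < s1) (s20 : 0 < s2) u : s1 <= s2 ->
  ball_ind u s10 \in S -> ball_ind u s20 \in S.
Proof.
move=> s12 uS; have [ys ysP] := net_exists v s2 s10.
rewrite (@ind_ball_sum (ball_ind u s20) s1 s2 ys s10 (ball_ind1 _ _) s12 _ _ ysP); first last.
- move=> x y ys1; rewrite !ft_ball; congr (if _ then _ else _); apply/idP/idP => H.
    rewrite -[x](addrK y); apply: (nmB_lt v) => //; exact: lt_le_trans s12.
  by apply: (nmD_lt v) => //; exact: lt_le_trans s12.
- by move=> x xs; rewrite ft_ball ltNge xs.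
apply: submod_sum => // y _; apply: SB; first exact: borel_nU.
rewrite ft_ball; case: ifP => // _.
by rewrite ball_ind0; exact: submod0.
Qed.

(** [ctr k] is central in D and unipotents act trivially, so diag(1, [ctr k]) commutes with the
    action of B and Schur's lemma applies. *)
Lemma ctr_scalar k : exists2 c, c != 0 & forall x, RA (tG 1 (ctr k)) x = c *: x.
Proof.
have c0 := ctr_neq0 D w0 k; have o0 : (1 : T) != 0 by exact: oner_neq0.
have tB : borel D (tG 1 (ctr k)) by exact: borel_tG.
have [b x bB|c cE] := schur (phi := RA (tG 1 (ctr k))).
  have [a0 d0] := borel_diag bB; have tB' : borel D (tG (ea b) (ed b)) by exact: borel_tG.
  have RAd y : RA b y = RA (tG (ea b) (ed b)) y.
    rewrite [in LHS](borel_factor divD bB) (rep_actM tB' (borel_nU _)) /=.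
    by rewrite rhoU.
  rewrite !RAd -!(RAM _ tB tB') -!(RAM _ tB' tB); congr (RA _ _).
  by rewrite -!tGM // mul1r mulr1 ctrC.
exists c => //; have [[u u0] _] := irr; apply: contraNneq u0 => c00.
by apply/eqP; apply: (RA_inj divD tB); rewrite cE c00 scale0r linear0.
Qed.

Theorem borel_stable_contains_kernel f : f \in S -> f != 0 -> f 1%g = 0 ->
  forall h : I, h 1%g = 0 -> h \in S.
Proof.
move=> fS f0 f1.
have [M [M0 [u [u0 uS]]]] := submod_contains_ball fS f0 f1.
(* diag([ctr k], 1) shrinks the ball of radius M below s at the cost of a scalar on the value;
   [ball_ind_grow] then reaches s exactly. *)
have uall s (s0 : 0 < s) : ball_ind u s0 \in S.
  have [k ks] := ctr_small lf D w01 M s0.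
  have c0 := ctr_neq0 D w0 k; have o0 : (1 : T) != 0 by exact: oner_neq0.
  have s10 : 0 < N (ctr k) * M by rewrite mulr_gt0 // (nm_gt0 v).
  apply: (@ball_ind_grow _ _ s10) => //; first exact: ltW.
  have [c c00 cE] := ctr_scalar k.
  have tS : ind_act (tG (ctr k) 1) (ball_ind u M0) \in S by apply: SB => //; exact: borel_tG.
  have := tS; rewrite (@ball_ind_tG _ _ _ _ _ s10) //; last by rewrite (nm1 v) mulr1 mulrC.
  rewrite cE ball_indZ => /(submodZ Ssub c^-1); rewrite scalerA mulVf // scale1r //.
(* All radii are required at once because the torus changes the radius together with the value; only
   so is W stable under B. *)
pose W : {pred rho} := fun x => `[< forall s (s0 : 0 < s), ball_ind x s0 \in S >].
have Wall x : x \in W.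
  apply: (@rho_submodule_full _ D K rho irr W u) => //; last by apply/asboolP.
  - split.
      by apply/asboolP => s s0; rewrite ball_ind0; exact: submod0.
    move=> a x1 x2 /asboolP x1W /asboolP x2W; apply/asboolP => s s0.
    by rewrite ball_ind_linear; apply: (submodP Ssub); [exact: x1W|exact: x2W].
  - move=> b y bB /asboolP yW; apply/asboolP => s s0.
    have [a0 d0] := borel_diag bB; have tB' : borel D (tG (ea b) (ed b)) by exact: borel_tG.
    have tB2 : borel D (tG (ed b) (ea b)) by exact: borel_tG.
    rewrite [in RA b](borel_factor divD bB) (rep_actM tB' (borel_nU _)) /= rhoU.
    have na := nm_gt0 v a0; have nd := nm_gt0 v d0.
    have s'0 : 0 < s * N (ea b) / N (ed b) by rewrite divr_gt0 // mulr_gt0.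
    rewrite -(@ball_ind_tG (ed b) (ea b) _ s s'0 s0) //; first exact: SB (yW _ _).
    by rewrite divfK // gt_eqF.
move=> h h1; have [r [rpos r1 hr]] := ind_smooth h.
have [M1 M10 hM1] := ft_compact_support h1.
have [ys ysP] := net_exists v (Num.max M1 r) rpos.
rewrite (@ind_ball_sum h r (Num.max M1 r) ys rpos h1) //; last first.
- by move=> x y; exact: ft_shift rpos hr.
- by move=> x; rewrite ge_max => /andP[xM _]; exact: hM1.
- by rewrite le_max lexx orbT.
apply: submod_sum => // y _; apply: SB; first exact: borel_nU.
by have /asboolP := Wall (ft h y); apply.
Qed.

End BorelStable.

(** The function n(x) f - f lies in S and vanishes at 1. *)
Lemma borel_stable_inv_at1 (S : {pred I}) f x : submod_closed S ->
  (forall b f, borel D b -> f \in S -> ind_act b f \in S) ->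
  (forall f, f \in S -> f 1%g = 0 -> f = 0) -> f \in S -> ft f x = ft f 0.
Proof.
move=> Ssub SB S1 fS; have bB : borel D (nU x) by exact: borel_nU.
have : ind_act (nU x) f - f = 0.
  apply: S1; first by apply: submodB => //; exact: SB.
  by rewrite ind_funB ind_nU_at1 subrr.
by move=> /(congr1 (fun h : I => ft h 0)) /eqP; rewrite ftB ft_nU add0r subr_eq0 => /eqP.
Qed.

(** * Subspaces stable under G *)

Section GStable.
Variable S : {pred I}.
Hypothesis Ssub : submod_closed S.
Hypothesis SG : forall g f, f \in S -> ind_act g f \in S.

(** S contains the kernel of evaluation at 1. The translate by w of a ball function from this kernel
    has any prescribed value at 1, so evaluation maps S onto rho as well. *)
Lemma G_stable_full f : f \in S -> f != 0 -> f 1%g = 0 -> forall h : I, h \in S.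
Proof.
move=> fS f0 f1 h; have kS : forall h : I, h 1%g = 0 -> h \in S.
  by apply: (borel_stable_contains_kernel Ssub _ fS f0 f1) => b g _; exact: SG.
pose e := ind_act wG (ball_ind (h 1%g) ltr01).
have e1h : e 1%g = h 1%g.
  have : ft (ball_ind (h 1%g) ltr01) 0 = h 1%g by rewrite ft_ball (nm0 v) ltr01.
  by rewrite /ft nU0 mulg1 /e ind_actE mul1g.
rewrite -[h](subrK e); apply: submodD => //; last by apply: SG; apply: kS; exact: ball_ind1.
by apply: kS; rewrite ind_funB e1h subrr.
Qed.

Hypothesis S1 : forall f, f \in S -> f 1%g = 0 -> f = 0.

Lemma ctr_scale_small (e : R) (x y : T) : 0 < e -> exists k, N (x * ctr k) < e /\ N (y * ctr k) < e.
Proof.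
move=> e0; have [k kx] := ctr_small lf D w01 (Num.max (N x) (N y)) e0.
have aux (z : T) : N z <= Num.max (N x) (N y) -> N (z * ctr k) < e.
  move=> zM; rewrite (nmM v) mulrC; apply: le_lt_trans kx.
  by rewrite ler_wpM2l // (nm_ge0 v).
by exists k; split; apply: aux; rewrite le_max lexx ?orbT.
Qed.

(** Here [ft h] is constant for h in S, so h(1) = diag(z^-1, z) h(w) for every small z. Comparing z
    = [ctr k] with z = y [ctr k] shows that diag(y, y^-1) fixes h(1); these values form a nonzero
    B-stable subspace, hence all of rho. *)
Lemma G_stable_torus f : f \in S -> f != 0 -> forall (y : T) u, y != 0 ->
  RA (tG y y^-1) u = u.
Proof.
move=> fS f0 y u y0; have o0 : (1 : T) != 0 by exact: oner_neq0.
have SB b h : borel D b -> h \in S -> ind_act b h \in S by move=> _; exact: SG.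
have rel (h : I) (z : T) : h \in S -> z != 0 -> exists2 e : R, 0 < e &
    forall k, N (z * ctr k) < e -> h 1%g = RA (tG (z * ctr k)^-1 (z * ctr k)) (ft h 0).
  move=> hS z0; have [e [e0 _ he]] := ft_at_infinity h; exists e => // k zk.
  rewrite (he (z * ctr k)) //; last by apply: mulT_neq0 => //; exact: ctr_neq0.
  by rewrite (borel_stable_inv_at1 _ Ssub SB S1 hS).
have [h hS <-] : exists2 h : I, h \in S & h 1%g = u.
  pose W : {pred rho} := fun u => `[< exists2 h : I, h \in S & h 1%g = u >].
  suff /asboolP : u \in W by [].
  apply: (@rho_submodule_full _ D K rho irr W (f 1%g)).
  - split; first by apply/asboolP; exists 0 => //; exact: submod0.
    move=> a _ _ /asboolP[h1 h1S <-] /asboolP[h2 h2S <-]; apply/asboolP.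
    by exists (a *: h1 + h2) => //; exact: submodP.
  - move=> b _ bB /asboolP[h hS <-]; apply/asboolP; exists (ind_act b h); first exact: SG.
    exact: ind_borel_at1.
  - by apply/asboolP; exists f.
  - by apply: contraNneq f0 => f1; apply/eqP; exact: S1.
have [e1 e10 h1E] := rel h 1 hS o0; have [e2 e20 h2E] := rel h y hS y0.
have [k [kx ky]] : exists k, N (1 * ctr k) < Num.min e1 e2 /\ N (y * ctr k) < Num.min e1 e2.
  by apply: ctr_scale_small; rewrite lt_min e10.
have := h1E k; have := h2E k; rewrite !lt_min in kx ky.
case/andP: kx => kx _; case/andP: ky => _ ky => /(_ ky) hy /(_ kx) hx.
have c0 := ctr_neq0 D w0 k.
have yc0 : y * ctr k != 0 by exact: mulT_neq0.
have [cV yV] : (ctr k)^-1 != 0 /\ (y * ctr k)^-1 != 0 by split; exact: invT_neq0.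
have yE : y = (ctr k)^-1 * (y * ctr k) by rewrite -(ctrC w k) mulKr // divD.
have yVE : y^-1 = ctr k * (y * ctr k)^-1 by rewrite invrM ?divD // mulVKr // divD.
rewrite mul1r in kx hx.
have tB1 : borel D (tG (ctr k)^-1 (ctr k)) by exact: borel_tG.
have tB2 : borel D (tG (y * ctr k) (y * ctr k)^-1) by exact: borel_tG.
have tB3 : borel D (tG (y * ctr k)^-1 (y * ctr k)) by exact: borel_tG.
rewrite yVE [y in tG y]yE tGM // (rep_actM tB1 tB2) /= {1}hy -(RAM _ tB2 tB3) -tGM //.
by rewrite !(mulrV, mulVr) ?divD // tG1 // rep_act1 -hx.
Qed.

End GStable.

End InducedRepresentation.

(** * Characters of GL(2, D) *)

Lemma valued_infinite (R : realType) (F : fieldType) (absF : F -> R) (w : F) (t : seq F) :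
  valued absF -> 0 < absF w < 1 -> exists a, a \notin t.
Proof.
move=> vF /andP[w0 w1]; apply: contrapT => nt.
have wt : {subset mkseq (GRing.exp w) (size t).+1 <= t}.
  by move=> a _; case: (boolP (a \in t)) => // at_; case: nt; exists a.
have inj : injective (GRing.exp w).
  by move=> i j /(congr1 absF); rewrite !(nmX vF); apply: ieexprIn => //; rewrite lt_eqF.
have := uniq_leq_size (mkseq_uniq (size t).+1 inj) wt.
by rewrite size_mkseq ltnn.
Qed.

Section UnitCharacters.
Variables (G : groupType) (K : fieldType) (chi : {multiplicative G -> units K}).

Lemma char_valM g h : uval (chi (g * h)%g) = uval (chi g) * uval (chi h).
Proof. by rewrite gmulfM. Qed.

Lemma char_val_neq0 g : uval (chi g) != 0.
Proof. by apply: contraPneq (uvalK (chi g)) => ->; rewrite mul0r => /esym/eqP; rewrite oner_eq0. Qed.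

Lemma char_val1 : uval (chi 1%g) = 1.
Proof. by apply: (mulfI (char_val_neq0 1%g)); rewrite -char_valM mul1g mulr1. Qed.

Lemma char_valC g h : uval (chi (g * h)%g) = uval (chi (h * g)%g).
Proof. by rewrite !char_valM mulrC. Qed.

Lemma char_val_conj g h : uval (chi (g * h * g^-1)%g) = uval (chi h).
Proof. by rewrite char_valC mulKg. Qed.

End UnitCharacters.

Section CharactersOfGL2.
Variables (R : realType) (p d : nat) (F : topologicalFieldType) (absF : F -> R).
Hypothesis lf : nonarch_local_field p absF.
Variable D : falgType F.
Local Notation T := (algtop D).
Local Notation G := (GL2 D).
Hypothesis divD : forall x : T, x != 0 -> x \is a GRing.unit.
Local Notation N := (@nT R F absF D).
Let v : valued N := valued_nT lf divD.
Variable w : F.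
Hypothesis w0 : w != 0.
Hypothesis w01 : 0 < absF w < 1.

(** The commutator of diag(c, 1) and n(x) is n((c - 1) x), and c - 1 is invertible because N c < 1.
    So every character of G is trivial on unipotents. *)
Lemma nU_commutator y : exists g h : G, nU y = (g * h * g^-1 * h^-1)%g.
Proof.
pose c := ctr D w 1; have c0 : c != 0 by exact: ctr_neq0.
have nc : N c < 1 by rewrite /c (nm_ctr lf) expr1; case/andP: (nm_ctr1 D w01).
have c1 : c - 1 != 0.
  by rewrite subr_eq0; apply: contraTneq nc => ->; rewrite (nm1 v) ltxx.
have o0 : (1 : T) != 0 by exact: oner_neq0.
exists (tG c 1), (nU ((c - 1)^-1 * y)).
rewrite tG_nU // mulgK -nUN -nUD invr1 mulr1; congr nU.
by rewrite -[X in _ - X]mul1r -mulrBl mulVKr // divD.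
Qed.

Lemma char_val_nU (K : fieldType) (chi : {multiplicative G -> units K}) y : uval (chi (nU y)) = 1.
Proof.
have [g [h ->]] := nU_commutator y.
by rewrite char_valM char_val_conj -char_valM mulgV char_val1.
Qed.

Lemma nL_conj y : nL y = (wG * nU (- y) * wG^-1 : G)%g.
Proof.
by apply: G_eq; rewrite !eM !e_wGV !e_nU !e_wG e_nL !simpr01 // ?mulrN1 ?mulN1r ?opprK.
Qed.

Lemma char_val_nL (K : fieldType) (chi : {multiplicative G -> units K}) y : uval (chi (nL y)) = 1.
Proof. by rewrite nL_conj char_val_conj char_val_nU. Qed.

(** diag(1, b) is conjugate to diag(b, 1) by w. *)
Lemma char_val_tG (K : fieldType) (chi : {multiplicative G -> units K}) a b : a != 0 -> b != 0 ->
  uval (chi (tG a b)) = uval (chi (tG a 1)) * uval (chi (tG b 1)).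
Proof.
move=> a0 b0; have o0 : (1 : T) != 0 by exact: oner_neq0.
have -> : tG b 1 = (wG^-1 * tG 1 b * wG)%g :> G.
  by rewrite -mulgA -wG_tG // mulKg.
have := char_val_conj chi (wG^-1)%g (tG 1 b); rewrite invgK => ->.
by rewrite -char_valM -tGM // mulr1 mul1r.
Qed.

(* By the Iwahori factorization, k is n^-(y) b with b in the Borel subgroup. *)
Lemma char_val_Kr (K : fieldType) (chi : {multiplicative G -> units K}) r k : 0 < r <= 1 ->
  (forall b, borel D b -> N (ea b - 1) < r -> N (ed b - 1) < r -> uval (chi b) = 1) ->
  Kr absF r k -> uval (chi k) = 1.
Proof.
move=> /andP[r0 r1] chiB [[ka kb kc kd] _].
have na := nT_near1 lf divD r1 ka.
have a0 : ea k != 0 by apply: (nm_neq0 v); rewrite na oner_neq0.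
pose y := ec k * (ea k)^-1; pose b := (nL (- y) * k)%g.
have yE : y * ea k = ec k by rewrite /y mulrVK // divD.
have -> : k = (nL y * b)%g.
  rewrite mulgA (_ : nL y * nL (- y) = 1)%g ?mul1g //.
  by apply: G_eq; rewrite !eM !e_nL !e1 !simpr01 // subrr.
rewrite char_valM char_val_nL mul1r; apply: chiB.
- by apply/borelE; rewrite /b !eM !e_nL mul1r mulNr yE addNr.
- by rewrite /b !eM !e_nL !simpr01.
rewrite /b !eM !e_nL mul1r mulNr -addrA; apply: (nmD_lt v) => //.
have ny : N y < r by rewrite /y (nmM v) (nmV v) na invr1 mulr1.
rewrite (nmN v) (nmM v); apply: le_lt_trans ny; rewrite ler_piMr ?(nm_ge0 v) //.
by apply: le_trans (ltW kb) r1.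
Qed.

Hypothesis d0 : (0 < d)%N.
Hypothesis dimD : \dim {:D} = (d ^ 2)%N.
Hypothesis centD : 'Z({:D})%VS = 1%VS.
Variable detG : {multiplicative G -> units F}.
Hypothesis redN : is_reduced_norm d detG.

(** At x = 0 the matrix is not invertible and [tG] falls back to 1, whence the condition x != 0 in
    what follows. *)
Definition nrd (x : T) : F := uval (detG (tG x 1)).

Lemma nrdM (x y : T) : x != 0 -> y != 0 -> nrd (x * y) = nrd x * nrd y.
Proof.
by move=> x0 y0; rewrite /nrd -char_valM -tGM ?oner_neq0 // mulr1.
Qed.

Lemma nrd_minpoly (x : D) m : x != 0 -> m \is monic -> irreducible_poly m ->
  horner_alg x m = 0 -> exists2 r, (r * (size m).-1 = d)%N & nrd x = (-1) ^+ d * (m ^+ r).[0].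
Proof.
case: redN => E [j [phi [phiA phiD]]].
have infF t : exists a, a \notin t := valued_infinite t (valued_absF lf) w01.
have phi_nrd : forall x : D, x != 0 -> \det (phi (mx22 x 0 0 1)) = j (nrd x).
  by move=> y y0; rewrite -phiD tGE // oner_neq0.
exact: (@reduced_normE F D E j d phi nrd infF phiA phi_nrd x m).
Qed.

Lemma nrd_character (K : fieldType) (lam : T -> K) r : p \in [pchar K] -> 0 < r ->
  (forall x y, x != 0 -> y != 0 -> lam (x * y) = lam x * lam y) ->
  (forall x, N (x - 1) < r -> lam x = 1) ->
  exists rho : F -> K,
  [/\ forall a b, a != 0 -> b != 0 -> rho (a * b) = rho a * rho b,
      forall a, absF (a - 1) < 1 -> rho a = 1,
      forall a, a != 0 -> rho a != 0
    & forall x : T, x != 0 -> lam x = rho (nrd x)].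
Proof.
move=> pK r0 lamM lam1; have [p_pr ps] := residue_pchar lf.
apply: (@smooth_character_factors_nrd R p d F absF D N nrd K lam r (valued_absF lf) v) => //.
- have [c c0 low] := normD_lower lf divD; exists (1 + c^-1) => x i x1.
  have [cl|cl] := leP (absF (coordrow x 0 i)) 1.
    by apply: le_trans cl _; rewrite lerDl invr_ge0 ltW.
  have c1 : absF (coordrow x 0 i) ^+ (\dim {:D}) <= c^-1.
    by rewrite -[c^-1]mulr1 ler_pdivlMl //; exact: le_trans (low x i) x1.
  apply: le_trans (_ : c^-1 <= _); last by rewrite lerDr.
  apply: le_trans c1; apply: expr_ge_self => //; [exact: adim_gt0|exact: ltW].
- by exists w => //; case/andP: w01.
- exact: nrdM.
- exact: nrd_minpoly.
Qed.

End CharactersOfGL2.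

(** * Irreducibility and the character case *)

Lemma scaler_injl (K : fieldType) (V : lmodType K) (u : V) : u != 0 -> injective (fun c : K => c *: u).
Proof.
move=> u0 a b /= ab; apply/eqP; rewrite -subr_eq0.
by have := scaler_eq0 (a - b) u; rewrite scalerBl ab subrr eqxx (negPf u0) orbF => <-.
Qed.

Section Main.
Variables (R : realType) (p d : nat) (F : topologicalFieldType) (absF : F -> R).
Hypothesis lf : nonarch_local_field p absF.
Variable D : falgType F.
Local Notation T := (algtop D).
Local Notation G := (GL2 D).
Hypothesis divD : forall x : T, x != 0 -> x \is a GRing.unit.
Local Notation N := (@nT R F absF D).
Let v : valued N := valued_nT lf divD.
Variable w : F.
Hypothesis w0 : w != 0.
Hypothesis w01 : 0 < absF w < 1.
Variables (K : closedFieldType) (rho : rep K (borel D)).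
Local Notation RA := (rep_act rho).
Local Notation Kr := (@Kr R F absF D).
Local Notation I := (ind_space rho).
Hypothesis rhoU : forall x u, RA (nU x) u = u.
Variable r0 : R.
Hypothesis r0_gt0 : 0 < r0.
Hypothesis r0_le1 : r0 <= 1.
Hypothesis rho1 : forall b x, borel D b -> N (ea b - 1) < r0 -> N (ed b - 1) < r0 -> RA b x = x.
Hypothesis irr : irreducible rho.
Hypothesis schur : forall phi : {linear rho -> rho},
  (forall b x, borel D b -> phi (RA b x) = RA b (phi x)) -> exists c, forall x, phi x = c *: x.
Hypothesis pK : p \in [pchar K].
Hypothesis d0 : (0 < d)%N.
Hypothesis dimD : \dim {:D} = (d ^ 2)%N.
Hypothesis centD : 'Z({:D})%VS = 1%VS.
Variable detG : {multiplicative G -> units F}.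
Hypothesis redN : is_reduced_norm d detG.

Let o0 : (1 : T) != 0. Proof. exact: oner_neq0. Qed.
Let ball := ball_ind lf divD r0_gt0 r0_le1 rho1.

(** diag(a, 1) and diag(1, a) act alike, and diag(a, 1) commutes with diag(1, b). So diag(a, 1)
    commutes with the action of B and is a scalar lam(a) by Schur's lemma, although D may be
    noncommutative. *)
Lemma torus_characters : (forall (y : T) u, y != 0 -> RA (tG y y^-1) u = u) ->
  exists lam : T -> K, [/\ forall x y, x != 0 -> y != 0 -> lam (x * y) = lam x * lam y,
    forall x, N (x - 1) < r0 -> lam x = 1
  & forall b u, borel D b -> RA b u = (lam (ea b) * lam (ed b)) *: u].
Proof.
move=> rhoT; have [[u0 u00] _] := irr.
have B1 a : a != 0 -> borel D (tG a 1) by move=> a0; exact: borel_tG.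
have B2 a : a != 0 -> borel D (tG 1 a) by move=> a0; exact: borel_tG.
have BV a : a != 0 -> borel D (tG a a^-1).
  by move=> a0; apply: borel_tG => //; exact: invT_neq0.
have swap a u : a != 0 -> RA (tG a 1) u = RA (tG 1 a) u.
  move=> a0; have aV := invT_neq0 a0.
  have -> : tG a 1 = (tG a a^-1 * tG 1 a)%g by rewrite -tGM // mulr1 mulVr // divD.
  by rewrite (RAM _ (BV a a0) (B2 a a0)) rhoT.
have split_tG a b u : a != 0 -> b != 0 -> RA (tG a b) u = RA (tG a 1) (RA (tG b 1) u).
  by move=> a0 b0; rewrite (swap b) // -(RAM _ (B1 a a0) (B2 b b0)) -tGM // mulr1 mul1r.
have comm a b u : a != 0 -> b != 0 -> RA (tG a 1) (RA (tG b 1) u) = RA (tG b 1) (RA (tG a 1) u).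
  move=> a0 b0; rewrite -split_tG // (swap b (RA (tG a 1) u)) // -(RAM _ (B2 b b0) (B1 a a0)).
  by rewrite -tGM // mulr1 mul1r.
have RAd b u : borel D b -> RA b u = RA (tG (ea b) 1) (RA (tG (ed b) 1) u).
  move=> bB; have [a0 b0] := borel_diag bB.
  have tB : borel D (tG (ea b) (ed b)) by exact: borel_tG.
  by rewrite [in LHS](borel_factor divD bB) (rep_actM tB (borel_nU _)) /= rhoU split_tG.
have /choice[lam lamE] : forall a : T, exists c : K, a != 0 -> forall u, RA (tG a 1) u = c *: u.
  move=> a; have [a00|a0] := eqVneq a 0; first by exists 0 => /eqP.
  have [b u bB|c cE] := schur (phi := RA (tG a 1)); last by exists c.
  have [ba bd] := borel_diag bB.
  by rewrite !(RAd b) // (comm a (ea b)) // (comm a (ed b)).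
exists lam; split=> [x y x0 y0|x x1|b u bB].
- apply: (scaler_injl u00); rewrite -scalerA -!lamE //; last by apply: mulT_neq0.
  by rewrite -(RAM _ (B1 x x0) (B1 y y0)) -tGM // mulr1.
- have x0 : x != 0 by apply: (nm_neq0 v); rewrite (nT_near1 lf divD r0_le1 x1) oner_neq0.
  apply: (scaler_injl u00); rewrite -lamE // scale1r rho1 ?(e_tG divD) //; first exact: B1.
  by rewrite subrr (nm0 v).
have [a0 b0] := borel_diag bB.
by rewrite RAd // !lamE // scalerA.
Qed.

(* Junk value 1 unless x * y = 1. *)
Definition unit_of (x y : K) : units K :=
  if pselect (x * y = 1) is left xy then mk_unit xy (etrans (mulrC y x) xy) else 1%g.

Lemma unit_ofE x y : x * y = 1 -> uval (unit_of x y) = x.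
Proof. by move=> xy; rewrite /unit_of; case: pselect. Qed.

Lemma rho_is_character : (forall (y : T) u, y != 0 -> RA (tG y y^-1) u = u) ->
  exists rho0 : {multiplicative units F -> units K},
    smooth (char_rep setT rho0) /\ rep_iso (char_rep (borel D) (rho0 \o detG)) rho.
Proof.
move=> rhoT; have [lam [lamM lam1 lamE]] := torus_characters rhoT.
have [chi [chiM chi1 chi0 chiE]] :=
  nrd_character lf divD w0 w01 d0 dimD centD redN pK r0_gt0 lamM lam1.
have vF := valued_absF lf.
have chi11 : chi 1 = 1 by apply: chi1; rewrite subrr (nm0 vF).
have uF (a : units F) : uval a != 0.
  by apply: contraPneq (uvalK a) => ->; rewrite mul0r => /esym/eqP; rewrite oner_eq0.
have uFV (a : units F) : uinv a != 0.
  by apply: contraPneq (uvalK a) => ->; rewrite mulr0 => /esym/eqP; rewrite oner_eq0.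
have chiV (a : units F) : chi (uval a) * chi (uinv a) = 1 by rewrite -chiM // uvalK.
pose f (a : units F) := unit_of (chi (uval a)) (chi (uinv a)).
have fE a : uval (f a) = chi (uval a) by rewrite unit_ofE.
have fM : {morph f : a b / (a * b)%g}.
  move=> a b; apply: units_inj; change (uval (f (a * b)%g) = uval (f a) * uval (f b)).
  by rewrite !fE -chiM.
pose fMi := isMultiplicative.Build _ _ f fM.
pose rho0 : {multiplicative units F -> units K} := HB.pack f fMi.
have rho0E a : uval (rho0 a) = chi (uval a) by exact: fE.
exists rho0; split.
  (* If |b - a| < |a| then b / a is a principal unit, on which chi is trivial; so stabilizers are
     open. *)
  move=> c; exists (stabilizer (V := char_rep setT rho0) c); last by rewrite setIT.
  rewrite openE => a [_ ac].
  have na : 0 < absF (uval a) by exact: nm_gt0.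
  have : nbhs (uval a) [set y | absF (y - uval a) < absF (uval a)].
    by apply/(absF_nbhs lf); exists (absF (uval a)).
  move=> /(@uval_continuous F a) ua.
  have {}ua : nbhs a [set b : units F | absF (uval b - uval a) < absF (uval a)] by exact: ua.
  apply: (filterS _ ua) => b /= ba; split=> //.
  rewrite -[RHS]ac /= /char_act !rho0E; congr (_ *: _).
  have -> : uval b = uval b / uval a * uval a by rewrite divfK.
  rewrite chiM ?mulf_neq0 ?invr_eq0 // chi1 ?mul1r //.
  rewrite -[X in _ - X](divff (uF a)) -mulrBl (nmM vF) (nmV vF).
  by rewrite ltr_pdivrMr // mul1r.
have [[u u0] _] := irr.
have RAE b x : borel D b -> RA b x = uval (rho0 (detG b)) *: x.
  move=> bB; have [a0 b0] := borel_diag bB.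
  rewrite lamE // rho0E [in detG b](borel_factor divD bB) char_valM.
  rewrite (char_val_nU lf divD w0 w01) mulr1 (char_val_tG divD) // chiM //;
  by rewrite !chiE.
have lin : linear (fun c : K^o => c *: u) by move=> a x y; rewrite scalerDl scalerA.
pose li := GRing.isLinear.Build _ _ _ _ _ lin.
pose g : {linear K^o -> rho} := HB.pack (fun c : K^o => c *: u) li.
have gact b (c : char_rep (borel D) (rho0 \o detG)) : borel D b ->
    g (rep_act (char_rep (borel D) (rho0 \o detG)) b c) = RA b (g c).
  by move=> bB; rewrite RAE // /= scalerA.
exists (@RepHom K G (borel D) (char_rep (borel D) (rho0 \o detG)) rho g gact).
(* B acts through scalars, so the line of u is B-stable and fills rho. *)
have /choice[h hE] : forall x : rho, exists c, c *: u = x.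
  move=> x; pose S : {pred rho} := fun x => `[< exists c, c *: u = x >].
  suff /asboolP : x \in S by [].
  apply: (@rho_submodule_full _ D K rho irr S u) => //.
  - split; first by apply/asboolP; exists 0; rewrite scale0r.
    move=> a _ _ /asboolP[c1 <-] /asboolP[c2 <-]; apply/asboolP.
    by exists (a * c1 + c2); rewrite scalerDl scalerA.
  - move=> b _ bB /asboolP[c <-]; apply/asboolP; exists (uval (rho0 (detG b)) * c).
    by rewrite RAE // scalerA.
  - by apply/asboolP; exists 1; rewrite scale1r.
by exists h => [c|x] /=; [apply: (scaler_injl u0); rewrite hE|exact: hE].
Qed.

Lemma ball_neq0 s (s0 : 0 < s) u : u != 0 -> ball u s0 != 0.
Proof. by apply: contraNneq => /ball_ind_eq0 ->. Qed.

Lemma G_stable_dichotomy (S : {pred I}) : submod_closed S ->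
  (forall g f, f \in S -> ind_act g f \in S) ->
  (forall h, h \in S) \/ (forall f, f \in S -> f 1%g = 0 -> f = 0).
Proof.
move=> Ssub SG; have [[f [fS f0 f1]]|nf] :=
  pselect (exists f : I, [/\ f \in S, f != 0 & f 1%g = 0]).
  by left; exact: (G_stable_full lf divD rhoU r0_gt0 r0_le1 rho1 irr schur pK w0 w01 Ssub SG fS f0 f1).
right=> f fS f1; have [//|f0] := eqVneq f 0.
by case: nf; exists f.
Qed.

Theorem Ind_irreducible :
  ~ (exists rho0 : {multiplicative units F -> units K},
      smooth (char_rep setT rho0) /\ rep_iso (char_rep (borel D) (rho0 \o detG)) rho) ->
  irreducible (Ind rho).
Proof.
move=> nchar; split.
  have [[u u0] _] := irr; exists (ball u ltr01); exact: ball_neq0.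
move=> S Ssub SG'; have SG g f : f \in S -> ind_act g f \in S by exact: SG'.
have [Sall|S1] := G_stable_dichotomy Ssub SG; first by right.
left=> f fS; have [//|f0] := eqVneq f 0.
case: nchar; apply: rho_is_character => y u y0.
exact: (G_stable_torus lf divD rhoU irr w0 w01 Ssub SG S1 fS f0).
Qed.

(** * Induction of a character that extends to G *)

Section CharacterCase.
Variable rho0 : {multiplicative units F -> units K}.
Local Notation chiG := (rho0 \o detG : {multiplicative G -> units K}).
Local Notation chi := (char_rep setT chiG).
Variable e : rep_hom (char_rep (borel D) chiG) rho.
Hypothesis e_bij : bijective e.
Let cc (g : G) : K := uval (chiG g).

Let e_inj : injective e. Proof. exact: bij_inj. Qed.

Let ccM g h : cc (g * h)%g = cc g * cc h. Proof. exact: (char_valM chiG). Qed.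

Let e_act b (c : K^o) : borel D b -> e (cc b * c) = RA b (e c).
Proof. by move=> bB; rewrite -hom_act. Qed.

(** Local constancy of the character on G is drawn from rho: [rho1] gives it on B, and [char_val_Kr]
    extends it to [Kr]. *)
Let cc_Kr k : Kr r0 k -> cc k = 1.
Proof.
apply: (char_val_Kr lf divD w0 w01); first by rewrite r0_gt0.
move=> b bB ba bd; apply: e_inj; rewrite -[X in e X]mulr1 -/(cc b).
by rewrite (e_act (1 : K^o) bB) rho1.
Qed.

Fact char_fun_subproof (c : K^o) : (fun g => e (cc g * c)) \in @ind_pred K G (borel D) rho.
Proof.
apply/asboolP; split=> [b g bB|]; first by rewrite ccM -mulrA e_act.
exists (Kr r0); first by apply: (Kr_open lf divD); rewrite r0_gt0.
by move=> g k kK; rewrite ccM (cc_Kr kK) mulr1.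
Qed.

Definition char_fun (c : chi) : Ind rho := IndSpace (char_fun_subproof c).

Fact char_fun_linear : linear char_fun.
Proof.
move=> a x y; apply: ind_eq => g; rewrite ind_funD ind_funZ /=.
by rewrite -linearP mulrDr -[a *: (_ * _)]/(a * (_ * _)) mulrCA.
Qed.
HB.instance Definition _ := GRing.isLinear.Build K chi (Ind rho) _ char_fun char_fun_linear.

Fact char_fun_act g (c : chi) : [set: G] g -> char_fun (rep_act chi g c) = rep_act (Ind rho) g (char_fun c).
Proof.
move=> _; apply: ind_eq => h; rewrite [RHS]/(e (cc (h * g)%g * c)) ccM -mulrA.
by [].
Qed.

Definition char_hom : rep_hom chi (Ind rho) := @RepHom K G setT chi (Ind rho) char_fun char_fun_act.

Lemma char_hom1 c : ind_fun (char_hom c) 1%g = e c.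
Proof. by rewrite /= /cc char_val1 mul1r. Qed.

Lemma char_hom_inj : injective char_hom.
Proof. by move=> a b /(congr1 (fun f : I => f 1%g)); rewrite !char_hom1 => /e_inj. Qed.

Lemma char_hom_at1 u : exists c, ind_fun (char_hom c) 1%g = u.
Proof. by case: e_bij => e' e'K eK; exists (e' u); rewrite char_hom1 eK. Qed.

Lemma ft_char_hom c x : ft (char_hom c) x = ft (char_hom c) 0.
Proof.
have xE y : ft (char_hom c) y = e (cc wG * c).
  by rewrite /ft /= ccM /cc (char_val_nU lf divD w0 w01) mulr1.
by rewrite !xE.
Qed.

(** Subtract the character function with the same value at 1: on the big cell the difference is
    constant and compactly supported, hence zero. *)
Lemma char_hom_eq (f : I) : (forall x, ft f x = ft f 0) -> exists c, char_hom c = f.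
Proof.
move=> fc; have [c c1] := char_hom_at1 (f 1%g); exists c.
have g1 : (char_hom c - f : I) 1%g = 0 by rewrite ind_funB c1 subrr.
have [M _ gM] := ft_compact_support lf divD rhoU g1.
have [x xM] : exists x, M <= N x.
  have [k kM] := ctr_small lf D w01 M ltr01; exists (ctr D w k)^-1.
  have k0 : 0 < N (ctr D w k) by rewrite (nm_gt0 v) // ctr_neq0.
  by rewrite (nmV v) -div1r ler_pdivlMr // mulrC ltW.
have gc y : ft (char_hom c - f : I) y = ft (char_hom c - f : I) x.
  by rewrite !ftB !(ft_char_hom c y) !(ft_char_hom c x) (fc y) (fc x).
apply/eqP; rewrite -subr_eq0; apply/eqP; apply: ind_ft_eq => // y.
by rewrite gc gM.
Qed.

Lemma char_short_exact : short_exact char_hom (coker_proj char_hom).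
Proof.
split; first exact: char_hom_inj.
  move=> f; rewrite -[X in _ = X](linear0 (coker_proj char_hom)).
  rewrite [X in X <-> _](lmodpi_eq char_hom f 0) subr0.
  by split=> [/limageP|] [c cE]; [exists c|apply/limageP; exists c].
by move=> x; exists (lmodrepr x); exact: lmodreprK.
Qed.

Lemma char_irreducible : irreducible chi.
Proof.
split; first by exists (1 : K^o); exact: oner_neq0.
move=> S Ssub _; have [[c [cS c0]]|nc] := pselect (exists c : chi, c \in S /\ c != 0).
  right=> x; have -> : x = (x * c^-1 : K) *: c by rewrite /GRing.scale /= divfK.
  exact: submodZ.
by left=> x xS; have [//|x0] := eqVneq x 0; case: nc; exists x.
Qed.

Lemma coker_proj_eq0 f : coker_proj char_hom f = 0 -> exists c, char_hom c = f.
Proof. by case: char_short_exact => _ /(_ f) [H _] _ /H. Qed.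

Lemma coker_proj_char c : coker_proj char_hom (char_hom c) = 0.
Proof. by case: char_short_exact => _ /(_ (char_hom c)) [_ H] _; apply: H; exists c. Qed.

Let u_ex : exists u : rho, u != 0. Proof. by case: irr. Qed.

Lemma ball_not_char u s (s0 : 0 < s) c : char_hom c = ball u s0 -> u = 0.
Proof.
move=> cE; have := char_hom1 c; rewrite cE ball_ind1 => /esym e0.
have c0 : c = 0 by apply: e_inj; rewrite e0 linear0.
by move: cE; rewrite c0 linear0 => /esym/ball_ind_eq0.
Qed.

(** Apply the dichotomy to the preimage of S. If evaluation at 1 is injective on it, its elements
    are constant on the big cell, so they are character functions and S is zero. *)
Lemma coker_irreducible : irreducible (coker char_hom).
Proof.
have [u u0] := u_ex; pose q := coker_proj char_hom.
split.
  exists (q (ball u ltr01)); apply: contraNneq u0 => /coker_proj_eq0[c cE].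
  by apply/eqP; exact: ball_not_char cE.
move=> S Ssub SG; pose S' : {pred I} := fun f => q f \in S.
have S'sub : submod_closed S'.
  split; first by rewrite -[_ \in _]/(q 0 \in S) linear0 submod0.
  move=> a f g fS gS; rewrite -[_ \in _]/(q _ \in S) linearP; exact: submodP.
have S'G g f : f \in S' -> ind_act g f \in S'.
  move=> fS; rewrite -[_ \in _]/(q (rep_act (Ind rho) g f) \in S) hom_act //; exact: SG.
have [S'all|S'1] := G_stable_dichotomy S'sub S'G.
  by right=> x; rewrite -[x]lmodreprK; exact: S'all.
left=> x xS; have fS : (lmodrepr x : I) \in S' by rewrite -[_ \in _]/(q _ \in S) [q _]lmodreprK.
have SB b f : borel D b -> f \in S' -> ind_act b f \in S' by move=> _; exact: S'G.
have [|c cE] := @char_hom_eq (lmodrepr x).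
  by move=> y; apply: (borel_stable_inv_at1 rhoU _ S'sub SB S'1 fS).
by rewrite -[x]lmodreprK -cE; exact: coker_proj_char.
Qed.

(** The f with s(q f) = f form the image of the section s. If they are everything, the character
    line, killed by q, is zero; if evaluation at 1 is injective on them, they are character
    functions, and the quotient is zero although it contains the class of a ball. *)
Lemma char_not_split : ~ split_epi (coker_proj char_hom).
Proof.
case=> s sK; pose q := coker_proj char_hom; pose S : {pred I} := fun f => s (q f) == f.
have Ssub : submod_closed S.
  split; first by rewrite -[_ \in _]/(s (q 0) == 0) !linear0.
  move=> a f g /eqP fS /eqP gS; rewrite -[_ \in _]/(s (q _) == _) !linearP.
  by apply/eqP; congr (_ *: _ + _).
have SG g f : f \in S -> ind_act g f \in S.
  move=> /eqP fS; rewrite -[_ \in _]/(s (q (rep_act (Ind rho) g f)) == rep_act (Ind rho) g f).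
  by rewrite !hom_act // fS.
have SB b f : borel D b -> f \in S -> ind_act b f \in S by move=> _; exact: SG.
have [Sall|S1] := G_stable_dichotomy Ssub SG.
  have /eqP := Sall (char_hom (1 : K^o)); rewrite /q coker_proj_char linear0.
  move=> /esym; rewrite -(linear0 char_hom) => /char_hom_inj /eqP.
  by rewrite (oner_eq0 K).
have [u u0] := u_ex; have := sK (q (ball u ltr01)).
set x := q _ => xE; have fS : (s x : I) \in S by rewrite -[_ \in _]/(s (q (s x)) == s x) [q _]xE.
have [|c cE] := @char_hom_eq (s x).
  by move=> y; apply: (borel_stable_inv_at1 rhoU _ Ssub SB S1 fS).
have x0 : x = 0 by rewrite -xE -cE; exact: coker_proj_char.
have [c' c'E] := coker_proj_eq0 x0.
by move: u0; rewrite (ball_not_char c'E) eqxx.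
Qed.

(** Unipotents act trivially on the character, so an isomorphism would make a ball function
    invariant under N modulo character functions. The difference vanishes at 1, so the invariance is
    exact and the ball function would be constant on the big cell. *)
Lemma char_not_iso_coker : ~ rep_iso chi (coker char_hom).
Proof.
case=> psi [psi' psiK psiK']; have [u u0] := u_ex; pose q := coker_proj char_hom.
have [c cE] : exists c, psi c = q (ball u ltr01) by exists (psi' (q (ball u ltr01))).
have inv y : ind_act (nU y) (ball u ltr01) = ball u ltr01.
  have chi_nU : rep_act chi (nU y) c = c.
    by rewrite /= /char_act (char_val_nU lf divD w0 w01) scale1r.
  have qy : q (rep_act (Ind rho) (nU y) (ball u ltr01) - ball u ltr01) = 0.
    by rewrite linearB hom_act // -cE -hom_act // chi_nU subrr.
  have [c' c'E] := coker_proj_eq0 qy.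
  have c'0 : c' = 0.
    apply: e_inj; rewrite linear0 -char_hom1 c'E ind_funB.
    by rewrite [X in X - _]ind_nU_at1 // subrr.
  by move/eqP: c'E; rewrite c'0 linear0 eq_sym subr_eq0 => /eqP.
have [|c' c'E] := @char_hom_eq (ball u ltr01).
  by move=> x; rewrite -[x in LHS]add0r -ft_nU inv.
by move: u0; rewrite (ball_not_char c'E) eqxx.
Qed.

End CharacterCase.

End Main.

Theorem mainTheorem1 (R : realType) (p : nat)
    (F : topologicalFieldType) (absF : F -> R)
    (d : nat) (D : falgType F)
    (detG : {multiplicative GL2 D -> units F})
    (K : closedFieldType) (iota : {rmorphism 'F_p -> K})
    (rho : rep K (borel D)) :
  nonarch_local_field p absF ->
  (1 <= d)%N -> \dim {:D} = (d ^ 2)%N -> central_division_algebra D ->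
  is_reduced_norm d detG ->
  integralRange iota ->
  smooth rho -> irreducible rho -> admissible rho ->
  (forall (rho0 : {multiplicative units F -> units K})
      (e : rep_hom (char_rep (borel D) (rho0 \o detG)) rho),
    smooth (char_rep setT rho0) -> bijective e ->
    let chi := char_rep setT (rho0 \o detG) in
    exists i : rep_hom chi (Ind rho),
      let St := coker i in
      [/\ forall g, i 1 g = e (uval (rho0 (detG g))),
          short_exact i (coker_proj i),
          ~ split_epi (coker_proj i),
          irreducible chi /\ irreducible St
        & ~ rep_iso chi St])
  /\
  ((~ exists rho0 : {multiplicative units F -> units K},
      smooth (char_rep setT rho0) /\
      rep_iso (char_rep (borel D) (rho0 \o detG)) rho) ->
   irreducible (Ind rho)).
Proof.
move=> lf d0 dimD [divD centD] redN _ sm irr adm.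
have [w w0 w01] := uniformizer_exists lf.
have rhoU := rho_unipotent lf divD w0 w01 sm adm.
have [r0 [r00 r01 rho1]] := rho_near1 lf divD w0 w01 sm adm irr.
have schur := schur_scalar lf divD w0 w01 sm adm irr.
have [p_pr _] := residue_pchar lf.
have pK : p \in [pchar K] by apply: (rmorph_pchar iota); exact: pchar_Fp.
split=> [rho0 e _ e_bij chi|nchar]; last first.
  exact: (Ind_irreducible lf divD w0 w01 rhoU r00 r01 rho1 irr schur pK d0 dimD centD redN nchar).
exists (char_hom lf divD w0 w01 r00 r01 rho1 e_bij); split.
- by move=> g; rewrite /= mulr1.
- exact: char_short_exact.
- exact: char_not_split.
- split; first exact: char_irreducible.
  exact: coker_irreducible.
- exact: char_not_iso_coker.
Qed.
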